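(* Assume $\xi:[0,\infty)\to\mathcal{P}^\perp$ is a classical solution of $$\partial E^*(\dot\xi(t))+\mathcal{J}^*(\xi(t))\ni0\quad\text{a.e. }t\ge0.$$ Then $\xi$ is a weak solution of this equation.
   Context: A constant width body is a compact convex $K\subset\mathbb{R}^3$ in which parallel supporting planes are at distance $1$ in every direction; equivalently its support function $H(u)=\max_{x\in K}x\cdot u$ satisfies $H(u)+H(-u)=|u|$ for all $u\in\mathbb{R}^3$. $\sigma$ is the surface measure on the unit sphere $\mathbb{S}^2\subset\mathbb{R}^3$, $\sigma(\mathbb{S}^2)=4\pi$. Spaces. $C(\mathbb{S}^2)$ has the sup norm; $\mathcal{P}=\{u\mapsto a\cdot u: a\in\mathbb{R}^3\}\subset C(\mathbb{S}^2)$; $\mathbf{g}=g+\mathcal{P}$ denotes the class of $g$; $\|\mathbf{g}\|=\inf_{a\in\mathbb{R}^3}\max_{|u|=1}|g(u)+a\cdot u|$ on $C(\mathbb{S}^2)/\mathcal{P}$. $M(\mathbb{S}^2)$ is the space of finite signed Radon measures, $\langle\xi,g\rangle=\int_{\mathbb{S}^2}g\,d\xi$, and $\mathcal{P}^\perp=\{\xi\in M(\mathbb{S}^2):\xi|_{\mathcal{P}}=0\}$, the dual of $C(\mathbb{S}^2)/\mathcal{P}$, with norm $\|\xi\|_*=\sup\{\langle\xi,g\rangle:\|\mathbf{g}\|\le1\}$. $\mathcal{C}$ is the set of $g\in C(\mathbb{S}^2)$ such that $g+\frac12=H|_{\mathbb{S}^2}$ for the support function $H$ of some constant width body. Functionals.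 $E(\mathbf{g})=\int_{\mathbb{S}^2}(\frac12|\nabla g|^2-g^2)\,d\sigma$ if $g\in\mathcal{C}$ and $+\infty$ otherwise (well defined on classes). $E^*(\zeta)=\sup\{\langle\zeta,g\rangle-E(\mathbf{g}):g\in\mathcal{C}\}$ for $\zeta\in\mathcal{P}^\perp$. $\partial E^*(\zeta)\subset C(\mathbb{S}^2)/\mathcal{P}$ is the subdifferential of $E^*$, and $\mathcal{J}^*(\xi)\subset C(\mathbb{S}^2)/\mathcal{P}$ is the subdifferential of $\xi\mapsto\frac12\|\xi\|_*^2$; $\mathbf{g}\in\mathcal{J}^*(\xi)$ iff $\|\mathbf{g}\|^2=\langle\xi,g\rangle=\|\xi\|_*^2$. Classical solution. $\xi$ is a classical solution if it is absolutely continuous (weak* differentiable a.e. with derivative $\dot\xi\in L^1_{\rm loc}([0,\infty);\mathcal{P}^\perp)$ and $\xi(t)-\xi(s)=\int_s^t\dot\xi(\tau)\,d\tau$ for all $0\le s<t$) and there is a measurable $\mathbf{g}:[0,\infty)\to C(\mathbb{S}^2)/\mathcal{P}$ with $\mathbf{g}(t)\in\mathcal{J}^*(\xi(t))\cap(-\partial E^*(\dot\xi(t)))$ for a.e. $t\ge0$. $E^*$ variation. For $0\le s<t$, $$E^*V(\xi,s,t)=\sup\Big\{\sum_{k=1}^N(\tau_k-\tau_{k-1})E^*\Big(\tfrac{\xi(\tau_k)-\xi(\tau_{k-1})}{\tau_k-\tau_{k-1}}\Big): s=\tau_0<\dots<\tau_N=t\Big\},$$ with $E^*V(\xi,s,s)=0$;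 $\xi$ has locally finite $E^*$ variation if this is finite for all $[s,t]\subset[0,\infty)$. Weak solution. A measurable $\xi:[0,\infty)\to\mathcal{P}^\perp$ (i.e. $t\mapsto\langle\xi(t),g\rangle$ is Lebesgue measurable for every $g\in C(\mathbb{S}^2)$) with locally finite $E^*$ variation is a weak solution if there is a measurable $\mathbf{g}:[0,\infty)\to C(\mathbb{S}^2)/\mathcal{P}$ such that $\mathbf{g}(t)\in\mathcal{J}^*(\xi(t))$ for a.e. $t\ge0$ and $$\tfrac12\|\xi(s)\|_*^2-\tfrac12\|\xi(t)\|_*^2=E^*V(\xi,s,t)+\int_s^tE(\mathbf{g}(\tau))\,d\tau$$ for almost every $0\le s\le t$, i.e. for all $0\le s\le t$ outside some null set of times. *)

(* Defs.v *)
From HB Require Import structures.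
From mathcomp Require Import all_boot all_order all_algebra.
From mathcomp Require Import all_classical all_reals all_analysis.
From mathcomp Require Import measurable_realfun.

Set Implicit Arguments.
Unset Strict Implicit.
Unset Printing Implicit Defensive.

Import Order.TTheory GRing.Theory Num.Theory.
Import numFieldNormedType.Exports.

Local Open Scope classical_set_scope.
Local Open Scope ring_scope.

(** * Euclidean space and the sphere *)

(* The library norm on ['rV[R]_3] is the sup norm, hence [enorm]. *)
Definition dotp (R : realType) (u v : 'rV[R]_3) : R := (u *m v^T) 0 0.

Definition enorm (R : realType) (u : 'rV[R]_3) : R := Num.sqrt (dotp u u).

Definition S2set (R : realType) : set 'rV[R]_3 := [set u | enorm u = 1].

Definition S2 (R : realType) : Type := set_type (@S2set R).

HB.instance Definition _ (R : realType) := [isSub of S2 R for @set_val _ (@S2set R)].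
HB.instance Definition _ (R : realType) := Choice.on (S2 R).
HB.instance Definition _ (R : realType) :=
  Topological.copy (S2 R) (set_type (@S2set R)).

Section sphere.
Variable R : realType.

Lemma dotpE (u v : 'rV[R]_3) : dotp u v = \sum_i u 0 i * v 0 i.
Proof. by rewrite /dotp mxE; apply: eq_bigr => i _; rewrite mxE. Qed.

Lemma dotp_ge0 (u : 'rV[R]_3) : 0 <= dotp u u.
Proof. by rewrite dotpE sumr_ge0// => i _; rewrite -expr2 sqr_ge0. Qed.

Lemma enormZ (a : R) (u : 'rV[R]_3) : enorm (a *: u) = `|a| * enorm u.
Proof.
have -> : enorm (a *: u) = Num.sqrt (a ^+ 2 * dotp u u).
  rewrite /enorm; congr Num.sqrt; rewrite !dotpE mulr_sumr.
  by apply: eq_bigr => i _; rewrite !mxE mulrACA.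
by rewrite sqrtrM ?sqr_ge0// sqrtr_sqr.
Qed.

Lemma pole_S2set : (delta_mx 0 ord_max : 'rV[R]_3) \in @S2set R.
Proof.
apply/mem_set; rewrite /S2set/= /enorm dotpE (bigD1 ord_max)//= big1 => [|i ne].
  by rewrite !mxE !eqxx mulr1 addr0 sqrtr1.
by rewrite !mxE (negbTE ne) mulr0.
Qed.

Definition pole : S2 R := SigSub pole_S2set.

HB.instance Definition _ := isPointed.Build (S2 R) pole.

End sphere.

(* Borel sigma-algebra.  On a compact metric space every finite signed Borel
   measure is Radon, so that [M_S2] below is the space of Radon measures. *)
HB.instance Definition _ (R : realType) :=
  Measurable.copy (S2 R) (g_sigma_algebraType (@open (S2 R))).

Notation M_S2 R := (charge (S2 R) R).

(** * Surface measure *)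

Notation R3 R :=
  (measurableTypeR R * measurableTypeR R * measurableTypeR R)%type.

Definition vec3 (R : realType) (p : R3 R) : 'rV[R]_3 :=
  \row_i [:: p.1.1; p.1.2; p.2]`_i.

(* Radial projection onto the sphere (with an arbitrary value at the origin). *)
Definition sdir (R : realType) (x : 'rV[R]_3) : S2 R :=
  insubd (pole R) ((enorm x)^-1 *: x).

Section measurability_of_the_projection.
Variable R : realType.

Lemma measurable_preimage_open_rV d (T : measurableType d) (n : nat)
    (F : T -> 'rV[R]_n) (W : set 'rV[R]_n) :
  (forall i, measurable_fun setT (fun x => F x 0 i)) -> open W ->
  measurable (F @^-1` W).
Proof.
move=> mF oW.
pose box (q : 'rV[rat]_n * 'rV[rat]_n) (j : 'I_n) : set R :=
  `](ratr (q.1 0 j)), (ratr (q.2 0 j))[%classic.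
pose good q := forall y : 'rV[R]_n, (forall j : 'I_n, box q j (y 0 j)) -> W y.
have -> : F @^-1` W = \bigcup_(q : 'rV[rat]_n * 'rV[rat]_n)
   (if `[< good q >] then \bigcap_(j : 'I_n) ((fun x => F x 0 j) @^-1` box q j)
    else set0).
  apply/seteqP; split=> [x Wx|x [q _]]; last first.
    by case: asboolP => // gq bx; apply: gq => j; exact: bx.
  have /nbhs_ballP[e /= e0 eW] : nbhs (F x) W by apply: open_nbhs_nbhs; split.
  have lt1 j : F x 0 j - e < F x 0 j by rewrite ltrBlDr ltrDl.
  have lt2 j : F x 0 j < F x 0 j + e by rewrite ltrDl.
  have [a ha] := choice (fun j => rat_in_itvoo (lt1 j)).
  have [b hb] := choice (fun j => rat_in_itvoo (lt2 j)).
  exists (\row_j a j, \row_j b j) => //; case: asboolP => [_ j _|[]] /=.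
    rewrite /box/= !mxE in_itv/=.
    by move: (ha j) (hb j); rewrite !in_itv/= => /andP[_ ->] /andP[-> _].
  move=> y hy; apply: eW; split=> // i j; rewrite ord1.
  move: (hy j) (ha j) (hb j); rewrite /box/= !mxE !in_itv/=.
  move=> /andP[y1 y2] /andP[a1 a2] /andP[b1 b2].
  rewrite -ball_normE/= ltr_distlC.
  by rewrite (lt_trans a1 y1) (lt_trans y2 b2).
apply: countable_bigcupT_measurable => [|q]; first exact: countableP.
case: asboolP => // _; apply: fin_bigcap_measurable => // j _.
by rewrite -[X in measurable X]setTI; apply: mF => //; exact: measurable_itv.
Qed.

Lemma measurable_enorm d (T : measurableType d) (F : T -> 'rV[R]_3) :
  (forall i, measurable_fun setT (fun x => F x 0 i)) ->
  measurable_fun setT (fun x => enorm (F x)).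
Proof.
move=> mF; have -> : (fun x => enorm (F x)) =
    (@powR R ^~ 2^-1) \o (fun x => \sum_i F x 0 i * F x 0 i).
  by apply/funext => x /=; rewrite -dotpE powR12_sqrt// dotp_ge0.
apply: measurableT_comp; first exact: measurable_powR.
by apply: measurable_sum => i; exact: measurable_funM.
Qed.

Lemma val_sdir (x : 'rV[R]_3) :
  \val (sdir x) =
    if enorm x == 0 then \val (pole R) else (enorm x)^-1 *: x.
Proof.
rewrite /sdir val_insubd; case: eqP => [->|/eqP x0].
  by rewrite invr0 scale0r; case: ifPn => //; rewrite inE /S2set/= /enorm
     dotpE big1 ?sqrtr0 => [/eqP|i _]; rewrite ?mxE ?mulr0// eq_sym oner_eq0.
rewrite ifT//; apply/mem_set.
by rewrite /S2set/= enormZ ger0_norm ?invr_ge0 ?sqrtr_ge0// mulVf.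
Qed.

Lemma measurable_vec3_coord (i : 'I_3) :
  measurable_fun setT (fun p : R3 R => vec3 p 0 i).
Proof.
under eq_fun do rewrite mxE; case: i => -[|[|[|//]]] ? /=.
- exact: measurableT_comp.
- exact: measurableT_comp.
- exact: measurable_snd.
Qed.

Lemma measurable_sdir : measurable_fun setT (@sdir R \o @vec3 R).
Proof.
apply: (measurability (@open (S2 R))) => // _ [_ [W oW <-] <-].
have -> : setT `&` (@sdir R \o @vec3 R) @^-1` (\val @^-1` W) =
   (fun p => \val (sdir (vec3 p))) @^-1` W by rewrite setTI.
apply: measurable_preimage_open_rV => // i.
have -> : (fun p => \val (sdir (@vec3 R p)) 0 i) = fun p =>
    if enorm (vec3 p) == 0 then \val (pole R) 0 i
    else (enorm (vec3 p)) `^ (-1) * vec3 p 0 i.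
  apply/funext => p; rewrite val_sdir powR_inv1 ?sqrtr_ge0//.
  by case: ifP => // _; rewrite !mxE.
have mn := measurable_enorm measurable_vec3_coord.
apply: measurable_fun_ifT => //.
  exact: measurable_fun_eqr.
apply: measurable_funM; last exact: measurable_vec3_coord.
exact: (measurableT_comp (measurable_powR _)).
Qed.

Lemma measurable_punctured_ball :
  measurable [set p : R3 R | 0 < enorm (vec3 p) <= 1].
Proof.
have mn := measurable_enorm measurable_vec3_coord.
have -> : [set p : R3 R | 0 < enorm (vec3 p) <= 1] =
  setT `&` (fun p => enorm (vec3 p)) @^-1` `]0, 1].
  by apply/seteqP; split=> p /=; rewrite in_itv/= => // -[].
exact: mn.
Qed.

End measurability_of_the_projection.

Definition lebesgue3 (R : realType) : set (R3 R) -> \bar R :=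
  (lebesgue_measure \x lebesgue_measure \x lebesgue_measure)%E.

HB.instance Definition _ (R : realType) := Measure.on (@lebesgue3 R).

(* Cone measure: [sigma A] is three times the volume of the part of the unit ball
   lying over [A], in particular [sigma setT = 3 * (4 * pi / 3) = 4 * pi]. *)
Definition sigma (R : realType) (A : set (S2 R)) : \bar R :=
  (3%:E * lebesgue3 [set p | (0 < enorm (vec3 p) <= 1)%R /\
                             A (sdir (vec3 p))])%E.

Section sigma_measure.
Variable R : realType.
Local Open Scope ereal_scope.

Let cone (A : set (S2 R)) : set (R3 R) :=
  [set p | (0 < enorm (vec3 p) <= 1)%R /\ A (sdir (vec3 p))].

Let measurable_cone A : measurable A -> measurable (cone A).
Proof.
move=> mA; apply: measurableI; first exact: measurable_punctured_ball.
by rewrite -[X in measurable X]setTI; exact: measurable_sdir.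
Qed.

Let sigma0 : sigma set0 = 0 :> \bar R.
Proof.
rewrite /sigma (_ : [set _ | _] = set0) ?measure0 ?mule0//.
by apply/seteqP; split=> p //= [].
Qed.

Let sigma_ge0 (A : set (S2 R)) : 0 <= sigma A.
Proof. by rewrite /sigma mule_ge0. Qed.

Let sigma_semi_sigma_additive : semi_sigma_additive (@sigma R).
Proof.
move=> F mF tF mUF; rewrite /sigma.
under eq_fun do rewrite -ge0_sume_distrr//.
apply: cvgeZl => //.
rewrite -/(cone _) (_ : cone _ = \bigcup_n cone (F n)); last first.
  by apply/seteqP; split=> [p [p1 [n _ Fp]]|p [n _ [p1 Fp]]];
    [exists n|split => //; exists n].
apply: measure_semi_sigma_additive.
- by move=> n; exact: measurable_cone.
- apply/trivIsetP => i j _ _ ij; apply/seteqP; split => p //= [[_ Fi] [_ Fj]].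
  move/trivIsetP : tF => /(_ i j I I ij) /seteqP[+ _].
  by move=> /(_ (sdir (vec3 p))); apply; split.
- rewrite (_ : \bigcup_n _ = cone (\bigcup_n F n)); first exact: measurable_cone.
  by apply/seteqP; split=> [p [n _ [p1 Fp]]|p [p1 [n _ Fp]]];
    [split => //; exists n|exists n].
Qed.

HB.instance Definition _ := isMeasure.Build _ _ _ (@sigma R)
  sigma0 sigma_ge0 sigma_semi_sigma_additive.

End sigma_measure.

(** * Function spaces and measures *)

Section spaces.
Variable R : realType.
Definition C_S2 : set (S2 R -> R) := [set g | continuous g].

(* Elements of [C(S2)/P] are represented by continuous functions [S2 R -> R];
   the norm, functionals and subdifferentials below are invariant under
   [g |-> g + a . u]. *)
Definition sup_norm (g : S2 R -> R) : R := sup [set `|g u| | u in setT].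

Definition linS2 (a : 'rV[R]_3) (u : S2 R) : R := dotp a (\val u).

Definition quot_norm (g : S2 R -> R) : R :=
  inf [set sup_norm (g \+ linS2 a) | a in setT].

(* The pairing <xi, g>, through the Jordan decomposition of xi. *)
Definition hahn_sets (xi : M_S2 R) :
    {PN : set (S2 R) * set (S2 R) | hahn_decomposition xi PN.1 PN.2} :=
  cid (let: ex_intro P (ex_intro N h) := Hahn_decomposition xi in
       ex_intro (fun PN => hahn_decomposition xi PN.1 PN.2) (P, N) h).

Definition pairing (xi : M_S2 R) (g : S2 R -> R) : R :=
  (\int[jordan_pos (projT2 (hahn_sets xi))]_u g u) -
  (\int[jordan_neg (projT2 (hahn_sets xi))]_u g u).

Definition csub (xi eta : M_S2 R) : M_S2 R := cadd xi (copp eta).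

Definition Pperp : set (M_S2 R) :=
  [set xi | forall a : 'rV[R]_3, pairing xi (linS2 a) = 0].

Definition dual_norm (xi : M_S2 R) : R :=
  sup [set pairing xi g | g in C_S2 `&` [set g | quot_norm g <= 1]].

(* For [F] on [Pperp], [g \in d F(xi)]. *)
Definition subdifferential (F : M_S2 R -> \bar R) (xi : M_S2 R)
    (g : S2 R -> R) : Prop :=
  C_S2 g /\
  forall eta, Pperp eta -> (F xi + (pairing (csub eta xi) g)%:E <= F eta)%E.

(** * Constant width bodies and functionals *)

Definition support_fun (K : set 'rV[R]_3) (u : 'rV[R]_3) : R :=
  sup [set dotp x u | x in K].

Definition constant_width_body (K : set 'rV[R]_3) : Prop :=
  [/\ K !=set0, compact K, convex_set K &
      forall u, support_fun K u + support_fun K (- u) = enorm u].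

Definition calC : set (S2 R -> R) := C_S2 `&`
  [set g | exists2 K, constant_width_body K &
             forall u, g u + 2^-1 = support_fun K (\val u)].

(* The tangential gradient of [g] at [u] is the Euclidean gradient at [u] of the
   0-homogeneous extension of [g].  Members of [calC] are Lipschitz, hence this
   is the actual gradient at sigma-almost every [u]. *)
Definition sgrad (g : S2 R -> R) (u : S2 R) : 'rV[R]_3 :=
  \row_(i < 3) 'D_(delta_mx 0 i) (g \o @sdir R) (\val u).

Definition energy (g : S2 R -> R) : \bar R :=
  if `[< calC g >] then
    (\int[@sigma R]_u (2^-1 * enorm (sgrad g u) ^+ 2 - g u ^+ 2)%:E)%E
  else +oo%E.

Definition energy_conj (zeta : M_S2 R) : \bar R :=
  ereal_sup [set ((pairing zeta g)%:E - energy g)%E | g in calC].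

Definition d_energy_conj (zeta : M_S2 R) (g : S2 R -> R) : Prop :=
  subdifferential energy_conj zeta g.

Definition dual_J (xi : M_S2 R) (g : S2 R -> R) : Prop :=
  subdifferential (fun eta => (2^-1 * dual_norm eta ^+ 2)%:E) xi g.

(** * Solutions *)

(* The real line with the sigma-algebra of Lebesgue measurable sets. *)
Definition time : measurableType _ :=
  caratheodory_type ((wlength (@idfun R))^*)%mu.

Local Notation leb := (@completed_lebesgue_measure R).

Definition nonneg_times : set time := [set t : R | 0 <= t].

(* Curves are functions on the whole line, of which only the values at
   nonnegative times are relevant. *)
Definition Pperp_curve (xi : R -> M_S2 R) : Prop :=
  forall t, 0 <= t -> Pperp (xi t).

Definition weak_star_measurable (xi : R -> M_S2 R) : Prop :=
  forall g, C_S2 g ->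
    measurable_fun nonneg_times (fun t : time => pairing (xi t) g).

(* Open sets of the quotient topology, as (automatically P-invariant) families
   of representatives. *)
Definition quot_open (U : set (S2 R -> R)) : Prop :=
  forall g, C_S2 g -> U g ->
    exists2 e, 0 < e & forall h, C_S2 h -> quot_norm (h \- g) < e -> U h.

(* [t |-> g t] represents a Borel measurable map [0, oo) -> C(S2)/P. *)
Definition class_measurable (g : R -> S2 R -> R) : Prop :=
  (forall t, 0 <= t -> C_S2 (g t)) /\
  forall U, quot_open U ->
    measurable (nonneg_times `&` [set t : time | U (g t)]).

Definition weak_star_derivative_at (xi : R -> M_S2 R) (t : R) (zeta : M_S2 R) :
    Prop :=
  forall g, C_S2 g ->
    pairing (cscale h^-1 (csub (xi (t + h)) (xi t))) g @[h --> 0^']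
      --> pairing zeta g.

Definition L1loc_Pperp (zeta : R -> M_S2 R) : Prop :=
  [/\ Pperp_curve zeta, weak_star_measurable zeta &
      forall T : R, leb.-integrable `[0, T]
        (fun t : time => (dual_norm (zeta t))%:E)].

(* The integral of the derivative is the weak* one. *)
Definition absolutely_continuous_curve (xi xidot : R -> M_S2 R) : Prop :=
  [/\ {ae leb, forall t : R, 0 <= t -> weak_star_derivative_at xi t (xidot t)},
      L1loc_Pperp xidot &
      forall s t : R, 0 <= s -> s < t -> forall g, C_S2 g ->
        pairing (csub (xi t) (xi s)) g =
        \int[leb]_(tau in `[s, t]) pairing (xidot tau) g].

Definition classical_solution (xi : R -> M_S2 R) : Prop :=
  Pperp_curve xi /\
  exists2 xidot, absolutely_continuous_curve xi xidot &
  exists2 g : R -> S2 R -> R, class_measurable g &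
    {ae leb, forall t : R, 0 <= t ->
       dual_J (xi t) (g t) /\ d_energy_conj (xidot t) (fun u => - g t u)}.

(* For [s = t] the only partition is [[::]], which yields the value 0. *)
Definition conj_variation (xi : R -> M_S2 R) (s t : R) : \bar R :=
  ereal_sup [set (\sum_(0 <= k < size l)
      let a := nth s (s :: l) k in let b := nth s (s :: l) k.+1 in
      (b - a)%:E * energy_conj (cscale (b - a)^-1 (csub (xi b) (xi a))))%E
    | l in itv_partition s t].

Definition weak_solution (xi : R -> M_S2 R) : Prop :=
  [/\ Pperp_curve xi, weak_star_measurable xi,
      forall s t, 0 <= s -> s <= t -> (conj_variation xi s t < +oo)%E &
  exists2 g : R -> S2 R -> R, class_measurable g &
    {ae leb, forall t : R, 0 <= t -> dual_J (xi t) (g t)} /\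
    exists2 N : set time, leb.-negligible N &
      forall s t : R, 0 <= s -> s <= t -> ~ N s -> ~ N t ->
        ((2^-1 * dual_norm (xi s) ^+ 2 - 2^-1 * dual_norm (xi t) ^+ 2)%:E =
         conj_variation xi s t + \int[leb]_(tau in `[s, t]) energy (g tau))%E].

End spaces.

(* Main.v *)
(* Let phi(t) = ||xi(t)||_*^2 / 2.  Since xi moves at speed ||xi'||_*, phi is
   absolutely continuous, and the inclusion g(t) in J^*(xi(t)) bounds its right
   difference quotients from below and its left ones from above by the same limit
   <xi', g>, so that phi' = <xi', g> almost everywhere.  The inclusion
   - g(t) in dE^*(xi'(t)) turns this into phi' = - E^*(xi') - E(g) by Fenchel
   duality, provided that E is convex and lower semicontinuous.  Finally
   E^*V(xi, s, t) is the integral of E^*(xi'): "<=" is Jensen's inequality, and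
   t |-> E^*V(xi, s, t) is absolutely continuous with derivative at least
   E^*(xi') because E^* is weak* lower semicontinuous.

   Convexity and semicontinuity of E come from the following formula.  Let f be the
   1-homogeneous extension of g, which is odd when g + 1/2 supports a body of
   constant width.  On the unit ball of R^3 x R^3 consider F(x, y) = f(x) and its
   rotation F_t(x, y) = f(cos t x + sin t y).  For t = pi / 2^n the form
   Q_t(F) = 2 cos t |F|^2 - 2 (F, F_t) is nonnegative on odd functions (by
   induction on n, halving the angle) and vanishes on linear ones, and
   Q_t(F) / tan^2 t tends to a multiple of E(g), the averages of the squared
   increments of F being nondecreasing in n. *)

From HB Require Import structures.
Require Import Defs.
From mathcomp Require Import all_boot all_order all_algebra.
From mathcomp Require Import all_classical all_reals all_analysis.
From mathcomp Require Import measurable_realfun ring lra.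

Set Implicit Arguments.
Unset Strict Implicit.
Unset Printing Implicit Defensive.

Import Order.TTheory GRing.Theory Num.Theory.
Import numFieldNormedType.Exports.

Local Open Scope classical_set_scope.
Local Open Scope ring_scope.

(** * Measure-preserving maps *)

(** The integrand [|grad g|^2 / 2 - g^2] is indefinite, so neither the sign nor the convexity of [E]
    can be read pointwise. They are spectral facts: on odd functions the lowest eigenvalue of the
    spherical Laplacian is 2, attained by the linear functions. The rotation forms replace spherical
    harmonics and second derivatives. The second factor [y] supplies the direction of
    differentiation: by homogeneity [F_t = cos t * f(x + tan t * y)], so that increments divided by
    [tan t] are difference quotients of [f] at [x] along [y], and averaging over [y] produces
    [|grad f|^2 = |grad g|^2 + g^2]. Working in a ball of [R^6] keeps all the integrals within
    product Lebesgue measures, which rotations preserve.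

    The other obstacle is that the inclusion speaks of [E^*] only. That [E(g)] is finite, with
    equality in Young's inequality, is Fenchel biduality in [C(S2)/P]; it is obtained by penalising
    the values at finitely many points instead of separating convex sets. *)

Lemma sigma_finite_product d1 d2 (T1 : measurableType d1)
    (T2 : measurableType d2) (R : realType)
    (m1 : {sigma_finite_measure set T1 -> \bar R})
    (m2 : {sigma_finite_measure set T2 -> \bar R}) :
  sigma_finite setT (m1 \x m2)%E.
Proof.
have /sigma_finiteP[F [TF ndF Foo]] := sigma_finiteT m1.
have /sigma_finiteP[G [TG ndG Goo]] := sigma_finiteT m2.
exists (fun n => F n `*` G n) => [|k].
  rewrite -setXTT TF TG; apply/seteqP; split=> [[x y]|[x y] [n _ []]]; last first.
    by move=> Fx Gy; split; exists n.
  move=> /= [[n _ Fnx] [k _ Gky]]; exists (maxn n k) => //; split.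
  - by move: x Fnx; exact/subsetPset/ndF/leq_maxl.
  - by move: y Gky; exact/subsetPset/ndG/leq_maxr.
have [? ?] := Foo k; have [? ?] := Goo k.
split; first exact: measurableX.
by rewrite product_measure1E// lte_mul_pinfty// ge0_fin_numE.
Qed.

Definition lebesgue2 (R : realType) :
    set (measurableTypeR R * measurableTypeR R) -> \bar R :=
  (lebesgue_measure \x lebesgue_measure)%E.

HB.instance Definition _ (R : realType) := Measure.on (@lebesgue2 R).
HB.instance Definition _ (R : realType) :=
  Measure_isSigmaFinite.Build _ _ _ (@lebesgue2 R)
    (sigma_finite_product lebesgue_measure lebesgue_measure).
HB.instance Definition _ (R : realType) :=
  Measure_isSigmaFinite.Build _ _ _ (@lebesgue3 R)
    (sigma_finite_product (@lebesgue2 R) lebesgue_measure).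

Section pushforward_measure.
Context d1 d2 (T1 : measurableType d1) (T2 : measurableType d2) (R : realType).

Definition push_measure (m : {measure set T1 -> \bar R}) (f : T1 -> T2)
    (mf : measurable_fun setT f) : {measure set T2 -> \bar R}.
Proof. by refine (pushforward m f : {measure set T2 -> \bar R}). Defined.

Lemma push_measureE (m : {measure set T1 -> \bar R}) (f : T1 -> T2)
    (mf : measurable_fun setT f) (A : set T2) :
  push_measure m mf A = m (f @^-1` A).
Proof. by []. Qed.

Definition measure_preserving (mu : {measure set T1 -> \bar R})
    (nu : {measure set T2 -> \bar R}) (phi : T1 -> T2) :=
  measurable_fun setT phi /\
  forall A, measurable A -> mu (phi @^-1` A) = nu A.

Variables (mu : {measure set T1 -> \bar R}) (nu : {measure set T2 -> \bar R}).
Variable phi : T1 -> T2.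

Lemma measure_preservingI : measurable_fun setT phi ->
  (forall f : T2 -> \bar R, measurable_fun setT f -> (forall x, 0 <= f x)%E ->
     (\int[nu]_x f x = \int[mu]_x f (phi x))%E) ->
  measure_preserving mu nu phi.
Proof.
move=> mphi H; split=> // A mA.
have mpA : measurable (phi @^-1` A) by rewrite -[X in measurable X]setTI; exact: mphi.
have := H (EFin \o \1_A); rewrite /= integral_indic// setIT => ->//.
- by rewrite -[in LHS](setIT (phi @^-1` A)) -integral_indic.
- exact/measurable_EFinP.
Qed.

Hypothesis muphi : measure_preserving mu nu phi.
Local Open Scope ereal_scope.

Lemma ge0_integral_preserving D (f : T2 -> \bar R) : measurable D ->
  measurable_fun D f -> (forall y, D y -> 0 <= f y) ->
  \int[nu]_(y in D) f y = \int[mu]_(x in phi @^-1` D) f (phi x).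
Proof.
move=> mD mf f0; case: muphi => mphi phiE.
rewrite -[RHS](ge0_integral_pushforward mphi mu mD mf); last first.
  by move=> y /set_mem; exact: f0.
by apply: eq_measure_integral => A mA _; rewrite -[LHS]phiE.
Qed.

Lemma integrable_preserving D (f : T2 -> \bar R) : measurable D ->
  measurable_fun D f ->
  mu.-integrable (phi @^-1` D) (f \o phi) <-> nu.-integrable D f.
Proof.
move=> mD mf; have mphi := muphi.1.
have mpD : measurable (phi @^-1` D) by rewrite -[X in measurable X]setTI; exact: mphi.
have mfp : measurable_fun (phi @^-1` D) (f \o phi).
  by apply: (measurable_comp mD) => //; [move=> _ [y Dy <-]|exact: measurable_funTS].
have E : \int[nu]_(y in D) `|f y| = \int[mu]_(x in phi @^-1` D) `|(f \o phi) x|.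
  by apply: (@ge0_integral_preserving D (abse \o f)) => // [|y _];
    [exact: measurableT_comp|exact: abse_ge0].
by split => /integrableP[_ h]; apply/integrableP; split; rewrite // ?E // -E.
Qed.

Lemma Rintegral_preserving D (f : T2 -> R) : measurable D ->
  measurable_fun D f ->
  (\int[nu]_(y in D) f y = \int[mu]_(x in phi @^-1` D) f (phi x))%R.
Proof.
move=> mD mf; rewrite /Rintegral [in LHS]integralE [in RHS]integralE.
have mF : measurable_fun D (EFin \o f) by exact/measurable_EFinP.
congr (fine (_ - _)).
  rewrite [LHS](ge0_integral_preserving mD (measurable_funepos mF)).
    by apply: eq_integral => x _; rewrite !funeposE.
  by move=> y _; exact: funepos_ge0.
rewrite [LHS](ge0_integral_preserving mD (measurable_funeneg mF)).
  by apply: eq_integral => x _; rewrite !funenegE.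
by move=> y _; exact: funeneg_ge0.
Qed.

End pushforward_measure.

(** * Affine changes of variables for Lebesgue measure *)

Section lebesgue_affine.
Context {R : realType}.
Local Notation leb := (@lebesgue_measure R).
Local Notation mR := (measurableTypeR R).
Local Open Scope ereal_scope.

(** Uniqueness of Lebesgue measure: the right-hand side is a measure in [A] with the expected value
    on the intervals []a, b]], whose preimages are [](a - c) / r, (b - c) / r]]. *)
Lemma lebesgue_measure_affine (r c : R) (A : set mR) :
  (0 < r)%R -> measurable A ->
  leb A = r%:E * leb ((fun x => r * x + c)%R @^-1` A).
Proof.
move=> r0 mA.
have mf : measurable_fun setT (fun x : mR => (r * x + c)%R : mR).
  by apply: measurable_funD => //; exact: measurable_funM.
pose mu := mscale (NngNum (ltW r0)) (push_measure leb mf).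
have -> : r%:E * leb ((fun x => r * x + c)%R @^-1` A) = mu A by [].
apply: lebesgue_measure_unique => //= _ [[a b]] _ <-.
rewrite /mu /mscale/= /pushforward.
rewrite (_ : _ @^-1` _ = `](a - c) / r, (b - c) / r]%classic)%R; last first.
  apply/seteqP; split => x /=; rewrite !in_itv/= ltr_pdivrMr// ler_pdivlMr//.
    by rewrite ltrBlDr lerBrDr mulrC.
  by rewrite ltrBlDr lerBrDr mulrC.
rewrite !lebesgue_measure_itv/= !lte_fin ltr_pM2r ?invr_gt0// ltrD2r.
case: ifPn => _; last by rewrite mule0.
by rewrite -!EFinB -EFinM; congr EFin; field; rewrite gt_eqF.
Qed.

Lemma measurable_affine (s c : R) : measurable_fun setT (fun x : mR => (s * x + c)%R : mR).
Proof. by apply: measurable_funD => //; exact: measurable_funM. Qed.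

(** A negative [r] is reduced to a positive one through [x |-> - x], which preserves the measure. *)
Lemma ge0_integral_affine (r c : R) (f : mR -> \bar R) :
  r != 0%R -> measurable_fun setT f -> (forall x, 0 <= f x) ->
  \int[leb]_x f x = `|r|%:E * \int[leb]_x f (r * x + c)%R.
Proof.
have pos (s : R) d (g : mR -> \bar R) : (0 < s)%R ->
    measurable_fun setT g -> (forall x, 0 <= g x) ->
    \int[leb]_x g x = s%:E * \int[leb]_x g (s * x + d)%R.
  move=> s0 mg g0.
  pose nu := mscale (NngNum (ltW s0)) leb.
  have phiP : measure_preserving nu leb (fun x : mR => (s * x + d)%R : mR).
    split=> [|A mA]; first exact: measurable_affine.
    by rewrite [RHS](lebesgue_measure_affine d s0 mA).
  rewrite (ge0_integral_preserving phiP)// preimage_setT ge0_integral_mscale//.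
  by apply: measurableT_comp => //; exact: measurable_affine.
move=> r0 mf f0.
have [r1|r1|/eqP] := ltgtP r 0%R; last by rewrite (negPf r0).
- rewrite ltr0_norm//.
  have mN : measurable_fun setT (-%R : mR -> mR) by exact: oppr_measurable.
  have -> : \int[leb]_x f x = \int[leb]_x f (- x)%R.
    rewrite (@ge0_integral_preserving _ _ _ _ _ leb leb -%R)//.
    by split=> [//|A mA]; exact: lebesgue_measureN.
  have Nr0 : (0 < - r)%R by rewrite oppr_gt0.
  have -> := pos _ (- c)%R _ Nr0 (measurableT_comp mf mN) (fun x => f0 _).
  by congr (_ * _); apply: eq_integral => x _ /=; congr f; ring.
- by rewrite gtr0_norm// (pos r c).
Qed.

End lebesgue_affine.

Section lebesgue3_transfo.
Context {R : realType}.
Local Notation leb := (@lebesgue_measure R).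
Local Notation leb3 := (@lebesgue3 R).
Local Notation mR := (measurableTypeR R).
Local Open Scope ereal_scope.

Lemma ge0_integral_lebesgue3 (f : R3 R -> \bar R) :
  measurable_fun setT f -> (forall x, 0 <= f x) ->
  \int[leb3]_p f p = \int[leb]_a \int[leb]_b \int[leb]_c f (a, b, c).
Proof.
move=> mf f0.
have E1 : \int[leb3]_p f p = \int[@lebesgue2 R]_p fubini_F leb f p.
  exact: (@fubini_tonelli1 _ _ _ _ R (@lebesgue2 R) leb f mf f0).
have mF : measurable_fun setT (fubini_F leb f).
  exact: measurable_fun_fubini_tonelli_F.
have F0 p : 0 <= fubini_F leb f p by exact: integral_ge0.
by rewrite E1; exact: (@fubini_tonelli1 _ _ _ _ R leb leb (fubini_F leb f) mF F0).
Qed.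

Let measurable_slice (f : R3 R -> \bar R) :
  measurable_fun setT f -> (forall x, 0 <= f x) ->
  [/\ measurable_fun setT (fun a => \int[leb]_b \int[leb]_c f (a, b, c)),
   (forall a, measurable_fun setT (fun b => \int[leb]_c f (a, b, c))) &
   (forall a b, measurable_fun setT (fun c => f (a, b, c)))].
Proof.
move=> mf f0.
have m1 : measurable_fun setT (fubini_F leb f).
  exact: measurable_fun_fubini_tonelli_F.
split.
- apply: (measurable_fun_fubini_tonelli_F (fubini_F leb f)) => //.
  by move=> x; apply: integral_ge0.
- by move=> a; apply: measurableT_comp m1 _; exact: measurable_pair1.
- by move=> a b; apply: measurableT_comp mf _; exact: measurable_pair1.
Qed.

Lemma measurable_affine3 (r1 r2 r3 c1 c2 c3 : R) : measurable_fun setT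
  (fun p : R3 R => (r1 * p.1.1 + c1, r2 * p.1.2 + c2, r3 * p.2 + c3)%R : R3 R).
Proof.
apply/measurable_fun_pair => /=; first apply/measurable_fun_pair => /=.
- by apply: (measurableT_comp (measurable_affine r1 c1)); exact: measurableT_comp.
- by apply: (measurableT_comp (measurable_affine r2 c2)); exact: measurableT_comp.
- by apply: (measurableT_comp (measurable_affine r3 c3)); exact: measurable_snd.
Qed.

Lemma ge0_integral_affine3 (r1 r2 r3 c1 c2 c3 : R) (f : R3 R -> \bar R) :
  r1 != 0%R -> r2 != 0%R -> r3 != 0%R ->
  measurable_fun setT f -> (forall x, 0 <= f x) ->
  \int[leb3]_p f p = (`|r1 * r2 * r3|)%:E *
   \int[leb3]_p f (r1 * p.1.1 + c1, r2 * p.1.2 + c2, r3 * p.2 + c3)%R.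
Proof.
move=> r10 r20 r30 mf f0.
pose h (p : R3 R) : R3 R := (r1 * p.1.1 + c1, r2 * p.1.2 + c2, r3 * p.2 + c3)%R.
have mh : measurable_fun setT h by exact: measurable_affine3.
have mfh : measurable_fun setT (f \o h) by exact: measurableT_comp.
have fh0 x : 0 <= (f \o h) x by exact: f0.
have [ma mb mc] := measurable_slice mf f0.
have [ma' mb' mc'] := measurable_slice mfh fh0.
rewrite -/(h _) [LHS]ge0_integral_lebesgue3// -[X in _ * integral _ _ X]/(f \o h).
rewrite [in RHS]ge0_integral_lebesgue3//.
have i0 x y : 0 <= \int[leb]_z f (x, y, z) by exact: integral_ge0.
have ii0 x : 0 <= \int[leb]_y \int[leb]_z f (x, y, z) by exact: integral_ge0.
have E1 := ge0_integral_affine c1 r10 ma ii0.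
have E2 a := ge0_integral_affine c2 r20 (mb a) (i0 a).
have E3 a b := ge0_integral_affine c3 r30 (mc a b) (fun c => f0 (a, b, c)).
rewrite E1 !normrM !EFinM -!muleA; congr (_ * _).
transitivity (\int[leb]_a (`|r2|%:E * (`|r3|%:E * \int[leb]_b \int[leb]_c (f \o h) (a, b, c)))).
  apply: eq_integral => a _; rewrite E2; congr (_ * _).
  rewrite -[RHS]ge0_integralZl_EFin//; last by move=> b _; exact: integral_ge0.
  by apply: eq_integral => b _; rewrite E3.
have ii0' a : 0 <= \int[leb]_b \int[leb]_c (f \o h) (a, b, c).
  by apply: integral_ge0 => b _; exact: integral_ge0.
have mZ := measurable_funeM (`|r3|%:E) ma'.
rewrite ge0_integralZl_EFin//; last by move=> a _; exact: mule_ge0.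
congr (_ * _); rewrite ge0_integralZl_EFin.
- reflexivity.
- exact: measurableT.
- by move=> a _; exact: ii0'.
- exact: ma'.
- exact: normr_ge0.
Qed.

(** Covers both the translations, which are the slices of shears, and the coordinate reflections
    that make odd integrals vanish. *)
Lemma lebesgue3_preserving_affine (r1 r2 r3 c1 c2 c3 : R) :
  `|r1|%R = 1%R -> `|r2|%R = 1%R -> `|r3|%R = 1%R ->
  measure_preserving leb3 leb3
   (fun p : R3 R => (r1 * p.1.1 + c1, r2 * p.1.2 + c2, r3 * p.2 + c3)%R : R3 R).
Proof.
move=> r1E r2E r3E; have neq0 (r : R) : `|r|%R = 1%R -> r != 0%R.
  by move=> rE; rewrite -normr_eq0 rE oner_eq0.
apply: measure_preservingI => [|f mf f0]; first exact: measurable_affine3.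
rewrite (@ge0_integral_affine3 r1 r2 r3 c1 c2 c3 f)//; [|exact: neq0..].
by rewrite !normrM r1E r2E r3E !mulr1 mul1e.
Qed.

Lemma lebesgue3_preserving_swap12 :
  measure_preserving leb3 leb3 (fun p : R3 R => (p.1.2, p.1.1, p.2) : R3 R).
Proof.
have mphi : measurable_fun setT (fun p : R3 R => (p.1.2, p.1.1, p.2) : R3 R).
  by apply/measurable_fun_pair => /=; [apply/measurable_fun_pair|] => /=;
    [exact: measurableT_comp..|exact: measurable_snd].
apply: measure_preservingI => // f mf f0.
have mfp : measurable_fun setT (fun p : R3 R => f (p.1.2, p.1.1, p.2)).
  exact: measurableT_comp mf mphi.
rewrite (ge0_integral_lebesgue3 mf f0) (ge0_integral_lebesgue3 mfp (fun p => f0 _)).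
have m1 : measurable_fun setT (fubini_F leb f).
  exact: measurable_fun_fubini_tonelli_F.
have F0 p : 0 <= fubini_F leb f p by exact: integral_ge0.
exact: (fubini_tonelli (fubini_F leb f) m1 F0).
Qed.

Lemma lebesgue3_preserving_swap23 :
  measure_preserving leb3 leb3 (fun p : R3 R => (p.1.1, p.2, p.1.2) : R3 R).
Proof.
have mphi : measurable_fun setT (fun p : R3 R => (p.1.1, p.2, p.1.2) : R3 R).
  by apply/measurable_fun_pair => /=; [apply/measurable_fun_pair|] => /=;
    [exact: measurableT_comp|exact: measurable_snd|exact: measurableT_comp].
apply: measure_preservingI => // f mf f0.
have mfp : measurable_fun setT (fun p : R3 R => f (p.1.1, p.2, p.1.2)).
  exact: measurableT_comp mf mphi.
rewrite (ge0_integral_lebesgue3 mf f0) (ge0_integral_lebesgue3 mfp (fun p => f0 _)).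
apply: eq_integral => a _.
have ma : measurable_fun setT (fun z : mR * mR => f (a, z.1, z.2)).
  apply: measurableT_comp mf _.
  by apply/measurable_fun_pair => /=; [apply/measurable_fun_pair|] => //=.
exact: (fubini_tonelli (fun z : mR * mR => f (a, z.1, z.2)) ma (fun z => f0 _)).
Qed.

End lebesgue3_transfo.

(** * Euclidean space and the sphere *)

Section euclid.
Context {R : realType}.
Implicit Types (u v w x y : 'rV[R]_3) (a b : R).

Lemma dotp3E u v : dotp u v = u 0 0 * v 0 0 + u 0 1 * v 0 1 + u 0 2%:R * v 0 2%:R.
Proof.
rewrite dotpE !big_ord_recl big_ord0 addr0 addrA.
by congr (_ + _ * _ + _ * _); congr (_ _ _); apply/val_inj.
Qed.

Lemma rV3P u v : u 0 0 = v 0 0 -> u 0 1 = v 0 1 -> u 0 2%:R = v 0 2%:R -> u = v.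
Proof.
move=> h0 h1 h2; apply/rowP => -[[|[|[|//]]] i3].
- by rewrite (_ : Ordinal _ = 0)//; exact/val_inj.
- by rewrite (_ : Ordinal _ = 1)//; exact/val_inj.
- by rewrite (_ : Ordinal _ = 2%:R)//; exact/val_inj.
Qed.

Lemma dotpC u v : dotp u v = dotp v u.
Proof. by rewrite !dotp3E; ring. Qed.

Lemma dotpDl u v w : dotp (u + v) w = dotp u w + dotp v w.
Proof. by rewrite !dotp3E !mxE; ring. Qed.

Lemma dotpDr u v w : dotp w (u + v) = dotp w u + dotp w v.
Proof. by rewrite !dotp3E !mxE; ring. Qed.

Lemma dotpZl a u v : dotp (a *: u) v = a * dotp u v.
Proof. by rewrite !dotp3E !mxE; ring. Qed.

Lemma dotpZr a u v : dotp u (a *: v) = a * dotp u v.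
Proof. by rewrite !dotp3E !mxE; ring. Qed.

Lemma dotpNl u v : dotp (- u) v = - dotp u v.
Proof. by rewrite !dotp3E !mxE; ring. Qed.

Lemma dotpNr u v : dotp u (- v) = - dotp u v.
Proof. by rewrite !dotp3E !mxE; ring. Qed.

Lemma dotp0l u : dotp 0 u = 0.
Proof. by rewrite !dotp3E !mxE; ring. Qed.

Lemma dotp0r u : dotp u 0 = 0.
Proof. by rewrite dotpC dotp0l. Qed.

Lemma enorm_ge0 u : 0 <= enorm u. Proof. exact: sqrtr_ge0. Qed.

Lemma sqr_enorm u : enorm u ^+ 2 = dotp u u.
Proof. by rewrite sqr_sqrtr ?dotp_ge0. Qed.

Lemma enorm0 : enorm (0 : 'rV[R]_3) = 0.
Proof. by rewrite /enorm dotp0l sqrtr0. Qed.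

Lemma enormN u : enorm (- u) = enorm u.
Proof. by rewrite -scaleN1r enormZ normrN1 mul1r. Qed.

Lemma enormB u v : enorm (u - v) = enorm (v - u).
Proof. by rewrite -enormN opprB. Qed.

Lemma enorm_eq0 u : (enorm u == 0) = (u == 0).
Proof.
apply/eqP/eqP => [u0|->]; last exact: enorm0.
have : dotp u u = 0 by rewrite -sqr_enorm u0 expr0n.
rewrite dotp3E => h.
have [s0 s1 s2] : [/\ 0 <= u 0 0 ^+ 2, 0 <= u 0 1 ^+ 2 & 0 <= u 0 2%:R ^+ 2].
  by split; exact: sqr_ge0.
by apply: rV3P; rewrite mxE; apply/eqP; rewrite -sqrf_eq0; apply/eqP; nra.
Qed.

Lemma enorm_gt0 u : (0 < enorm u) = (u != 0).
Proof. by rewrite lt_def enorm_ge0 andbT enorm_eq0. Qed.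

(** Cauchy-Schwarz by Lagrange's identity: the defect is the sum of the squares of the 2 x 2
    minors. *)
Lemma norm_dotp_le u v : `|dotp u v| <= enorm u * enorm v.
Proof.
rewrite -ler_sqr ?nnegrE ?mulr_ge0 ?enorm_ge0// real_normK ?num_real//.
rewrite exprMn !sqr_enorm !dotp3E -subr_ge0.
rewrite [leRHS](_ : _ = (u 0 0 * v 0 1 - u 0 1 * v 0 0) ^+ 2 +
  (u 0 0 * v 0 2%:R - u 0 2%:R * v 0 0) ^+ 2 +
  (u 0 1 * v 0 2%:R - u 0 2%:R * v 0 1) ^+ 2); last by ring.
by rewrite !addr_ge0 ?sqr_ge0.
Qed.

Lemma dotp_le_enorm u v : dotp u v <= enorm u * enorm v.
Proof. exact: le_trans (ler_norm _) (norm_dotp_le _ _). Qed.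

Lemma ler_enormD u v : enorm (u + v) <= enorm u + enorm v.
Proof.
rewrite -ler_sqr ?nnegrE ?addr_ge0 ?enorm_ge0// sqrrD !sqr_enorm.
rewrite dotpDl !dotpDr (dotpC v u).
have := dotp_le_enorm u v; set a := dotp u v; set b := _ * _; lra.
Qed.

Lemma ler_enormB u v : enorm (u - v) <= enorm u + enorm v.
Proof. by rewrite (le_trans (ler_enormD _ _))// enormN. Qed.

Lemma ler_dist_enorm u v : `|enorm u - enorm v| <= enorm (u - v).
Proof.
have h x y : enorm x - enorm y <= enorm (x - y).
  by rewrite lerBlDr -[X in enorm X <= _](subrK y) ler_enormD.
by rewrite ler_norml h lerNl opprB andbT (le_trans (h _ _))// enormB.
Qed.

Lemma norm_coord_le_enorm u i : `|u 0 i| <= enorm u.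
Proof.
rewrite -ler_sqr ?nnegrE ?enorm_ge0// sqr_enorm real_normK ?num_real//.
rewrite dotpE (bigD1 i)//= expr2 lerDl sumr_ge0// => j _.
by rewrite -expr2 sqr_ge0.
Qed.

Lemma enorm_le_coord u :
  enorm u <= `|u 0 0| + `|u 0 1| + `|u 0 2%:R|.
Proof.
rewrite -ler_sqr ?nnegrE ?addr_ge0 ?enorm_ge0// sqr_enorm dotp3E -!expr2.
rewrite -(real_normK (num_real (u 0 0))) -(real_normK (num_real (u 0 1))).
rewrite -(real_normK (num_real (u 0 2%:R))).
have := normr_ge0 (u 0 0); have := normr_ge0 (u 0 1); have := normr_ge0 (u 0 2%:R).
by move: `|u 0 0| `|u 0 1| `|u 0 2%:R| => a b c; nra.
Qed.

Lemma enorm_le_norm u : enorm u <= 3 * `|u|.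
Proof.
apply: (le_trans (enorm_le_coord u)).
have h i : `|u 0 i| <= `|u| by rewrite [leRHS]mx_normrE; exact: (le_bigmax _ (fun i => `|u i.1 i.2|) (0, i)).
by have := h 0; have := h 1; have := h 2%:R; lra.
Qed.

(** Bridges the Euclidean norm, in which estimates are made, and the sup norm, which carries the
    topology. A one-sided bound is enough because [x] and [y] can be exchanged. *)
Lemma enorm_lipschitz_continuous (f : 'rV[R]_3 -> R) (L : R) :
  (forall x y, f x - f y <= L * enorm (x - y)) -> continuous f.
Proof.
move=> fL x; apply/(@cvgrPdist_le _ R^o _ (nbhs x) (nbhs_filter x)) => /= e e0.
have [L1 fL1] : exists2 L1, 0 < L1 & forall x y, `|f x - f y| <= L1 * `|x - y|.
  exists (3 * `|L| + 1) => [|y z]; first by rewrite ltr_wpDl// mulr_ge0.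
  have h y' z' : f y' - f z' <= (3 * `|L| + 1) * `|y' - z'|.
    apply: (le_trans (fL _ _)).
    apply: (le_trans (ler_wpM2r (enorm_ge0 _) (ler_norm L))).
    apply: (le_trans (ler_wpM2l (normr_ge0 L) (enorm_le_norm _))).
    have := normr_ge0 (y' - z'); have := normr_ge0 L; nra.
  by rewrite ler_norml h lerNl opprB andbT (le_trans (h _ _))// distrC.
have eL1 : 0 < e / L1 by rewrite divr_gt0.
move=> fL1'; apply: (@filterS _ _ (nbhs_filter x) (ball x (e / L1))); last exact: nbhsx_ballx.
move=> y; rewrite -ball_normE /= => xy; apply: (le_trans (fL1' _ _)).
by rewrite mulrC -ler_pdivlMr// ltW.
Qed.

Lemma enorm_continuous : continuous (@enorm R).
Proof.
apply: (@enorm_lipschitz_continuous _ 1) => x y.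
by rewrite mul1r (le_trans (ler_norm _))// ler_dist_enorm.
Qed.

Lemma dotp_continuous v : continuous (@dotp R v).
Proof.
apply: (@enorm_lipschitz_continuous _ (enorm v)) => x y.
by rewrite -dotpNr -dotpDr dotp_le_enorm.
Qed.

Lemma measurable_comp_continuous d (T : measurableType d) (F : T -> 'rV[R]_3)
    (f : 'rV[R]_3 -> R) :
  (forall i, measurable_fun setT (fun t => F t 0 i)) -> continuous f ->
  measurable_fun setT (fun t => f (F t)).
Proof.
move=> mF /continuousP cf; apply: (measurability _ (RGenOpens.measurableE R)).
move=> _ [_ [a [b ->] <-]]; rewrite setTI comp_preimage.
by apply: measurable_preimage_open_rV => //; apply: cf; exact: interval_open.
Qed.

End euclid.

Section sphere.
Context {R : realType}.
Implicit Types (g h : S2 R -> R) (u : S2 R).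

Lemma enorm_S2 u : enorm (\val u) = 1.
Proof. by have := set_valP u. Qed.

Lemma dotp_S2 u : dotp (\val u) (\val u) = 1.
Proof. by rewrite -sqr_enorm enorm_S2 expr1n. Qed.

Lemma val_S2_continuous : continuous (fun u : S2 R => \val u : 'rV[R]_3).
Proof. exact: initial_continuous. Qed.

(** The sphere is closed and bounded in [R^3]. A filter on the subtype is pushed forward to [R^3],
    and its cluster point is pulled back because the topology of [S2 R] is the initial one. *)
Lemma compact_S2 : compact [set: S2 R].
Proof.
have cS : compact (@S2set R).
  apply: bounded_closed_compact.
    exists 1; split; first exact: num_real.
    move=> M M1 u /= uS; apply: (le_trans _ (ltW M1)).
    rewrite [leLHS]mx_normrE; apply/bigmax_leP; split => //= -[i j] _ /=.
    by rewrite ord1 -uS; exact: norm_coord_le_enorm.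
  rewrite (_ : @S2set R = @enorm R @^-1` [set 1])//.
  apply: closed_comp => [u _|]; first exact: enorm_continuous.
  exact: closed_eq.
move=> F FF _.
have [|p [pS clp]] := cS ((\val : S2 R -> 'rV[R]_3) @ F) _.
  by apply: (@filterS _ F _ setT _ _ filterT) => u _; exact: set_valP.
have pS' : p \in @S2set R by exact/mem_set.
exists (SigSub pS'); split => // A B FA /= nB.
have [C [[W oW WC] Cp CB]] := nB.
have Wp : W p by move: Cp; rewrite -WC.
have FvA : ((\val : S2 R -> 'rV[R]_3) @ F) ((\val : S2 R -> 'rV[R]_3) @` A).
  by apply: (@filterS _ F _ A) => // u Au /=; exists u.
have nW : nbhs p W by exact: open_nbhs_nbhs.
have [q [[u Au <-] Wq]] := clp _ _ FvA nW.
by exists u; split => //; apply: CB; rewrite -WC.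
Qed.

Lemma continuous_S2_measurable g : continuous g -> measurable_fun setT g.
Proof.
move=> /continuousP cg; apply: (measurability _ (RGenOpens.measurableE R)).
move=> _ [_ [a [b ->] <-]]; rewrite setTI.
by apply: sub_sigma_algebra; apply: cg; exact: interval_open.
Qed.

Lemma continuous_S2_bounded g : continuous g ->
  exists2 M, 0 < M & forall u, `|g u| <= M.
Proof.
move=> cg; have : compact (g @` setT).
  by apply: continuous_compact compact_S2; exact: continuous_subspaceT.
move=> /compact_bounded [M [Mr Mb]]; exists (`|M| + 1).
  by rewrite ltr_wpDl.
move=> u; apply: (Mb (`|M| + 1)) => /=; last by exists u.
by rewrite ltr_pwDr// ler_norm.
Qed.

Lemma C_S2_cst (a : R) : C_S2 (fun=> a : R).
Proof. by rewrite /C_S2/=; exact: cst_continuous. Qed.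

Lemma C_S2D g h : C_S2 g -> C_S2 h -> C_S2 (g \+ h).
Proof. by move=> cg ch u; exact: (cvgD (cg u) (ch u)). Qed.

Lemma C_S2Z (a : R) g : C_S2 g -> C_S2 (fun u => a * g u).
Proof. by move=> cg u; exact: (cvgM (@cst_continuous (S2 R) R a u) (cg u)). Qed.

Lemma C_S2N g : C_S2 g -> C_S2 (fun u => - g u).
Proof. by move=> cg u; exact: (cvgN (cg u)). Qed.

Lemma C_S2B g h : C_S2 g -> C_S2 h -> C_S2 (g \- h).
Proof. by move=> cg ch u; exact: (cvgB (cg u) (ch u)). Qed.

Lemma C_S2_val (f : 'rV[R]_3 -> R) : continuous f -> C_S2 (fun u => f (\val u)).
Proof.
by move=> cf u; apply: continuous_comp; [exact: val_S2_continuous|exact: cf].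
Qed.

Lemma C_S2_linS2 (a : 'rV[R]_3) : C_S2 (linS2 a).
Proof. exact: (C_S2_val (@dotp_continuous R a)). Qed.

Lemma sup_norm_ub g u : C_S2 g -> `|g u| <= sup_norm g.
Proof.
move=> cg; apply: ub_le_sup; last by exists u.
by have [M _ gM] := continuous_S2_bounded cg; exists M => _ [v _ <-].
Qed.

Lemma sup_norm_le g (M : R) : (forall u, `|g u| <= M) -> sup_norm g <= M.
Proof.
move=> gM; apply: ge_sup; first by exists `|g (pole R)|, (pole R).
by move=> _ [u _ <-].
Qed.

Lemma sup_norm_ge0 g : C_S2 g -> 0 <= sup_norm g.
Proof. by move=> cg; exact: le_trans (sup_norm_ub (pole R) cg). Qed.

Lemma has_inf_quot_norm g : C_S2 g -> has_inf [set sup_norm (g \+ linS2 a) | a in setT].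
Proof.
move=> cg; split; first by exists (sup_norm (g \+ linS2 0)), 0.
exists 0 => _ [a _ <-]; apply: sup_norm_ge0.
by apply: C_S2D => //; exact: C_S2_linS2.
Qed.

Lemma quot_norm_le g a : C_S2 g -> quot_norm g <= sup_norm (g \+ linS2 a).
Proof. by move=> cg; apply: ge_inf; [exact: (has_inf_quot_norm cg).2|exists a]. Qed.

Lemma quot_norm_lt g e : C_S2 g -> quot_norm g < e ->
  exists a, sup_norm (g \+ linS2 a) < e.
Proof.
by move=> cg /(inf_lt (has_inf_quot_norm cg).1)[_ [a _ <-] ae]; exists a.
Qed.

End sphere.

(** * Bilinearity of the pairing between charges and continuous functions *)

Section pairing.
Context {R : realType}.
Implicit Types (g h : S2 R -> R) (xi eta : M_S2 R) (u : S2 R).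
Local Notation msr := {measure set (S2 R) -> \bar R}.

Lemma C_S2_integrable (m : msr) g : (m setT < +oo)%E -> C_S2 g ->
  m.-integrable setT (EFin \o g).
Proof.
move=> mfin cg; apply: measurable_bounded_integrable => //.
  exact: continuous_S2_measurable.
have [M _ gM] := continuous_S2_bounded cg.
exists M; split; first exact: num_real.
by move=> x Mx u _; exact: le_trans (gM u) (ltW Mx).
Qed.

Definition pos_part xi : msr := jordan_pos (projT2 (hahn_sets xi)).
Definition neg_part xi : msr := jordan_neg (projT2 (hahn_sets xi)).

Let pos_fin xi : (pos_part xi setT < +oo)%E.
Proof. by rewrite -ge0_fin_numE//; exact: fin_num_measure. Qed.

Let neg_fin xi : (neg_part xi setT < +oo)%E.
Proof. by rewrite -ge0_fin_numE//; exact: fin_num_measure. Qed.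

Let pos_negE xi A : measurable A -> (xi A = pos_part xi A - neg_part xi A)%E.
Proof.
move=> mA; rewrite (jordan_decomp (projT2 (hahn_sets xi)) mA) /cadd/= /cscale/=.
by rewrite mulN1e.
Qed.

(** The Jordan parts do not depend linearly on the charge. However, two decompositions of [xi] as a
    difference of finite measures give [pos_part xi + m2 = m1 + neg_part xi], so that any of them
    computes the pairing; linearity in [xi] then follows by choosing a convenient one. *)
Lemma pairing_measures xi (m1 m2 : msr) g :
  (m1 setT < +oo)%E -> (m2 setT < +oo)%E ->
  (forall A, measurable A -> (xi A = m1 A - m2 A)%E) -> C_S2 g ->
  pairing xi g = \int[m1]_u g u - \int[m2]_u g u.
Proof.
move=> f1 f2 xiE cg.
have fin (m : msr) A : measurable A -> (m setT < +oo)%E -> m A \is a fin_num.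
  move=> mA mf; rewrite ge0_fin_numE//; apply: le_lt_trans mf.
  by apply: le_measure => //; rewrite inE.
have aux (p n a b : \bar R) : (p \is a fin_num -> n \is a fin_num ->
    a \is a fin_num -> b \is a fin_num -> p - n = a - b -> p + b = a + n)%E.
  move: p n a b => [p||] [n||] [a||] [b||]// _ _ _ _ [pnab].
  by apply: (congr1 EFin); lra.
have E : (\int[measure_add (pos_part xi) m2]_u (g u)%:E =
          \int[measure_add m1 (neg_part xi)]_u (g u)%:E)%E.
  apply: eq_measure_integral => A mA _ /=.
  have := xiE _ mA; rewrite pos_negE//= /measure_add /msum !big_ord_recl !big_ord0 /=.
  rewrite !adde0.
  apply: aux; [exact: fin (pos_fin xi)|exact: fin (neg_fin xi)|exact: fin|exact: fin].
have i1 := C_S2_integrable f1 cg; have i2 := C_S2_integrable f2 cg.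
have ip := C_S2_integrable (pos_fin xi) cg.
have iN := C_S2_integrable (neg_fin xi) cg.
have h (m : msr) : m.-integrable setT (EFin \o g) ->
    (\int[m]_u (g u)%:E = (\int[m]_u g u)%:E)%E.
  by move=> im; rewrite /Rintegral fineK//; exact: integrable_fin_num.
have Ep := integral_measure_add measurableT ip i2.
have En := integral_measure_add measurableT i1 iN.
have [] : ((\int[pos_part xi]_u g u)%:E + (\int[m2]_u g u)%:E =
    (\int[m1]_u g u)%:E + (\int[neg_part xi]_u g u)%:E)%E.
  by rewrite -(h _ ip) -(h _ i1) -(h _ i2) -(h _ iN) -[LHS]Ep -[RHS]En E.
by rewrite /pairing -/(pos_part xi) -/(neg_part xi) => ?; lra.
Qed.

Let RintegralM (m1 m2 : msr) g : (m1 setT < +oo)%E -> (m2 setT < +oo)%E ->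
  C_S2 g ->
  \int[measure_add m1 m2]_u g u = \int[m1]_u g u + \int[m2]_u g u.
Proof.
move=> f1 f2 cg; have i1 := C_S2_integrable f1 cg; have i2 := C_S2_integrable f2 cg.
have E := integral_measure_add measurableT i1 i2.
by rewrite /Rintegral [X in fine X]E fineD//; exact: integrable_fin_num.
Qed.

Let measure_addT (m1 m2 : msr) : (m1 setT < +oo)%E -> (m2 setT < +oo)%E ->
  (measure_add m1 m2 setT < +oo)%E.
Proof.
move=> f1 f2; rewrite /measure_add /msum !big_ord_recl big_ord0 /= adde0.
exact: lte_add_pinfty.
Qed.

Let measure_addE (m1 m2 : msr) A : measure_add m1 m2 A = (m1 A + m2 A)%E.
Proof. by rewrite /measure_add /msum !big_ord_recl big_ord0 /= adde0. Qed.

Let parts_fin xi (A : set (S2 R)) : measurable A ->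
  exists p n : R, pos_part xi A = p%:E /\ neg_part xi A = n%:E.
Proof.
move=> mA; exists (fine (pos_part xi A)), (fine (neg_part xi A)).
have h (m : msr) : (m setT < +oo)%E -> m A \is a fin_num.
  move=> mf; rewrite ge0_fin_numE//; apply: le_lt_trans mf.
  by apply: le_measure => //; rewrite inE.
by rewrite !fineK; [|exact: h (neg_fin xi)|exact: h (pos_fin xi)].
Qed.

Lemma pairing_cadd xi eta g : C_S2 g ->
  pairing (cadd xi eta) g = pairing xi g + pairing eta g.
Proof.
move=> cg.
have fp := measure_addT (pos_fin xi) (pos_fin eta).
have fn := measure_addT (neg_fin xi) (neg_fin eta).
rewrite (@pairing_measures (cadd xi eta) _ _ _ fp fn _ cg).
  rewrite (RintegralM (pos_fin xi) (pos_fin eta) cg).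
  rewrite (RintegralM (neg_fin xi) (neg_fin eta) cg) /pairing.
  by rewrite opprD addrACA.
move=> A mA.
suff : (xi A + eta A = measure_add (pos_part xi) (pos_part eta) A -
  measure_add (neg_part xi) (neg_part eta) A)%E by [].
rewrite !measure_addE.
have [p [n [pE nE]]] := parts_fin xi mA; have [q [m [qE mE]]] := parts_fin eta mA.
rewrite !pos_negE// pE nE qE mE.
by apply: (congr1 EFin); rewrite opprD addrACA.
Qed.

Lemma pairing_copp xi g : C_S2 g -> pairing (copp xi) g = - pairing xi g.
Proof.
move=> cg; rewrite (pairing_measures (neg_fin xi) (pos_fin xi) _ cg).
  by rewrite opprB.
move=> A mA; suff : (- xi A = neg_part xi A - pos_part xi A)%E by [].
rewrite pos_negE//.
have [p [n [-> ->]]] := parts_fin xi mA.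
by apply: (congr1 EFin); rewrite opprB.
Qed.

Lemma pairing_csub xi eta g : C_S2 g ->
  pairing (csub xi eta) g = pairing xi g - pairing eta g.
Proof. by move=> cg; rewrite /csub pairing_cadd// pairing_copp. Qed.

Let Rintegral_mscale (l : {nonneg R}) (m : msr) g : (m setT < +oo)%E ->
  C_S2 g -> \int[mscale l m]_u g u = l%:num * \int[m]_u g u.
Proof.
move=> mf cg; have im := C_S2_integrable mf cg.
have mg : measurable_fun setT (EFin \o g) by case/integrableP: im.
have ipos := integrable_pos_fin_num measurableT im; have ineg := integrable_neg_fin_num measurableT im.
have -> : l%:num * \int[m]_u g u = fine (l%:num%:E * \int[m]_u (g u)%:E)%E.
  by rewrite fineM//; exact: integrable_fin_num.
congr fine; rewrite [LHS]integralE [in RHS]integralE.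
rewrite muleBr//; last exact: fin_num_adde_defr.
have Ep := ge0_integral_mscale m measurableT l (measurable_funepos mg)
  (fun u _ => funepos_ge0 _ u).
have En := ge0_integral_mscale m measurableT l (measurable_funeneg mg)
  (fun u _ => funeneg_ge0 _ u).
by congr (_ - _)%E.
Qed.

Let pairing_cscale_ge0 (l : {nonneg R}) xi g : C_S2 g ->
  pairing (cscale l%:num xi) g = l%:num * pairing xi g.
Proof.
move=> cg.
have fin (m : msr) : (m setT < +oo)%E -> (mscale l m setT < +oo)%E.
  by move=> mf; rewrite /mscale/= lte_mul_pinfty.
rewrite (@pairing_measures _ _ _ _ (fin _ (pos_fin xi)) (fin _ (neg_fin xi)) _ cg).
  rewrite (Rintegral_mscale l (pos_fin xi) cg) (Rintegral_mscale l (neg_fin xi) cg).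
  by rewrite -mulrBr.
move=> A mA.
suff : (l%:num%:E * xi A = l%:num%:E * pos_part xi A - l%:num%:E * neg_part xi A)%E by [].
rewrite pos_negE//.
have [p [n [-> ->]]] := parts_fin xi mA.
by apply: (congr1 EFin); rewrite mulrBr.
Qed.

Lemma eq_pairing xi eta g : (forall A, measurable A -> xi A = eta A) -> C_S2 g ->
  pairing xi g = pairing eta g.
Proof.
move=> xe cg; rewrite (pairing_measures (pos_fin eta) (neg_fin eta) _ cg)//.
by move=> A mA; rewrite xe// pos_negE.
Qed.

Lemma pairing_cscale (k : R) xi g : C_S2 g ->
  pairing (cscale k xi) g = k * pairing xi g.
Proof.
move=> cg; have [k0|k0] := leP 0 k; first exact: (pairing_cscale_ge0 (NngNum k0)).
have Nk0 : 0 <= - k by rewrite oppr_ge0 ltW.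
rewrite (@eq_pairing _ (copp (cscale (- k) xi)) g _ cg).
  rewrite pairing_copp// (pairing_cscale_ge0 (NngNum Nk0))//=.
  by rewrite mulNr opprK.
move=> A mA; suff : (k%:E * xi A = - ((- k)%:E * xi A))%E by [].
by rewrite EFinN mulNe oppeK.
Qed.

Lemma pairing_dirac (u : S2 R) g : C_S2 g ->
  pairing (charge_of_finite_measure (dirac u)) g = g u.
Proof.
move=> cg; have d1 : (@dirac _ (S2 R) u R setT < +oo)%E.
  by rewrite diracT ltry.
have z1 : ((mzero : msr) setT < +oo)%E by rewrite /mzero ltry.
rewrite (@pairing_measures _ _ _ _ d1 z1 _ cg); last first.
  by move=> A mA; rewrite /mzero sube0.
rewrite /Rintegral integral_measure_zero integral_dirac// ?diracT ?mul1e /= ?subr0//.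
by apply/measurable_EFinP; exact: continuous_S2_measurable.
Qed.

Lemma pairingD xi g h : C_S2 g -> C_S2 h ->
  pairing xi (g \+ h) = pairing xi g + pairing xi h.
Proof.
move=> cg ch; rewrite /pairing !RintegralD//; first by rewrite opprD addrACA.
- exact: C_S2_integrable (neg_fin xi) cg.
- exact: C_S2_integrable (neg_fin xi) ch.
- exact: C_S2_integrable (pos_fin xi) cg.
- exact: C_S2_integrable (pos_fin xi) ch.
Qed.

Lemma pairingZ xi (k : R) g : C_S2 g ->
  pairing xi (fun u => k * g u) = k * pairing xi g.
Proof.
move=> cg; rewrite /pairing !RintegralZl//; first by rewrite mulrBr.
- exact: C_S2_integrable (neg_fin xi) cg.
- exact: C_S2_integrable (pos_fin xi) cg.
Qed.

Lemma pairingN xi g : C_S2 g -> pairing xi (fun u => - g u) = - pairing xi g.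
Proof.
move=> cg; rewrite -mulN1r -pairingZ//; congr pairing.
by apply/funext => u; rewrite mulN1r.
Qed.

(** The constant is the total variation of [xi]. *)
Lemma pairing_bounded xi : exists2 K, 0 <= K &
  forall g (M : R), C_S2 g -> (forall u, `|g u| <= M) -> `|pairing xi g| <= K * M.
Proof.
exists (fine (pos_part xi setT) + fine (neg_part xi setT)).
  by rewrite addr_ge0// fine_ge0.
move=> g M cg gM; rewrite /pairing mulrDl.
apply: (le_trans (ler_normB _ _)).
have h (m : msr) : (m setT < +oo)%E -> `|\int[m]_u g u| <= fine (m setT) * M.
  move=> mf; have im := C_S2_integrable mf cg.
  apply: (le_trans (le_normr_Rintegral measurableT im)).
  rewrite mulrC -Rintegral_cst//; apply: le_Rintegral => //.
    exact: integrable_norm.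
  exact: (C_S2_integrable mf (@C_S2_cst R M)).
by apply: lerD; apply: h; [exact: pos_fin|exact: neg_fin].
Qed.

End pairing.

(** * Quadratic forms of a rotation *)

Section rotation_form.
Context {R : realType} {Omega : Type}.
Variables (bd : set (Omega -> R)) (I : (Omega -> R) -> R).
Hypothesis bdD : forall F G, bd F -> bd G -> bd (F \+ G).
Hypothesis bdZ : forall (a : R) F, bd F -> bd (a \*o F).
Hypothesis bdM : forall F G, bd F -> bd G -> bd (F \* G).
Hypothesis ID : forall F G, bd F -> bd G -> I (F \+ G) = I F + I G.
Hypothesis IZ : forall (a : R) F, bd F -> I (a \*o F) = a * I F.
Hypothesis I_ge0 : forall F, bd F -> (forall z, 0 <= F z) -> 0 <= I F.
Variable rho : nat -> Omega -> Omega.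
Hypothesis bd_rho : forall n F, bd F -> bd (F \o rho n).
Hypothesis I_rho : forall n F, bd F -> I (F \o rho n) = I F.
Hypothesis rhoS : forall n z, rho n.+1 (rho n.+1 z) = rho n z.
Implicit Types F G : Omega -> R.

(** The section is abstract: [bd] is an algebra of functions, [I] a positive linear functional on
    it, and [rho n] plays the rotation by [half_angle n], known only through the invariance of [I]
    and the halving rule [rhoS]. The first angle is a right angle, so that [rho 0] applied twice
    stands for the antipodal map. *)
Definition half_angle (n : nat) : R := pi / 2 ^+ n.+1.

Definition sq_form F := I (F \* F).
Definition corr_form n F := I (F \* (F \o rho n)).
Definition incr_form n F := I ((F \o rho n \- F) \* (F \o rho n \- F)).
Definition rot_form n F := 2 * cos (half_angle n) * sq_form F - 2 * corr_form n F.

Let IB F G : bd F -> bd G -> I (F \- G) = I F - I G.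
Proof.
move=> bF bG; have -> : F \- G = F \+ ((-1) \*o G).
  by apply/funext => z /=; rewrite mulN1r.
by rewrite ID ?IZ ?mulN1r//; exact: bdZ.
Qed.

Let bdB F G : bd F -> bd G -> bd (F \- G).
Proof.
move=> bF bG; have -> : F \- G = F \+ ((-1) \*o G).
  by apply/funext => z /=; rewrite mulN1r.
by apply: bdD => //; exact: bdZ.
Qed.

Let half_angleS n : half_angle n = half_angle n.+1 + half_angle n.+1.
Proof.
rewrite /half_angle [in RHS]exprS.
by field; rewrite expf_neq0.
Qed.

Lemma half_angle0 : half_angle 0 = pi / 2.
Proof. by rewrite /half_angle expr1. Qed.

Lemma half_angle_gt0 n : 0 < half_angle n.
Proof. by rewrite divr_gt0 ?pi_gt0 ?exprn_gt0. Qed.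

Lemma half_angle_le n : half_angle n <= pi / 2.
Proof.
rewrite ler_pM2l ?pi_gt0// lef_pV2 ?posrE ?exprn_gt0//.
by rewrite -[leLHS]expr1 ler_weXn2l// ler1n.
Qed.

Lemma cos_half_angle_ge0 n : 0 <= cos (half_angle n).
Proof.
apply: cos_ge0_pihalf; rewrite half_angle_le andbT.
by rewrite (le_trans _ (ltW (half_angle_gt0 n)))// oppr_le0 divr_ge0// pi_ge0.
Qed.

Lemma cos_half_angleS n : cos (half_angle n) = 2 * cos (half_angle n.+1) ^+ 2 - 1.
Proof.
rewrite half_angleS cosD; have := cos2Dsin2 (half_angle n.+1).
by set c := cos _; set s := sin _; rewrite !expr2; lra.
Qed.

Lemma cos_half_angleS_gt0 n : 0 < cos (half_angle n.+1).
Proof.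
rewrite lt_def cos_half_angle_ge0 andbT; apply/eqP => c0.
by have := cos_half_angle_ge0 n; rewrite cos_half_angleS c0 expr0n/= mulr0 sub0r oppr_ge0 ler10.
Qed.

Lemma incr_formE n F : bd F -> incr_form n F = 2 * sq_form F - 2 * corr_form n F.
Proof.
move=> bF; rewrite /incr_form /sq_form /corr_form.
have bFr := bd_rho n bF.
have -> : (F \o rho n \- F) \* (F \o rho n \- F) =
    (((F \* F) \o rho n) \+ (F \* F)) \- (2 \*o (F \* (F \o rho n))).
  by apply/funext => z /=; ring.
have bFF : bd (F \* F) by exact: bdM.
have bFn : bd (F \* (F \o rho n)) by exact: bdM.
have bFFr := bd_rho n bFF.
rewrite (IB (bdD bFFr bFF) (bdZ 2 bFn)) (ID bFFr bFF) (IZ 2 bFn) (I_rho n bFF).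
by ring.
Qed.

Lemma sq_form_ge0 F : bd F -> 0 <= sq_form F.
Proof. by move=> bF; apply: I_ge0 => [|z /=]; [exact: bdM|rewrite -expr2 sqr_ge0]. Qed.

(** The increment over the full angle is the sum of two increments over the half angle, which have
    the same integral of squares by invariance. The defect in [(x + y)^2 <= 2 x^2 + 2 y^2] is the
    square of the second difference. *)
Lemma incr_form_half n F : bd F -> incr_form n F <= 4 * incr_form n.+1 F.
Proof.
move=> bF; have bFr := bd_rho n bF; have bFS := bd_rho n.+1 bF.
have bFSS := bd_rho n.+1 bFS.
pose D := F \o rho n.+1 \- F.
have bD : bd D by exact: bdB.
have bDr := bd_rho n.+1 bD.
have bDD : bd (D \* D) by exact: bdM.
have bDDr := bd_rho n.+1 bDD.
have b1 := bdD (bdZ 2 bDDr) (bdZ 2 bDD).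
have -> : 4 * incr_form n.+1 F = I ((2 \*o ((D \* D) \o rho n.+1)) \+ (2 \*o (D \* D))).
  rewrite (ID (bdZ 2 bDDr) (bdZ 2 bDD)) (IZ 2 bDDr) (IZ 2 bDD) (I_rho _ bDD).
  by rewrite /incr_form -/D; ring.
have b2 : bd ((F \o rho n \- F) \* (F \o rho n \- F)) by apply: bdM; exact: bdB.
rewrite -subr_ge0 /incr_form -(IB b1 b2).
apply: I_ge0 => [|z]; first exact: bdB.
rewrite /D /= !rhoS.
set a := F (rho n z); set b := F (rho n.+1 z); set e := F z.
rewrite [leRHS](_ : _ = (a - 2 * b + e) ^+ 2) ?sqr_ge0//; ring.
Qed.

Lemma rot_form_ge0 n F : bd F -> (forall z, F (rho 0%N (rho 0%N z)) = - F z) ->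
  0 <= rot_form n F.
Proof.
move=> bF oddF; suff : corr_form n F <= cos (half_angle n) * sq_form F.
  by rewrite /rot_form; lra.
elim: n => [|n IH].
  rewrite half_angle0 cos_pihalf mul0r.
  have bG : bd (F \* (F \o rho 0%N)) by apply: bdM => //; exact: bd_rho.
  have := I_rho 0%N bG.
  have -> : (F \* (F \o rho 0%N)) \o rho 0%N = (-1) \*o (F \* (F \o rho 0%N)).
    by apply/funext => z /=; rewrite oddF; ring.
  by rewrite IZ// /corr_form; lra.
set c := cos (half_angle n.+1); have c0 : 0 < c := cos_half_angleS_gt0 n.
have bFS := bd_rho n.+1 bF; have bFr := bd_rho n bF.
(* The square terms of [c * (b - (a + e) / (2 c))^2], where [e], [b], [a] are the values of [F] at
   [z] and after one and two half rotations. The cross terms [b * e] and [b * a] have the same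
   integral, [corr_form n.+1 F]. *)
pose E := (c \*o ((F \* F) \o rho n.+1)) \+
   ((4 * c)^-1 \*o (((F \* F) \+ ((F \* F) \o rho n)) \+ (2 \*o (F \* (F \o rho n))))).
have bFF : bd (F \* F) by exact: bdM.
have bFFr := bd_rho n bFF; have bFFS := bd_rho n.+1 bFF.
have bFn : bd (F \* (F \o rho n)) by exact: bdM.
have bE : bd E by do ?[apply: bdD|apply: bdZ].
have IE : I E = c * sq_form F + (4 * c)^-1 * (2 * sq_form F + 2 * corr_form n F).
  have b1 := bdD bFF bFFr; have b2 := bdZ 2 bFn.
  rewrite /E (ID (bdZ c bFFS) (bdZ (4 * c)^-1 (bdD b1 b2))) (IZ c bFFS).
  rewrite (IZ _ (bdD b1 b2)) (ID b1 b2) (ID bFF bFFr) (IZ 2 bFn).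
  by rewrite (I_rho _ bFF) (I_rho _ bFF) /sq_form /corr_form; ring.
have bG : bd (F \* (F \o rho n.+1)) by exact: bdM.
have bGr := bd_rho n.+1 bG.
have : 0 <= I (E \- ((F \* (F \o rho n.+1)) \+ ((F \* (F \o rho n.+1)) \o rho n.+1))).
  apply: I_ge0 => [|z]; first by apply: bdB => //; exact: bdD.
  rewrite /E /= rhoS.
  set a := F (rho n z); set b := F (rho n.+1 z); set e := F z.
  rewrite [leRHS](_ : _ = c * (b - (2 * c)^-1 * (a + e)) ^+ 2).
    by rewrite mulr_ge0 ?sqr_ge0// ltW.
  by field; rewrite gt_eqF.
rewrite (IB bE (bdD bG bGr)) (ID bG bGr) (I_rho _ bG) IE -/(corr_form n.+1 F) => h.
have s0 := sq_form_ge0 bF.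
have : (4 * c)^-1 * (2 * sq_form F + 2 * corr_form n F) <= c * sq_form F.
  rewrite -(ler_pM2l (_ : 0 < 4 * c)) ?mulr_gt0// mulrA mulfV ?mul1r ?gt_eqF ?mulr_gt0//.
  move: IH; rewrite cos_half_angleS -/c; nra.
by lra.
Qed.

Lemma rot_form_conv n F G (s : R) : bd F -> bd G ->
  rot_form n ((s \*o F) \+ ((1 - s) \*o G)) =
  s * rot_form n F + (1 - s) * rot_form n G - s * (1 - s) * rot_form n (F \- G).
Proof.
move=> bF bG; have bFr := bd_rho n bF; have bGr := bd_rho n bG.
have bFF : bd (F \* F) by exact: bdM.
have bGG : bd (G \* G) by exact: bdM.
have bFG : bd (F \* G) by exact: bdM.
have b1 : bd (F \* (F \o rho n)) by exact: bdM.
have b2 : bd (F \* (G \o rho n)) by exact: bdM.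
have b3 : bd (G \* (F \o rho n)) by exact: bdM.
have b4 : bd (G \* (G \o rho n)) by exact: bdM.
have sqE (a b : R) : sq_form ((a \*o F) \+ (b \*o G)) =
    a ^+ 2 * I (F \* F) + (2 * a * b) * I (F \* G) + b ^+ 2 * I (G \* G).
  rewrite -!IZ// -!ID; [|by do ?[apply: bdD|apply: bdZ]..].
  by congr I; apply/funext => z /=; ring.
have corrE (a b : R) : corr_form n ((a \*o F) \+ (b \*o G)) =
    a ^+ 2 * I (F \* (F \o rho n)) + (a * b) * I (F \* (G \o rho n)) +
    (a * b) * I (G \* (F \o rho n)) + b ^+ 2 * I (G \* (G \o rho n)).
  rewrite -!IZ// -!ID; [|by do ?[apply: bdD|apply: bdZ]..].
  by congr I; apply/funext => z /=; ring.
have -> : F \- G = (1 \*o F) \+ ((-1) \*o G).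
  by apply/funext => z /=; ring.
by rewrite /rot_form !sqE !corrE /sq_form /corr_form; ring.
Qed.

(* A quadratic form that is nonnegative on the line [F + t G] and vanishes at [G]
   does not see [G]. *)
Lemma rot_form_kernel n F G : bd F -> bd G ->
  (forall z, F (rho 0%N (rho 0%N z)) = - F z) ->
  (forall z, G (rho 0%N (rho 0%N z)) = - G z) ->
  rot_form n G = 0 -> rot_form n (F \+ G) = rot_form n F.
Proof.
move=> bF bG oF oG G0.
have key (t : R) : rot_form n (F \+ (t \*o G)) =
   rot_form n F + t * (rot_form n (F \+ G) - rot_form n F).
  have bFG : bd (F \+ G) by exact: bdD.
  have := rot_form_conv n t bFG bF.
  have -> : (t \*o (F \+ G)) \+ ((1 - t) \*o F) = F \+ (t \*o G).
    by apply/funext => z /=; ring.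
  have -> : (F \+ G) \- F = G by apply/funext => z /=; ring.
  by rewrite G0 => ->; ring.
set b := rot_form n (F \+ G) - rot_form n F in key.
suff b0 : b = 0 by apply/eqP; rewrite -subr_eq0; apply/eqP.
have pos (t : R) : 0 <= rot_form n F + t * b.
  rewrite -key; apply: rot_form_ge0 => [|z /=]; last by rewrite oF oG; ring.
  by apply: bdD => //; exact: bdZ.
apply/eqP; apply: contraT => bn0.
have := pos (- (rot_form n F + 1) / b); rewrite mulfVK//; lra.
Qed.

End rotation_form.

(** * Shears and rotations of [R^3 x R^3] *)

Section preserving_shear.
Context d1 d2 (T1 : measurableType d1) (T2 : measurableType d2) (R : realType).
Variables (m1 : {sigma_finite_measure set T1 -> \bar R})
  (m2 : {sigma_finite_measure set T2 -> \bar R}).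
Local Open Scope ereal_scope.

Definition product_m : set (T1 * T2) -> \bar R := m1 \x m2.
HB.instance Definition _ := Measure.on product_m.

(** Fubini with the sheared factor integrated first: each slice is preserved by hypothesis. *)
Lemma measure_preserving_shear1 (phi : T1 * T2 -> T1) :
  measurable_fun setT phi ->
  (forall q, measure_preserving m1 m1 (fun p => phi (p, q))) ->
  measure_preserving product_m product_m (fun z => (phi z, z.2)).
Proof.
move=> mphi pphi.
have mshear : measurable_fun setT (fun z : T1 * T2 => (phi z, z.2)).
  exact/measurable_fun_pair.
apply: measure_preservingI => // f mf f0.
have mfs : measurable_fun setT (fun z => f (phi z, z.2)).
  exact: measurableT_comp mf mshear.
apply: etrans (fubini_tonelli2 (m1 := m1) (m2 := m2) _ mf f0) _.
apply: etrans _ (esym (fubini_tonelli2 (m1 := m1) (m2 := m2) _ mfs (fun=> f0 _))).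
apply: eq_integral => q _; rewrite /fubini_G.
rewrite (ge0_integral_preserving (pphi q) measurableT)//.
exact: measurableT_comp mf (measurable_pair2 _).
Qed.

Lemma measure_preserving_shear2 (phi : T1 * T2 -> T2) :
  measurable_fun setT phi ->
  (forall p, measure_preserving m2 m2 (fun q => phi (p, q))) ->
  measure_preserving product_m product_m (fun z => (z.1, phi z)).
Proof.
move=> mphi pphi.
have mshear : measurable_fun setT (fun z : T1 * T2 => (z.1, phi z)).
  exact/measurable_fun_pair.
apply: measure_preservingI => // f mf f0.
have mfs : measurable_fun setT (fun z => f (z.1, phi z)).
  exact: measurableT_comp mf mshear.
apply: etrans (fubini_tonelli1 (m1 := m1) (m2 := m2) _ mf f0) _.
apply: etrans _ (esym (fubini_tonelli1 (m1 := m1) (m2 := m2) _ mfs (fun=> f0 _))).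
apply: eq_integral => p _; rewrite /fubini_F.
rewrite (ge0_integral_preserving (pphi p) measurableT)//.
exact: measurableT_comp mf (measurable_pair1 _).
Qed.

End preserving_shear.

Lemma measure_preserving_comp d1 d2 d3 (T1 : measurableType d1)
    (T2 : measurableType d2) (T3 : measurableType d3) (R : realType)
    (m1 : {measure set T1 -> \bar R}) (m2 : {measure set T2 -> \bar R})
    (m3 : {measure set T3 -> \bar R}) (f : T1 -> T2) (g : T2 -> T3) :
  measure_preserving m1 m2 f -> measure_preserving m2 m3 g ->
  measure_preserving m1 m3 (g \o f).
Proof.
move=> [mf fE] [mg gE]; split=> [|A mA]; first exact: measurableT_comp.
rewrite comp_preimage fE ?gE//.
by rewrite -[X in measurable X]setTI; exact: mg.
Qed.

Section rotation6.
Context {R : realType}.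
Local Notation R6 := (R3 R * R3 R)%type.
Implicit Types (a b c s : R) (p q : R3 R) (z : R6).

Definition comb3 a b p q : R3 R :=
  (a * p.1.1 + b * q.1.1, a * p.1.2 + b * q.1.2, a * p.2 + b * q.2).

Lemma vec3_comb3 a b p q : vec3 (comb3 a b p q) = a *: vec3 p + b *: vec3 q.
Proof. by apply: rV3P; rewrite !mxE. Qed.

Lemma vec3_coord p : (vec3 p 0 0 = p.1.1) * (vec3 p 0 1 = p.1.2) * (vec3 p 0 2%:R = p.2).
Proof. by rewrite !mxE. Qed.

Lemma measurable_comb3 a b : measurable_fun setT (fun z : R6 => comb3 a b z.1 z.2).
Proof.
have m1 (h : R3 R -> R) : measurable_fun setT h ->
    measurable_fun setT (fun z : R6 => a * h z.1 + b * h z.2).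
  move=> mh; apply: measurable_funD; apply: measurable_funM => //.
    exact: measurableT_comp mh measurable_fst.
  exact: measurableT_comp mh measurable_snd.
apply/measurable_fun_pair => /=; first apply/measurable_fun_pair => /=.
- by apply: (m1 (fun p => p.1.1)); exact: measurableT_comp.
- by apply: (m1 (fun p => p.1.2)); exact: measurableT_comp.
- by apply: (m1 (fun p => p.2)); exact: measurable_snd.
Qed.

Definition lebesgue6 := @product_m _ _ _ _ _ (@lebesgue3 R) (@lebesgue3 R).
HB.instance Definition _ := Measure.on lebesgue6.

Definition shear1 a z : R6 := (comb3 1 a z.1 z.2, z.2).
Definition shear2 a z : R6 := (z.1, comb3 a 1 z.1 z.2).
Definition rot6 c s z : R6 := (comb3 c s z.1 z.2, comb3 (- s) c z.1 z.2).

Lemma shear1_preserving a : measure_preserving lebesgue6 lebesgue6 (shear1 a).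
Proof.
apply: (@measure_preserving_shear1 _ _ _ _ _ (@lebesgue3 R) (@lebesgue3 R)
  (fun z => comb3 1 a z.1 z.2)); first exact: measurable_comb3.
move=> q; exact: (@lebesgue3_preserving_affine R 1 1 1 (a * q.1.1) (a * q.1.2)
  (a * q.2) (normr1 _) (normr1 _) (normr1 _)).
Qed.

Lemma shear2_preserving a : measure_preserving lebesgue6 lebesgue6 (shear2 a).
Proof.
apply: (@measure_preserving_shear2 _ _ _ _ _ (@lebesgue3 R) (@lebesgue3 R)
  (fun z => comb3 a 1 z.1 z.2)); first exact: measurable_comb3.
move=> p; have -> : (fun q => comb3 a 1 (p, q).1 (p, q).2) = fun q =>
   (1 * q.1.1 + a * p.1.1, 1 * q.1.2 + a * p.1.2, 1 * q.2 + a * p.2).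
  by apply/funext => q; rewrite /comb3/=; congr (_, _, _); rewrite addrC.
exact: (@lebesgue3_preserving_affine R 1 1 1 (a * p.1.1) (a * p.1.2)
  (a * p.2) (normr1 _) (normr1 _) (normr1 _)).
Qed.

(* A rotation of angle different from [pi] is a product of three shears. *)
Lemma rot6_preserving c s : c ^+ 2 + s ^+ 2 = 1 -> c != -1 ->
  measure_preserving lebesgue6 lebesgue6 (rot6 c s).
Proof.
move=> cs1 cN1; have c1 : 1 + c != 0 by rewrite addrC addr_eq0.
pose a := s / (1 + c).
have -> : rot6 c s = shear1 a \o (shear2 (- s) \o shear1 a).
  have E1 : 1 + a * - s = c.
    have s2 : s ^+ 2 = (1 - c) * (1 + c) by rewrite -subr_sqr expr1n -cs1; ring.
    by rewrite /a mulrN mulrAC -expr2 s2 mulfK//; ring.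
  have E2 : a + a * c = s by rewrite /a; field.
  apply/funext => z; rewrite /rot6 /shear1 /shear2 /comb3 /=.
  have h1 (x y : R) : c * x + s * y = 1 * (1 * x + a * y) + a * (- s * (1 * x + a * y) + 1 * y).
    rewrite -[X in X * x]E1 -[X in X * y]E2 -E1; ring.
  have h2 (x y : R) : - s * x + c * y = - s * (1 * x + a * y) + 1 * y.
    by rewrite -[X in X * y]E1; ring.
  by congr (_, _, _, (_, _, _)); rewrite ?h1 ?h2.
apply: measure_preserving_comp (shear1_preserving a).
exact: measure_preserving_comp (shear1_preserving a) (shear2_preserving (- s)).
Qed.

Definition ball6 : set R6 :=
  [set z | dotp (vec3 z.1) (vec3 z.1) + dotp (vec3 z.2) (vec3 z.2) <= 1].

Lemma measurable_vec3_comp (f : 'rV[R]_3 -> R) : continuous f ->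
  measurable_fun setT (fun p => f (vec3 p)).
Proof. by move=> cf; apply: measurable_comp_continuous cf; exact: measurable_vec3_coord. Qed.

Lemma sqnorm_continuous : continuous (fun x : 'rV[R]_3 => dotp x x).
Proof.
have -> : (fun x : 'rV[R]_3 => dotp x x) = fun x => enorm x * enorm x.
  by apply/funext => x; rewrite -expr2 sqr_enorm.
by move=> x; apply: (@continuousM _ _ (@enorm R) (@enorm R)); exact: enorm_continuous.
Qed.

Lemma measurable_ball6 : measurable ball6.
Proof.
have mf : measurable_fun setT (fun z : R6 =>
    dotp (vec3 z.1) (vec3 z.1) + dotp (vec3 z.2) (vec3 z.2)).
  have m1 := measurable_vec3_comp sqnorm_continuous.
  apply: measurable_funD.
    exact: measurableT_comp m1 measurable_fst.
  exact: measurableT_comp m1 measurable_snd.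
have -> : ball6 = setT `&` (fun z : R6 =>
    dotp (vec3 z.1) (vec3 z.1) + dotp (vec3 z.2) (vec3 z.2)) @^-1` `]-oo, 1].
  by apply/seteqP; split=> z /=; rewrite in_itv/= => // -[].
by apply: mf => //; exact: measurable_itv.
Qed.

Lemma ball6_enorm z : ball6 z -> enorm (vec3 z.1) <= 1 /\ enorm (vec3 z.2) <= 1.
Proof.
rewrite /ball6/= -!sqr_enorm => zB.
have := enorm_ge0 (vec3 z.1); have := enorm_ge0 (vec3 z.2).
by split; rewrite -ler_sqr ?nnegrE ?enorm_ge0 ?ler01// expr1n; have := sqr_ge0 (enorm (vec3 z.1));
  have := sqr_ge0 (enorm (vec3 z.2)); lra.
Qed.

Lemma rot6_ball6 c s : c ^+ 2 + s ^+ 2 = 1 -> rot6 c s @^-1` ball6 = ball6.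
Proof.
move=> cs1; suff E z : dotp (vec3 (rot6 c s z).1) (vec3 (rot6 c s z).1) +
    dotp (vec3 (rot6 c s z).2) (vec3 (rot6 c s z).2) =
    dotp (vec3 z.1) (vec3 z.1) + dotp (vec3 z.2) (vec3 z.2).
  by apply/seteqP; split=> z; rewrite /ball6/= E.
rewrite !vec3_comb3 !dotp3E !mxE.
transitivity ((c ^+ 2 + s ^+ 2) * (dotp (vec3 z.1) (vec3 z.1) + dotp (vec3 z.2) (vec3 z.2))).
  by rewrite !dotp3E !mxE; ring.
by rewrite cs1 mul1r !dotp3E !mxE.
Qed.

(** An explicit set of finite volume containing the unit ball; it serves to show that measures are
    finite and to carry compactly supported integrands. *)
Definition cube3 : set (R3 R) := (`[(-1)%R, 1%R] `*` `[(-1)%R, 1%R]) `*` `[(-1)%R, 1%R].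

Lemma measurable_cube3 : measurable cube3.
Proof. by apply: measurableX; [apply: measurableX|]; exact: measurable_itv. Qed.

Lemma cube3_fin : (@lebesgue3 R cube3 < +oo)%E.
Proof.
pose J : set (measurableTypeR R) := `[(-1)%R, 1%R]%classic.
have mJ : measurable J by exact: measurable_itv.
have E2 := product_measure1E (@lebesgue_measure R) lebesgue_measure mJ mJ.
have E3 := product_measure1E (@lebesgue2 R) lebesgue_measure (measurableX mJ mJ) mJ.
have JE : lebesgue_measure J = 2%:E.
  by rewrite /J lebesgue_measure_itv/= lte_fin gtrN// -EFinB opprK.
have Jfin : (lebesgue_measure J < +oo)%E by rewrite JE ltry.
have Jfn : lebesgue_measure J \is a fin_num by rewrite JE.
have J2 : (@lebesgue2 R (J `*` J) < +oo)%E.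
  rewrite [X in (X < _)%E](E2 : lebesgue2 _ = _).
  exact: (lte_mul_pinfty (measure_ge0 _ _) Jfn Jfin).
have J2n : @lebesgue2 R (J `*` J) \is a fin_num by rewrite ge0_fin_numE.
suff : ((@lebesgue2 R \x lebesgue_measure) ((J `*` J) `*` J) < +oo)%E by [].
rewrite E3; exact: (lte_mul_pinfty (measure_ge0 _ _) J2n Jfin).
Qed.

Lemma enorm_cube3 p : enorm (vec3 p) <= 1 -> cube3 p.
Proof.
move=> p1; have h i : `|vec3 p 0 i| <= 1 by exact: le_trans (norm_coord_le_enorm _ _) p1.
have := h 0; have := h 1; have := h 2%:R; rewrite !vec3_coord !ler_norml => h2 h1 h0.
by rewrite /cube3/= !in_itv/=.
Qed.

Lemma ball6_fin : (lebesgue6 ball6 < +oo)%E.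
Proof.
apply: (@le_lt_trans _ _ (lebesgue6 (cube3 `*` cube3))).
  apply: le_measure; rewrite ?inE.
  - exact: measurable_ball6.
  - by apply: measurableX; exact: measurable_cube3.
  - by move=> z /ball6_enorm[z1 z2]; split; exact: enorm_cube3.
have -> : lebesgue6 (cube3 `*` cube3) = (lebesgue3 cube3 * lebesgue3 cube3)%E.
  exact: (product_measure1E _ _ measurable_cube3 measurable_cube3).
by rewrite lte_mul_pinfty// ?cube3_fin// ge0_fin_numE// cube3_fin.
Qed.

(** Boundedness is asked on the ball only, since 1-homogeneous functions are unbounded on the whole
    space; the class is still stable under rotations because these preserve the ball. *)
Definition bd6 (F : R6 -> R) := measurable_fun setT F /\
  exists M, forall z, ball6 z -> `|F z| <= M.
Definition int6 (F : R6 -> R) := \int[lebesgue6]_(z in ball6) F z.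

Lemma bd6_integrable F : bd6 F -> lebesgue6.-integrable ball6 (EFin \o F).
Proof.
move=> [mF [M FM]]; apply: measurable_bounded_integrable.
- exact: measurable_ball6.
- exact: ball6_fin.
- exact: measurable_funTS.
exists M; split; first exact: num_real.
by move=> x Mx z /= zB; exact: le_trans (FM z zB) (ltW Mx).
Qed.

Lemma bd6D F G : bd6 F -> bd6 G -> bd6 (F \+ G).
Proof.
move=> [mF [M FM]] [mG [N GN]]; split; first exact: measurable_funD.
by exists (M + N) => z zB; apply: le_trans (ler_normD _ _) _; rewrite lerD ?FM ?GN.
Qed.

Lemma bd6Z a F : bd6 F -> bd6 (a \*o F).
Proof.
move=> [mF [M FM]]; split; first exact: measurable_funM.
by exists (`|a| * M) => z zB; rewrite normrM ler_wpM2l ?FM.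
Qed.

Lemma bd6M F G : bd6 F -> bd6 G -> bd6 (F \* G).
Proof.
move=> [mF [M FM]] [mG [N GN]]; split; first exact: measurable_funM.
by exists (M * N) => z zB; rewrite normrM ler_pM ?FM ?GN.
Qed.

Lemma bd6_rot6 c s F : c ^+ 2 + s ^+ 2 = 1 -> bd6 F -> bd6 (F \o rot6 c s).
Proof.
move=> cs1 [mF [M FM]]; split.
  apply: measurableT_comp mF _.
  by apply/measurable_fun_pair; exact: measurable_comb3.
exists M => z zB; apply: FM.
by move: zB; rewrite -{1}(rot6_ball6 cs1).
Qed.

Lemma int6D F G : bd6 F -> bd6 G -> int6 (F \+ G) = int6 F + int6 G.
Proof.
by move=> bF bG; apply: RintegralD;
  [exact: measurable_ball6|exact: bd6_integrable|exact: bd6_integrable].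
Qed.

Lemma int6Z a F : bd6 F -> int6 (a \*o F) = a * int6 F.
Proof.
by move=> bF; apply: RintegralZl; [exact: measurable_ball6|exact: bd6_integrable].
Qed.

Lemma int6_ge0 F : bd6 F -> (forall z, 0 <= F z) -> 0 <= int6 F.
Proof. by move=> _ F0; exact: Rintegral_ge0. Qed.

Lemma int6_rot6 c s F : c ^+ 2 + s ^+ 2 = 1 -> c != -1 -> bd6 F ->
  int6 (F \o rot6 c s) = int6 F.
Proof.
move=> cs1 c1 [mF _]; rewrite /int6.
have E := Rintegral_preserving (rot6_preserving cs1 c1) measurable_ball6
  (measurable_funTS mF).
by rewrite [RHS]E rot6_ball6.
Qed.

Definition rho6 (n : nat) : R6 -> R6 := rot6 (cos (half_angle n)) (sin (half_angle n)).

Let cos2Dsin2' n : cos (@half_angle R n) ^+ 2 + sin (half_angle n) ^+ 2 = 1.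
Proof. exact: cos2Dsin2. Qed.

Let cos_neq n : cos (@half_angle R n) != -1.
Proof.
by apply/eqP => h; have := @cos_half_angle_ge0 R n; rewrite h oppr_ge0 ler10.
Qed.

Lemma bd6_rho6 n F : bd6 F -> bd6 (F \o rho6 n).
Proof. exact: (bd6_rot6 (cos2Dsin2' n)). Qed.

Lemma int6_rho6 n F : bd6 F -> int6 (F \o rho6 n) = int6 F.
Proof. exact: (int6_rot6 (cos2Dsin2' n) (cos_neq n)). Qed.

Lemma rot6_comp c s c' s' z : rot6 c s (rot6 c' s' z) =
  rot6 (c * c' - s * s') (c * s' + s * c') z.
Proof.
by rewrite /rot6 /comb3/=; congr (_, _, _, (_, _, _)); ring.
Qed.

Lemma rho6S n z : rho6 n.+1 (rho6 n.+1 z) = rho6 n z.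
Proof.
rewrite /rho6 rot6_comp; congr (rot6 _ _ z).
  by rewrite [RHS]cos_half_angleS; have := cos2Dsin2' n.+1; rewrite !expr2; lra.
have -> : half_angle n = half_angle n.+1 + half_angle n.+1 :> R.
  by rewrite /half_angle [in RHS]exprS; field; rewrite expf_neq0.
by rewrite sinD; ring.
Qed.

Lemma vec3_rho6 n z :
  vec3 (rho6 n z).1 = cos (half_angle n) *: vec3 z.1 + sin (half_angle n) *: vec3 z.2.
Proof. exact: vec3_comb3. Qed.

Lemma vec3_rho60 z : vec3 (rho6 0 (rho6 0 z)).1 = - vec3 z.1.
Proof.
rewrite /rho6 half_angle0 cos_pihalf sin_pihalf rot6_comp vec3_comb3.
by rewrite !(mul0r, mulr1, mulr0, addr0, sub0r) scaleN1r scale0r addr0.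
Qed.

End rotation6.

(** * Constant width bodies as sublinear functions *)

Section sublinear.
Context {R : realType} {V : lmodType R}.
Implicit Types (p q : V -> R) (u v w : V).

Definition sublinear p :=
  (forall u v, p (u + v) <= p u + p v) /\
  (forall (a : R) u, 0 <= a -> p (a *: u) = a * p u).

Lemma sublinear0 p : sublinear p -> p 0 = 0.
Proof. by move=> [_ pZ]; rewrite -(scale0r (0 : V)) pZ// mul0r. Qed.

Lemma sublinearN p u : sublinear p -> - p (- u) <= p u.
Proof.
by move=> sp; have := sp.1 u (- u); rewrite subrr sublinear0//; lra.
Qed.

(** [q w] is squeezed between [- q (- w)] and [p w]. Hence a direction in which [p] has been made
    linear remains so for every smaller sublinear function. *)
Lemma sublinear_sym_le p q w : sublinear q -> (forall u, q u <= p u) ->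
  p (- w) = - p w -> q w = p w /\ q (- w) = - p w.
Proof.
move=> sq qp pw; have := qp w; have := qp (- w); have := sublinearN w sq.
by rewrite pw; split; lra.
Qed.

(** One step of Hahn-Banach: [q u] is the infimum of [p (u + t v) - t * p v] over [t >= 0], a
    sublinear function below [p] that is linear along [v]. *)
Lemma sublinear_linearize p v : sublinear p ->
  exists q, [/\ sublinear q, forall u, q u <= p u, q v = p v & q (- v) = - q v].
Proof.
move=> sp; have [pD pZ] := sp.
pose S u := [set p (u + t *: v) - t * p v | t in [set t : R | 0 <= t]].
have lbS u : lbound (S u) (- p (- u)).
  move=> _ [t /= t0 <-]; rewrite -(pZ _ _ t0) lerBrDr.
  by have := pD (- u) (u + t *: v); rewrite addKr; lra.
have Sn u : S u !=set0 by exists (p (u + 0 *: v) - 0 * p v), 0 => /=.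
have infS u : has_inf (S u) by split; [exact: Sn|exists (- p (- u))].
pose q u := inf (S u).
have qle u (t : R) : 0 <= t -> q u <= p (u + t *: v) - t * p v.
  by move=> t0; apply: ge_inf; [exact: (infS u).2|exists t].
have qge u (b : R) : (forall t, 0 <= t -> b <= p (u + t *: v) - t * p v) -> b <= q u.
  by move=> h; apply: lb_le_inf => // _ [t /= t0 <-]; exact: h.
have qp u : q u <= p u.
  by have := qle u 0 (lexx _); rewrite scale0r addr0 mul0r subr0.
have q0 : q 0 = 0.
  apply/eqP; rewrite eq_le; apply/andP; split.
    by rewrite -(sublinear0 sp); exact: qp.
  by apply: (qge) => t t0; rewrite add0r pZ// subrr.
have qZle (a : R) u : 0 < a -> q (a *: u) <= a * q u.
  move=> a0; rewrite mulrC -ler_pdivrMr//; apply: (qge) => t t0.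
  rewrite ler_pdivrMr//; have := qle (a *: u) (a * t) (mulr_ge0 (ltW a0) t0).
  by rewrite -scalerA -scalerDr (pZ _ _ (ltW a0)); lra.
have sq : sublinear q.
  split=> [u w|a u].
    rewrite -lerBlDr; apply: (qge) => t t0; rewrite lerBlDr -lerBlDl.
    apply: (qge) => s s0; rewrite lerBlDl.
    have := qle (u + w) (t + s) (addr_ge0 t0 s0).
    have := pD (u + t *: v) (w + s *: v).
    have -> : u + t *: v + (w + s *: v) = u + w + (t + s) *: v.
      by rewrite addrACA scalerDl.
    by rewrite mulrDl; lra.
  rewrite le_eqVlt => /predU1P[<-|a0]; first by rewrite scale0r mul0r.
  apply/eqP; rewrite eq_le qZle//=.
  have aV0 : 0 < a^-1 by rewrite invr_gt0.
  have := qZle _ (a *: u) aV0; rewrite scalerA mulVf ?gt_eqF// scale1r.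
  by rewrite mulrC ler_pdivlMr// mulrC.
have qv : q v = p v.
  apply/eqP; rewrite eq_le qp/=; apply: (qge) => t t0.
  have -> : v + t *: v = (1 + t) *: v by rewrite scalerDl scale1r.
  by rewrite pZ ?addr_ge0//; lra.
exists q; split=> //; have := sublinearN v sq; have := qle (- v) 1 ler01.
rewrite scale1r addNr (sublinear0 sp) mul1r sub0r qv => h1 h2.
by apply/eqP; rewrite eq_le; apply/andP; split; lra.
Qed.

End sublinear.

Section supporting.
Context {R : realType}.
Local Notation V := 'rV[R]_3.
Implicit Types (p h : V -> R) (u x y k : V).

Definition e3 (i : 'I_3) : V := delta_mx 0 i.

Lemma rV3_sum x : x = x 0 0 *: e3 0 + x 0 1 *: e3 1 + x 0 2%:R *: e3 2%:R.
Proof. by apply: rV3P; rewrite !mxE/= ?(mulr0, mulr1, addr0, add0r). Qed.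

Lemma dotp_e3 x i : dotp x (e3 i) = x 0 i.
Proof.
rewrite dotpE (bigD1 i)//= big1 => [|j ji]; first by rewrite mxE !eqxx mulr1 addr0.
by rewrite mxE (negbTE ji) andbF mulr0.
Qed.

Lemma enorm_e3 i : enorm (e3 i) = 1.
Proof. by rewrite /enorm dotp_e3 mxE !eqxx sqrtr1. Qed.

Lemma sublinear_linear p : sublinear p -> (forall i, p (- e3 i) = - p (e3 i)) ->
  forall x, p x = dotp (\row_i p (e3 i)) x.
Proof.
move=> sp pN.
have lin (a : R) i : p (a *: e3 i) = a * p (e3 i).
  have [a0|a0] := leP 0 a; first by rewrite sp.2.
  have Na0 : 0 <= - a by rewrite oppr_ge0 ltW.
  by have := sp.2 _ (- e3 i) Na0; rewrite scalerN scaleNr opprK pN mulrNN.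
have le x : p x <= dotp (\row_i p (e3 i)) x.
  rewrite dotp3E !mxE [in leLHS](rV3_sum x).
  have := sp.1 (x 0 0 *: e3 0 + x 0 1 *: e3 1) (x 0 2%:R *: e3 2%:R).
  by have := sp.1 (x 0 0 *: e3 0) (x 0 1 *: e3 1); rewrite !lin; lra.
move=> x; apply/eqP; rewrite eq_le le/=.
by have := le (- x); have := sublinearN x sp; rewrite dotpNr; lra.
Qed.

(** Linearising along [u] and then along the three axes leaves a sublinear function that is
    antisymmetric on the axes, hence linear, and still equal to [p] at [u]. This is the supporting
    plane in direction [u]. *)
Lemma sublinear_dotp_exists p u : sublinear p ->
  exists k, (forall x, dotp k x <= p x) /\ dotp k u = p u.
Proof.
move=> sp.
have [p1 [sp1 p1p p1u p1Nu]] := sublinear_linearize u sp.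
have [p2 [sp2 p2p p2e p2N]] := sublinear_linearize (e3 0) sp1.
have [p3 [sp3 p3p p3e p3N]] := sublinear_linearize (e3 1) sp2.
have [p4 [sp4 p4p p4e p4N]] := sublinear_linearize (e3 2%:R) sp3.
have [p3e0 p3N0] := sublinear_sym_le sp3 p3p p2N.
have p42 x : p4 x <= p2 x := le_trans (p4p x) (p3p x).
have p41 x : p4 x <= p1 x := le_trans (p42 x) (p2p x).
have [p4e0 p4N0] := sublinear_sym_le sp4 p42 p2N.
have [p4e1 p4N1] := sublinear_sym_le sp4 p4p p3N.
have [p4u p4Nu] := sublinear_sym_le sp4 p41 p1Nu.
have p4N' i : p4 (- e3 i) = - p4 (e3 i).
  case: i => -[|[|[|//]]] i3.
  - by rewrite (_ : Ordinal _ = 0) ?p4N0 ?p4e0//; exact/val_inj.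
  - by rewrite (_ : Ordinal _ = 1) ?p4N1 ?p4e1//; exact/val_inj.
  - by rewrite (_ : Ordinal _ = 2%:R)//; exact/val_inj.
pose k : V := \row_i p4 (e3 i).
have kE x : dotp k x = p4 x by rewrite (sublinear_linear sp4 p4N').
exists k; split=> [x|]; last by rewrite kE p4u.
by rewrite kE (le_trans (p41 x)).
Qed.

Definition width_fun h := sublinear h /\ forall x, h x + h (- x) = enorm x.

Lemma sublinear_bound p : sublinear p -> exists2 M, 0 < M & forall x, p x <= M * enorm x.
Proof.
move=> sp; pose m i := `|p (e3 i)| + `|p (- e3 i)|.
have m0 i : 0 <= m i by rewrite addr_ge0.
have hi (a : R) i : p (a *: e3 i) <= `|a| * m i.
  have [a0|a0] := leP 0 a.
    by rewrite sp.2// ger0_norm// ler_wpM2l// (le_trans (ler_norm _))// lerDl.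
  have Na0 : 0 <= - a by rewrite oppr_ge0 ltW.
  rewrite -[a *: _]opprK -scaleNr -scalerN sp.2// ltr0_norm// ler_wpM2l//.
  by rewrite (le_trans (ler_norm _))// lerDr.
exists (m 0 + m 1 + m 2%:R + 1) => [|x]; first by rewrite ltr_wpDl// !addr_ge0.
rewrite [in leLHS](rV3_sum x).
have := sp.1 (x 0 0 *: e3 0 + x 0 1 *: e3 1) (x 0 2%:R *: e3 2%:R).
have := sp.1 (x 0 0 *: e3 0) (x 0 1 *: e3 1).
have := hi (x 0 0) 0; have := hi (x 0 1) 1; have := hi (x 0 2%:R) 2%:R.
have xm i : `|x 0 i| * m i <= enorm x * m i.
  by rewrite ler_wpM2r// norm_coord_le_enorm.
have := xm 0; have := xm 1; have := xm 2%:R; have := enorm_ge0 x.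
by move: (p _) (p _) (p _) (p _) (p _) => *; nra.
Qed.

Lemma sublinear_continuous p : sublinear p -> continuous p.
Proof.
move=> sp; have [M _ pM] := sublinear_bound sp.
apply: (@enorm_lipschitz_continuous _ _ M) => x y; apply: le_trans (pM _).
by have := sp.1 (x - y) y; rewrite subrK; lra.
Qed.

Lemma compact_dotp_bounded (K : set V) : compact K ->
  exists2 M, 0 <= M & forall x, K x -> enorm x <= M.
Proof.
move=> /compact_bounded[M [_ KM]]; exists (3 * (`|M| + 1)).
  by rewrite mulr_ge0// addr_ge0.
move=> x Kx; apply: (le_trans (enorm_le_norm _)); rewrite ler_wpM2l//.
by apply: KM => //; rewrite ltr_pwDr// ler_norm.
Qed.

Lemma support_fun_width (K : set V) : constant_width_body K ->
  width_fun (support_fun K).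
Proof.
move=> [K0 Kc _ Kw]; have [M M0 KM] := compact_dotp_bounded Kc.
have hs u : has_sup [set dotp x u | x in K].
  split; first by have [x Kx] := K0; exists (dotp x u), x.
  exists (M * enorm u) => _ [x Kx <-]; apply: (le_trans (dotp_le_enorm _ _)).
  by rewrite ler_wpM2r ?enorm_ge0 ?KM.
have ub u x : K x -> dotp x u <= support_fun K u.
  by move=> Kx; apply: ub_le_sup; [exact: (hs u).2|exists x].
have lb u (b : R) : (forall x, K x -> dotp x u <= b) -> support_fun K u <= b.
  by move=> h; apply: ge_sup; [exact: (hs u).1|move=> _ [x Kx <-]; exact: h].
split=> //; split=> [u v|a u a0].
  by apply: lb => x Kx; rewrite dotpDr lerD ?ub.
have le (b : R) v : 0 <= b -> support_fun K (b *: v) <= b * support_fun K v.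
  by move=> b0; apply: lb => x Kx; rewrite dotpZr ler_wpM2l ?ub.
apply/eqP; rewrite eq_le le//=.
have [->|an0] := eqVneq a 0.
  have [x Kx] := K0; rewrite mul0r scale0r.
  by rewrite -(dotp0r x) ub.
have ap : 0 < a by rewrite lt_def an0.
have := le a^-1 (a *: u); rewrite scalerA mulVf// scale1r => /(_ _).
by rewrite invr_ge0 => /(_ a0); rewrite mulrC ler_pdivlMr// mulrC.
Qed.

(** The body is the set of vectors whose linear form stays below [h]. Supporting planes show that
    its support function reaches [h] in every direction. *)
Lemma width_fun_body h : width_fun h ->
  exists2 K, constant_width_body K & forall u, support_fun K u = h u.
Proof.
move=> [sh hw]; have [M M0 hM] := sublinear_bound sh.
pose K : set V := [set k | forall u, dotp k u <= h u].
have KE u : support_fun K u = h u.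
  have [k [kh ku]] := sublinear_dotp_exists u sh.
  apply/eqP; rewrite eq_le; apply/andP; split.
    by apply: ge_sup; [exists (dotp k u), k|move=> _ [x Kx <-]; exact: Kx].
  apply: ub_le_sup; last by exists k.
  by exists (h u) => _ [x Kx <-]; exact: Kx.
exists K => //; split.
- by have [k [kh _]] := sublinear_dotp_exists 0 sh; exists k.
- apply: bounded_closed_compact.
    exists M; split; first exact: num_real.
    move=> N MN k /= Kk; apply: (le_trans _ (ltW MN)).
    rewrite [leLHS]mx_normrE; apply/bigmax_leP; split; first exact: ltW.
    move=> -[i j] _ /=; rewrite ord1; apply: (le_trans (norm_coord_le_enorm _ _)).
    have [->|k0] := eqVneq k 0; first by rewrite enorm0 ltW.
    rewrite -(@ler_pM2r _ (enorm k)) ?enorm_gt0// -expr2 sqr_enorm.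
    exact: le_trans (Kk k) (hM k).
  have -> : K = \bigcap_(u in setT) ((fun k => dotp u k) @^-1` [set r | r <= h u]).
    by apply/seteqP; split=> [k Kk u _ /=|k Kk u]; rewrite dotpC; [exact: Kk|exact: Kk].
  apply: closed_bigI => u _; apply: preimage_closed; last exact: closed_le.
  by move=> x _; exact: dotp_continuous.
- move=> x y t; rewrite !inE => Kx Ky u.
  have -> : (conv t x y : convex_lmodType V) = (t%:num *: x + (1 - t%:num) *: y : V) by [].
  rewrite dotpDl !dotpZl.
  have -> : h u = t%:num * h u + (1 - t%:num) * h u by ring.
  by rewrite lerD// ler_wpM2l// ?subr_ge0.
- by move=> u; rewrite !KE.
Qed.

(** The support function that [g] would come from: the 1-homogeneous extension of [g + 1/2]. *)
Definition hext (g : S2 R -> R) x := enorm x * (g (sdir x) + 2^-1).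

Lemma val_sdir_neq0 x : x != 0 -> \val (sdir x) = (enorm x)^-1 *: x.
Proof. by move=> x0; rewrite val_sdir enorm_eq0 (negbTE x0). Qed.

Lemma enormZ_sdir x : enorm x *: \val (sdir x) = x.
Proof.
have [->|x0] := eqVneq x 0; first by rewrite enorm0 scale0r.
by rewrite val_sdir_neq0// scalerA mulfV ?scale1r// enorm_eq0.
Qed.

Lemma sdir_val (u : S2 R) : sdir (\val u) = u.
Proof.
apply: val_inj; rewrite val_sdir_neq0 ?enorm_S2 ?invr1 ?scale1r//.
by rewrite -enorm_eq0 enorm_S2 oner_eq0.
Qed.

Lemma sdirZ (a : R) x : 0 < a -> sdir (a *: x) = sdir x.
Proof.
move=> a0; have [->|x0] := eqVneq x 0; first by rewrite scaler0.
apply: val_inj; rewrite !val_sdir_neq0//; last by rewrite scaler_eq0 negb_or gt_eqF.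
rewrite enormZ gtr0_norm// scalerA; congr (_ *: _).
by field; rewrite enorm_eq0 x0 gt_eqF.
Qed.

Lemma hext_val g (u : S2 R) : hext g (\val u) = g u + 2^-1.
Proof. by rewrite /hext enorm_S2 mul1r sdir_val. Qed.

Lemma sublinear_hextE h g : sublinear h ->
  (forall u : S2 R, g u + 2^-1 = h (\val u)) -> h = hext g.
Proof.
move=> sh gh; apply/funext => x.
by rewrite -[in LHS](enormZ_sdir x) sh.2 ?enorm_ge0// -gh.
Qed.

(** Trades the existence of a body for inequalities on [g] itself, which are visibly stable under
    translations, convex combinations and pointwise limits. *)
Lemma calCP g : calC g <-> C_S2 g /\ width_fun (hext g).
Proof.
split=> [[cg [K cK gK]]|[cg wg]].
  split=> //; have wK := support_fun_width cK.
  by rewrite -(sublinear_hextE wK.1 gK).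
split=> //; have [K cK KE] := width_fun_body wg.
by exists K => // u; rewrite KE hext_val.
Qed.

End supporting.

(** * Stability and compactness properties of [calC] *)

Section calC_theory.
Context {R : realType}.
Local Notation V := 'rV[R]_3.
Implicit Types (g : S2 R -> R) (u : S2 R) (x y a : V).

(** The extension of [g] without the constant 1/2: subtracting half the norm from the support
    function makes it odd, as the rotation forms require. *)
Definition fext g x := enorm x * g (sdir x).

Lemma fextE g x : fext g x = hext g x - 2^-1 * enorm x.
Proof. by rewrite /fext /hext; ring. Qed.

Lemma fext_val g u : fext g (\val u) = g u.
Proof. by rewrite /fext enorm_S2 mul1r sdir_val. Qed.

Lemma fextD g1 g2 x : fext (g1 \+ g2) x = fext g1 x + fext g2 x.
Proof. by rewrite /fext mulrDr. Qed.

Lemma fextZ (t : R) g x : fext (t \*o g) x = t * fext g x.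
Proof. by rewrite /fext mulrCA. Qed.

Lemma fext_linS2 a x : fext (linS2 a) x = dotp a x.
Proof. by rewrite /fext /linS2 -dotpZr enormZ_sdir. Qed.

Lemma fext_scale g (t : R) x : 0 <= t -> fext g (t *: x) = t * fext g x.
Proof.
rewrite le_eqVlt => /predU1P[<-|t0].
  by rewrite scale0r mul0r /fext enorm0 mul0r.
by rewrite /fext enormZ sdirZ// gtr0_norm// mulrA.
Qed.

Lemma fextN g x : calC g -> fext g (- x) = - fext g x.
Proof.
move=> /calCP[_ [_ gw]]; rewrite !fextE enormN.
by have := gw x; lra.
Qed.

Lemma norm_fext_le g (M : R) x : (forall u, `|g u| <= M) -> `|fext g x| <= M * enorm x.
Proof.
by move=> gM; rewrite normrM ger0_norm ?enorm_ge0// mulrC ler_wpM2r ?enorm_ge0.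
Qed.

Lemma calC_C_S2 g : calC g -> C_S2 g.
Proof. by case. Qed.

Lemma calC_linS2 g a : calC g -> calC (g \+ linS2 a).
Proof.
move=> /calCP[cg [[hD hZ] hw]]; apply/calCP; split.
  by apply: C_S2D => //; exact: C_S2_linS2.
have E x : hext (g \+ linS2 a) x = hext g x + dotp a x.
  by rewrite /hext -(fext_linS2 a x) /fext/=; ring.
split; first split=> [x y|t x t0].
- by rewrite !E dotpDr; have := hD x y; lra.
- by rewrite !E hZ// dotpZr; ring.
- by move=> x; rewrite !E dotpNr -(hw x); ring.
Qed.

(** Oddness of [fext g] makes the extension of [- g + 1/2] equal to [hext g (- x)]: the body is
    reflected through the origin. *)
Lemma calC_opp g : calC g -> calC (fun u => - g u).
Proof.
move=> cg; have /calCP[ccg [[hD hZ] hw]] := cg; apply/calCP; split.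
  exact: C_S2N.
have E x : hext (fun u => - g u) x = hext g (- x).
  by have := fextN x cg; rewrite fextE /fext /hext enormN; lra.
split; first split=> [x y|t x t0].
- by rewrite !E opprD.
- by rewrite !E -scalerN hZ.
- by move=> x; rewrite !E opprK addrC hw.
Qed.

Lemma calC_conv g1 g2 (s : R) : 0 <= s <= 1 -> calC g1 -> calC g2 ->
  calC (s \*o g1 \+ (1 - s) \*o g2).
Proof.
move=> /andP[s0 s1] /calCP[c1 [[hD1 hZ1] hw1]] /calCP[c2 [[hD2 hZ2] hw2]].
have s1' : 0 <= 1 - s by rewrite subr_ge0.
apply/calCP; split; first by apply: C_S2D; exact: C_S2Z.
have E x : hext (s \*o g1 \+ (1 - s) \*o g2) x = s * hext g1 x + (1 - s) * hext g2 x.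
  by rewrite /hext/=; ring.
split; first split=> [x y|t x t0].
- have h1 := ler_wpM2l s0 (hD1 x y); have h2 := ler_wpM2l s1' (hD2 x y).
  by rewrite !E; lra.
- by rewrite !E hZ1// hZ2//; ring.
- by move=> x; rewrite !E -[RHS](_ : s * enorm x + (1 - s) * enorm x = _);
    [rewrite -{1}(hw1 x) -(hw2 x); ring|ring].
Qed.

(** The ball of radius 1/2. *)
Lemma calC0 : calC (fun=> 0 : R).
Proof.
apply/calCP; split; first exact: C_S2_cst.
have E x : hext (fun=> 0) x = 2^-1 * enorm x by rewrite /hext; ring.
split; first split=> [x y|t x t0].
- by rewrite !E; have := ler_enormD x y; lra.
- by rewrite !E enormZ ger0_norm//; ring.
- by move=> x; rewrite !E enormN; field.
Qed.

(* Translating a constant width body so that it contains the origin makes its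
   support function nonnegative, hence bounded by [enorm]. *)
Lemma calC_translate g : calC g -> exists a,
  (forall u, `|g u + linS2 a u| <= 2^-1) /\
  forall x y, `|fext (g \+ linS2 a) x - fext (g \+ linS2 a) y| <= 2 * enorm (x - y).
Proof.
move=> cg; have /calCP[_ [sh _]] := cg.
have [k [kh _]] := sublinear_dotp_exists 0 sh.
exists (- k); set g' := g \+ linS2 (- k).
have /calCP[_ [[hD hZ] hw]] : calC g' by exact: calC_linS2.
have E x : hext g' x = hext g x - dotp k x.
  by rewrite /g' /hext -dotpNl -(fext_linS2 (- k) x) /fext/=; ring.
have h0 x : 0 <= hext g' x by rewrite E subr_ge0.
have h1 x : hext g' x <= enorm x by have := hw x; have := h0 (- x); lra.
split=> [u|x y].
  have := h0 (\val u); have := h1 (\val u); rewrite hext_val enorm_S2 /g'/= => a1 a2.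
  by rewrite ler_norml; apply/andP; split; lra.
have lip v w : hext g' v - hext g' w <= enorm (v - w).
  by have := hD (v - w) w; have := h1 (v - w); rewrite subrK; lra.
have := ler_dist_enorm x y; rewrite !fextE !ler_norml => /andP[e1 e2].
have := lip x y; have := lip y x; rewrite (enormB y x) => l1 l2.
by have := enorm_ge0 (x - y) => e0; apply/andP; split; lra.
Qed.

Lemma calC_lipschitz g : calC g -> exists2 L, 0 < L &
  forall x y, `|fext g x - fext g y| <= L * enorm (x - y).
Proof.
move=> cg; have [a [_ gl]] := calC_translate cg.
exists (2 + enorm a) => [|x y]; first by rewrite ltr_pwDl// enorm_ge0.
have := gl x y; rewrite !fextD !fext_linS2 => gxy.
have := norm_dotp_le a (x - y); rewrite dotpDr dotpNr => axy.
have -> : fext g x - fext g y = (fext g x + dotp a x - (fext g y + dotp a y)) - (dotp a x - dotp a y).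
  by ring.
by rewrite (le_trans (ler_normB _ _))// mulrDl lerD.
Qed.

Lemma calC_fext_continuous g : calC g -> continuous (fext g).
Proof.
move=> /calC_lipschitz[L _ gL]; apply: (@enorm_lipschitz_continuous _ _ L) => x y.
exact: le_trans (ler_norm _) (gL x y).
Qed.

Lemma calC_closed (gn : nat -> S2 R -> R) g : (forall n, calC (gn n)) -> C_S2 g ->
  (forall u, gn n u @[n --> \oo] --> g u) -> calC g.
Proof.
move=> cn cg cv; apply/calCP; split=> //.
have lim x : hext (gn n) x @[n --> \oo] --> hext g x.
  by apply: cvgM; [exact: cvg_cst|apply: cvgD; [exact: cv|exact: cvg_cst]].
have cl (f1 f2 : nat -> R) (l1 l2 : R) : f1 @ \oo --> l1 -> f2 @ \oo --> l2 ->
    (forall n, f1 n <= f2 n) -> l1 <= l2.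
  move=> c1 c2 f12; rewrite -(cvg_lim (@Rhausdorff R) c1) -(cvg_lim (@Rhausdorff R) c2).
  apply: ler_lim; [by apply/cvg_ex; exists l1|by apply/cvg_ex; exists l2|].
  by near=> n; exact: f12.
have hn n : width_fun (hext (gn n)) by have /calCP[] := cn n.
have eql (f1 f2 : nat -> R) (l1 l2 : R) : f1 @ \oo --> l1 -> f2 @ \oo --> l2 ->
    (forall n, f1 n = f2 n) -> l1 = l2.
  by move=> c1 c2 e; apply/eqP; rewrite eq_le (cl f1 f2)//= ?(cl f2 f1)// => n; rewrite e.
split; first split=> [x y|t x t0].
- apply: (cl _ _ _ _ (lim _) (cvgD (lim x) (lim y))) => n; exact: (hn n).1.1.
- apply: (eql _ _ _ _ (lim _) (cvgM (cvg_cst t) (lim x))) => n; exact: (hn n).1.2.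
- move=> x; apply: (eql _ _ _ _ (cvgD (lim x) (lim (- x))) (cvg_cst _)) => n.
  exact: (hn n).2.
Unshelve. all: by end_near. Qed.

End calC_theory.

(** * Polar coordinates *)

Section polar_product.
Context d1 d2 d3 (X : measurableType d1) (S : measurableType d2)
  (Y : measurableType d3) (R : realType).
Variables (nu : {finite_measure set X -> \bar R}) (sg : {finite_measure set S -> \bar R}).
Variable m2 : {measure set Y -> \bar R}.
Variables (theta : X -> S) (r : X -> R).
Hypothesis mtheta : measurable_fun setT theta.
Hypothesis mr : measurable_fun setT (r : X -> measurableTypeR R).
Variable s : {nonneg R}.
Hypothesis polar_rays : forall A (t : R), measurable A ->
  (s%:num%:E * nu [set x | A (theta x) /\ (t < r x)%R] =
   sg A * nu [set x | (t < r x)%R])%E.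
Local Open Scope ereal_scope.
Local Notation mR := (measurableTypeR R).

Let nu_fin : nu setT < +oo.
Proof. by rewrite -ge0_fin_numE//; exact: fin_num_measure. Qed.

Let mtr : measurable_fun setT (fun x => (theta x, r x) : S * mR).
Proof. exact/measurable_fun_pair. Qed.

Definition radial_law : set mR -> \bar R := push_measure nu mr.
HB.instance Definition _ := Measure.on radial_law.

Let radial_law_fin : fin_num_fun radial_law.
Proof. by apply: lty_fin_num_fun; rewrite /radial_law push_measureE preimage_setT. Qed.
HB.instance Definition _ := Measure_isFinite.Build _ _ _ radial_law radial_law_fin.

Let mpre (A : set S) (C : set mR) : measurable A -> measurable C ->
  measurable [set x | A (theta x) /\ C (r x)].
Proof.
move=> mA mC; rewrite (_ : mkset _ = (theta @^-1` A) `&` (r @^-1` C))//.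
by apply: measurableI; rewrite -[X in measurable X]setTI; [exact: mtheta|exact: mr].
Qed.

(** For fixed [A] both sides are finite measures in [C]. They agree on the half-lines []t, +oo[],
    which are stable under intersection and generate the Borel sets. *)
Lemma polar_rectangles (A : set S) (C : set mR) : measurable A -> measurable C ->
  s%:num%:E * nu [set x | A (theta x) /\ C (r x)] = sg A * radial_law C.
Proof.
move=> mA mC.
have mtA : measurable (theta @^-1` A) by rewrite -[X in measurable X]setTI; exact: mtheta.
have nuA B : measurable B -> nu B < +oo.
  by move=> mB; apply: le_lt_trans nu_fin; apply: le_measure; rewrite ?inE.
pose c : {nonneg R} := NngNum (fine_ge0 (measure_ge0 sg A)).
have cE : c%:num%:E = sg A by rewrite /= fineK// fin_num_measure.
pose m1 : {measure set mR -> \bar R} :=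
  mscale s (push_measure (mrestr nu mtA) mr).
pose m2' : {measure set mR -> \bar R} := mscale c radial_law.
have m1E B : m1 B = s%:num%:E * nu [set x | A (theta x) /\ B (r x)].
  rewrite /m1 /= /mscale/=; congr (_ * nu _).
  by rewrite setIC.
suff : m1 C = m2' C by rewrite m1E => ->; rewrite -cE.
apply: (@measure_unique _ R mR (@RGenOInfty.G R) (fun n => `](- n%:R)%R, +oo[%classic : set mR)) => //.
- exact: RGenOInfty.measurableE.
- move=> _ _ [a ->] [b ->]; exists (Num.max a b).
  by apply/seteqP; split=> x /=; rewrite !in_itv/= !andbT gt_max => // /andP.
- by move=> n; exists (- n%:R)%R.
- apply/seteqP; split=> // x _; exists (Num.bound `|x|%R) => //=.
  rewrite in_itv/= andbT ltrNl; apply: le_lt_trans (ler_norm _) _.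
  by rewrite normrN archi_boundP.
- move=> _ [t ->]; rewrite m1E.
  have -> : [set x | A (theta x) /\ `]t, +oo[%classic (r x)] = [set x | A (theta x) /\ (t < r x)%R].
    by apply/seteqP; split=> x /=; rewrite in_itv/= andbT.
  rewrite polar_rays// -cE; congr (_ * nu _).
  by apply/seteqP; split=> x /=; rewrite /= in_itv/= andbT.
- move=> n; rewrite m1E lte_mul_pinfty// nuA//.
  by apply: mpre => //; exact: measurable_itv.
Qed.

Variables (G : S -> \bar R) (psi : mR * Y -> \bar R).
Hypothesis mG : measurable_fun setT G.
Hypothesis G0 : forall u, 0 <= G u.
Hypothesis mpsi : measurable_fun setT psi.
Hypothesis psi0 : forall z, 0 <= psi z.

Let slice_ge0 y : 0 <= \int[nu]_x psi (r x, y).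
Proof. exact: integral_ge0. Qed.

(** Rectangles determine the joint law of direction and radius: up to the factor [s] it is the
    product of [sg] and [radial_law], and Fubini separates the two factors. The parameter [y] is
    carried along because the radial range inside a ball of [R^6] depends on the other variable. *)
Lemma polar_integral y :
  s%:num%:E * \int[nu]_x (G (theta x) * psi (r x, y)) =
  \int[sg]_u G u * \int[nu]_x psi (r x, y).
Proof.
pose P : {measure set (S * mR) -> \bar R} := mscale s (push_measure nu mtr).
pose F (z : S * mR) := G z.1 * psi (z.2, y).
have mpsiy : measurable_fun setT (fun b : mR => psi (b, y)).
  exact: measurableT_comp mpsi (measurable_pair2 _).
have mF : measurable_fun setT F.
  apply: emeasurable_funM; first exact: measurableT_comp mG measurable_fst.
  exact: measurableT_comp mpsiy measurable_snd.
have F0 z : 0 <= F z by exact: mule_ge0.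
have mFt : measurable_fun setT (fun x => F (theta x, r x)) := measurableT_comp mF mtr.
have PE : \int[P]_z F z = s%:num%:E * \int[nu]_x F (theta x, r x).
  rewrite (ge0_integral_mscale _ measurableT s mF (fun z _ => F0 z)).
  by rewrite (ge0_integral_pushforward mtr nu measurableT mF (fun z _ => F0 z)).
have PsE : \int[P]_z F z = \int[sg \x radial_law]_z F z.
  apply: eq_measure_integral => A mA _; apply/esym.
  have := @product_measure_unique _ _ _ _ _ sg radial_law P; apply => // B C mB mC.
  by rewrite -[RHS]polar_rectangles.
have bE : \int[radial_law]_b psi (b, y) = \int[nu]_x psi (r x, y).
  exact: (ge0_integral_pushforward mr nu measurableT mpsiy (fun z _ => psi0 _)).
rewrite -PE PsE (fubini_tonelli1 F mF F0) /fubini_F.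
transitivity (\int[sg]_u (G u * \int[nu]_x psi (r x, y))).
  apply: eq_integral => u _; rewrite -bE /F/=.
  by rewrite ge0_integralZl.
by rewrite ge0_integralZr.
Qed.

Lemma polar_integral2 :
  s%:num%:E * \int[m2]_y \int[nu]_x (G (theta x) * psi (r x, y)) =
  \int[sg]_u G u * \int[m2]_y \int[nu]_x psi (r x, y).
Proof.
have mGpsi : measurable_fun setT (fun z : X * Y => G (theta z.1) * psi (r z.1, z.2)).
  apply: emeasurable_funM.
    by apply: measurableT_comp mG _; exact: measurableT_comp mtheta measurable_fst.
  apply: measurableT_comp mpsi _; apply/measurable_fun_pair => //=.
  exact: measurableT_comp mr measurable_fst.
have mpsi' : measurable_fun setT (fun z : X * Y => psi (r z.1, z.2)).
  apply: measurableT_comp mpsi _; apply/measurable_fun_pair => //=.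
  exact: measurableT_comp mr measurable_fst.
have mL : measurable_fun setT (fun y => \int[nu]_x (G (theta x) * psi (r x, y))).
  apply: (measurable_fun_fubini_tonelli_G (m1 := nu) _ mGpsi) => z.
  exact: mule_ge0.
have mR' : measurable_fun setT (fun y => \int[nu]_x psi (r x, y)).
  exact: (measurable_fun_fubini_tonelli_G (m1 := nu) _ mpsi').
have L0 y : 0 <= \int[nu]_x (G (theta x) * psi (r x, y)).
  by apply: integral_ge0 => x _; exact: mule_ge0.
rewrite -(ge0_integralZl m2 measurableT mL (fun y _ => L0 y))//.
rewrite -(ge0_integralZl m2 measurableT mR' (fun y _ => slice_ge0 y)); last first.
  exact: integral_ge0.
by apply: eq_integral => y _; exact: polar_integral.
Qed.

End polar_product.

Section polar_sphere.
Context {R : realType}.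
Local Notation leb3 := (@lebesgue3 R).
Local Notation mR := (measurableTypeR R).
Local Notation R6 := (R3 R * R3 R)%type.
Implicit Types (A : set (S2 R)) (p : R3 R) (t : R).

Definition pball : set (R3 R) := [set p | 0 < enorm (vec3 p) <= 1].

Lemma measurable_enorm_vec3 : measurable_fun setT (fun p : R3 R => enorm (vec3 p) : mR).
Proof. exact: measurable_vec3_comp (@enorm_continuous R). Qed.

Definition cone t A : set (R3 R) := [set p | (0 < enorm (vec3 p) <= t) /\ A (sdir (vec3 p))].

Lemma measurable_cone t A : measurable A -> measurable (cone t A).
Proof.
move=> mA.
have -> : cone t A = ((fun p => enorm (vec3 p) : mR) @^-1` `]0, t]) `&` ((@sdir R \o @vec3 R) @^-1` A).
  by apply/seteqP; split=> p /=; rewrite in_itv/=.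
apply: measurableI; rewrite -[X in measurable X]setTI.
  by apply: measurable_enorm_vec3 => //; exact: measurable_itv.
exact: measurable_sdir.
Qed.

Lemma vec3_scale t p : vec3 (t * p.1.1 + 0, t * p.1.2 + 0, t * p.2 + 0) = t *: vec3 p.
Proof. by apply: rV3P; rewrite !mxE/= addr0. Qed.

Lemma cone_scale t A : measurable A -> 0 < t ->
  leb3 (cone t A) = ((t ^+ 3)%:E * leb3 (cone 1 A))%E.
Proof.
move=> mA t0; have tn0 : t != 0 by rewrite gt_eqF.
have mi s : measurable_fun setT (EFin \o \1_(cone s A) : R3 R -> \bar R).
  by apply/measurable_EFinP; apply: measurable_indic; exact: measurable_cone.
have i0 s p : (0 <= (EFin \o \1_(cone s A) : R3 R -> \bar R) p)%E by rewrite lee_fin.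
have iE s : (\int[leb3]_p (EFin \o \1_(cone s A)) p = leb3 (cone s A))%E.
  by rewrite [LHS]integral_indic ?setIT//; exact: measurable_cone.
rewrite -(iE t) -(iE 1) (ge0_integral_affine3 0 0 0 tn0 tn0 tn0 (mi t) (i0 t)).
have -> : `|t * t * t| = t ^+ 3 by rewrite gtr0_norm ?mulr_gt0// !exprS expr0 mulr1 mulrA.
apply: (congr1 (fun x => (t ^+ 3)%:E * x)%E); apply: eq_integral => p _ /=.
rewrite !indicE; congr ((_ _)%:R%:E); apply/idP/idP; rewrite !inE /cone/= vec3_scale.
  move=> [/andP[p0 pt] Ap]; move: p0 pt; rewrite enormZ gtr0_norm// pmulr_rgt0//.
  by rewrite -ler_pdivlMl// mulVf// => p0 pt; split; [rewrite p0|rewrite -(sdirZ _ t0)].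
move=> [/andP[p0 pt] Ap]; rewrite enormZ gtr0_norm// pmulr_rgt0// p0/=.
by rewrite -ler_pdivlMl// mulVf// pt sdirZ.
Qed.

Lemma cone_fin A : measurable A -> (leb3 (cone 1 A) < +oo)%E.
Proof.
move=> mA; apply: le_lt_trans (@cube3_fin R).
apply: le_measure; rewrite ?inE; [exact: measurable_cone|exact: measurable_cube3|].
by move=> p [/andP[_ p1] _]; exact: enorm_cube3.
Qed.

Lemma sigmaE A : sigma A = (3%:E * leb3 (cone 1 A))%E.
Proof. by []. Qed.

Let sigma_fin_num_fun : fin_num_fun (@sigma R).
Proof.
apply: lty_fin_num_fun; suff : (3%:E * leb3 (cone 1 setT) < +oo)%E by [].
by apply: lte_mul_pinfty => //; exact: cone_fin.
Qed.
HB.instance Definition _ := Measure_isFinite.Build _ _ _ (@sigma R) sigma_fin_num_fun.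

(** A finite measure that ignores the origin, where [sdir] takes an arbitrary value. *)
Definition nu3 : set (R3 R) -> \bar R := mrestr leb3 (@measurable_punctured_ball R).
HB.instance Definition _ := Measure.on nu3.

Let nu3_fin : fin_num_fun nu3.
Proof.
apply: lty_fin_num_fun; suff : (leb3 (setT `&` pball) < +oo)%E by [].
rewrite setTI.
apply: le_lt_trans (@cube3_fin R).
apply: le_measure; rewrite ?inE; [exact: measurable_punctured_ball|exact: measurable_cube3|].
by move=> p /andP[_ p1]; exact: enorm_cube3.
Qed.
HB.instance Definition _ := Measure_isFinite.Build _ _ _ nu3 nu3_fin.

(** The constant [k] is the same for all [A], which makes direction and radius independent. By
    homogeneity of the volume it is [1 - t^3] for [t] between 0 and 1. *)
Lemma nu3_ray t : exists2 k : R, 0 <= k & forall A, measurable A ->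
  nu3 [set p | A (sdir (vec3 p)) /\ t < enorm (vec3 p)] = (k%:E * leb3 (cone 1 A))%E.
Proof.
have [t1|t1] := leP 1 t.
  exists 0 => // A mA; rewrite mul0e -[RHS](measure0 leb3); congr (leb3 _).
  apply/seteqP; split=> // p [[_ tp] /andP[_ p1]].
  by move: (lt_le_trans tp p1); rewrite ltNge t1.
have [t0|t0] := leP t 0.
  exists 1 => // A mA; rewrite mul1e; congr (leb3 _).
  apply/seteqP; split=> [p [[Ap _] p1]|p [/andP[p0 p1] Ap]]; first by [].
  by split => /=; [split => //; exact: le_lt_trans t0 p0|rewrite p0 p1].
exists (1 - t ^+ 3) => [|A mA]; first by rewrite subr_ge0 exprn_ile1// ltW.
have -> : nu3 [set p | A (sdir (vec3 p)) /\ t < enorm (vec3 p)] = leb3 (cone 1 A `\` cone t A).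
  congr (leb3 _); apply/seteqP; split=> [p [[Ap tp] /andP[p0 p1]]|p [[/andP[p0 p1] Ap] np]].
    by split; [split => //; rewrite p0|move=> [/andP[_]]; rewrite leNgt tp].
  split=> /=; last by rewrite p0.
  by split => //; rewrite ltNge; apply/negP => pt; apply: np; split => //; rewrite p0.
have D : (leb3 (cone 1 A `\` cone t A) = leb3 (cone 1 A) - leb3 (cone 1 A `&` cone t A))%E.
  by apply: measureD; [exact: measurable_cone..|exact: cone_fin].
have ct : cone 1 A `&` cone t A = cone t A.
  apply/setIidPr => p [/andP[p0 pt] Ap]; split => //; rewrite p0/=.
  exact: le_trans pt (ltW t1).
have fn : leb3 (cone 1 A) \is a fin_num by rewrite ge0_fin_numE// cone_fin.
rewrite D ct (cone_scale mA t0) -(fineK fn).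
by apply: (congr1 EFin); ring.
Qed.

Definition sphere_area : {nonneg R} := NngNum (fine_ge0 (measure_ge0 (@sigma R) setT)).

Lemma sphere_areaE : (sphere_area%:num)%:E = sigma [set: S2 R].
Proof. by rewrite /= fineK//; exact: fin_num_measure. Qed.

Lemma nu3_polar_rays A t : measurable A ->
  ((sphere_area%:num)%:E * nu3 [set p | A (sdir (vec3 p)) /\ (t < enorm (vec3 p))%R] =
   sigma A * nu3 [set p | (t < enorm (vec3 p))%R])%E.
Proof.
move=> mA; have [k k0 nuE] := nu3_ray t.
have -> : [set p | t < enorm (vec3 p)] =
    [set p : R3 R | [set: S2 R] (sdir (vec3 p)) /\ t < enorm (vec3 p)].
  by apply/seteqP; split=> p //= -[].
rewrite !nuE// sphere_areaE !sigmaE.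
by rewrite muleACA [in RHS]muleACA [X in (_ * X)%E]muleC.
Qed.

Lemma negligible_origin : leb3 [set p | vec3 p = 0] = 0%E.
Proof.
have -> : [set p : R3 R | vec3 p = 0] = ([set 0] `*` [set 0]) `*` [set 0].
  apply/seteqP; split=> [p /= p0|p [[/= p1 p2] p3]].
    have h i : vec3 p 0 i = 0 by rewrite p0 mxE.
    by have := h 0; have := h 1; have := h 2%:R; rewrite !vec3_coord => -> -> ->.
  by apply: rV3P; rewrite !vec3_coord !mxE.
have m1 : measurable ([set 0] : set mR) by exact: measurable_set1.
have E := product_measure1E (@lebesgue2 R) lebesgue_measure (measurableX m1 m1) m1.
suff : (@lebesgue2 R \x lebesgue_measure)%E (([set 0] `*` [set 0]) `*` [set 0]) = 0%E by [].
rewrite E; apply/eqP; rewrite mule_eq0; apply/orP; right.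
by apply/eqP; exact: lebesgue_measure_set1.
Qed.

Lemma integral_nu3 (h : R3 R -> \bar R) : measurable_fun setT h ->
  (forall p, 0 <= h p)%E -> (forall p, 1 < enorm (vec3 p) -> h p = 0%E) ->
  (\int[leb3]_p h p = \int[nu3]_p h p)%E.
Proof.
move=> mh h0 h1; have mB := @measurable_punctured_ball R.
have mN : measurable [set p : R3 R | vec3 p = 0].
  have -> : [set p : R3 R | vec3 p = 0] = (fun p => enorm (vec3 p) : mR) @^-1` [set 0].
    by apply/seteqP; split=> p /= => [->|/eqP]; [exact: enorm0|rewrite enorm_eq0 => /eqP].
  by rewrite -[X in measurable X]setTI; apply: measurable_enorm_vec3 => //; exact: measurable_set1.
rewrite (ge0_negligible_integral mN measurableT mh (fun p _ => h0 p) negligible_origin).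
transitivity (\int[leb3]_(p in pball) h p)%E.
  rewrite integral_mkcond [RHS]integral_mkcond; apply: eq_integral => p _.
  rewrite !patchE setTD; case: ifPn => [|]; rewrite ?inE ?notin_setE /pball/= => p0.
    case: ifPn => //; rewrite notin_setE/= => /negP; rewrite negb_and -leNgt => /orP[|].
      by rewrite le_eqVlt ltNge enorm_ge0 orbF enorm_eq0 => /eqP.
    by rewrite -ltNge => /h1.
  case: ifPn => //; rewrite inE/= => /andP[p0' _]; exfalso; apply: p0 => /= p0.
  by move: p0'; rewrite p0 enorm0 ltxx.
transitivity (\int[nu3]_(p in pball) h p)%E.
  apply: eq_measure_integral => A mA AB; rewrite /nu3 /mrestr; congr (leb3 _).
  by apply/esym/setIidPl.
have nB : nu3 (~` pball) = 0%E.
  by rewrite /nu3 /mrestr setICl measure0.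
rewrite (ge0_negligible_integral (measurableC mB) measurableT mh (fun p _ => h0 p) nB).
by rewrite setTD setCK.
Qed.

Lemma measurable_sqnorm6 :
  measurable_fun setT (fun z : R6 => dotp (vec3 z.1) (vec3 z.1) : mR) /\
  measurable_fun setT (fun z : R6 => dotp (vec3 z.2) (vec3 z.2) : mR).
Proof.
have m1 := measurable_vec3_comp (@sqnorm_continuous R).
split; first exact: measurableT_comp m1 measurable_fst.
exact: measurableT_comp m1 measurable_snd.
Qed.

Local Open Scope ereal_scope.

Lemma ball6_polar (G : S2 R -> \bar R) (psi : mR * R3 R -> \bar R) :
  measurable_fun setT G -> (forall u, 0 <= G u) ->
  measurable_fun setT psi -> (forall z, 0 <= psi z) ->
  (sphere_area%:num)%:E *
    \int[@lebesgue6 R]_(z in ball6) (G (sdir (vec3 z.1)) * psi (enorm (vec3 z.1), z.2)) =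
  \int[@sigma R]_u G u * \int[@lebesgue6 R]_(z in ball6) psi (enorm (vec3 z.1), z.2).
Proof.
move=> mG G0 mpsi psi0.
pose D : set (mR * R3 R) := [set w | (w.1 ^+ 2 + dotp (vec3 w.2) (vec3 w.2) <= 1)%R].
have mD : measurable D.
  have mf : measurable_fun setT (fun w : mR * R3 R => (w.1 ^+ 2 + dotp (vec3 w.2) (vec3 w.2))%R : mR).
    apply: measurable_funD.
      by apply: measurable_funX; exact: measurable_fst.
    exact: measurableT_comp (measurable_vec3_comp (@sqnorm_continuous R)) measurable_snd.
  have -> : D = setT `&` (fun w : mR * R3 R => (w.1 ^+ 2 + dotp (vec3 w.2) (vec3 w.2))%R : mR) @^-1` `]-oo, 1%R].
    by apply/seteqP; split=> w /=; rewrite in_itv/= => // -[].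
  by apply: mf => //; exact: measurable_itv.
(* Membership in [ball6] depends on [x] only through its norm, so the domain of integration can be
   absorbed into the radial factor. *)
pose psi' := psi \_ D.
have mpsi' : measurable_fun setT psi'.
  by apply/(measurable_restrictT _ mD); exact: measurable_funTS.
have psi'0 z : 0 <= psi' z by rewrite /psi' patchE; case: ifP.
have key (H : S2 R -> \bar R) : measurable_fun setT H -> (forall u, 0 <= H u) ->
  \int[@lebesgue6 R]_(z in ball6) (H (sdir (vec3 z.1)) * psi (enorm (vec3 z.1), z.2)) =
  \int[leb3]_y \int[nu3]_x (H (sdir (vec3 x)) * psi' (enorm (vec3 x), y)).
  move=> mH H0.
  pose F (z : R6) := H (sdir (vec3 z.1)) * psi' (enorm (vec3 z.1), z.2).
  have mF : measurable_fun setT F.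
    apply: emeasurable_funM.
      by apply: measurableT_comp mH _; exact: measurableT_comp (@measurable_sdir R) measurable_fst.
    apply: measurableT_comp mpsi' _; apply/measurable_fun_pair => /=; last exact: measurable_snd.
    exact: measurableT_comp measurable_enorm_vec3 measurable_fst.
  have F0 z : 0 <= F z by exact: mule_ge0.
  transitivity (\int[@lebesgue6 R]_z F z).
    rewrite integral_mkcond; apply: eq_integral => z _.
    rewrite /F /psi' !patchE; case: ifPn => zB; case: ifPn => zD //.
    - exfalso; move: zD; rewrite notin_setE /D/= sqr_enorm => h; apply: h.
      by move: zB; rewrite inE.
    - exfalso; move: zB; rewrite notin_setE /ball6/= => h; apply: h.
      by move: zD; rewrite inE /D/= sqr_enorm.
    - by rewrite mule0.
  apply: etrans (fubini_tonelli2 (m1 := leb3) (m2 := leb3) _ mF F0) _.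
  apply: eq_integral => y _; rewrite /fubini_G.
  apply: integral_nu3 => [|x|x x1].
  - exact: measurableT_comp mF (measurable_pair2 _).
  - exact: F0.
  - rewrite /F /psi' patchE ifF ?mule0//; apply/negbTE; rewrite notin_setE /D/= => h.
    have := dotp_ge0 (vec3 y); have := enorm_ge0 (vec3 x); nra.
rewrite (key G mG G0).
have -> : \int[@lebesgue6 R]_(z in ball6) psi (enorm (vec3 z.1), z.2) =
    \int[leb3]_y \int[nu3]_x psi' (enorm (vec3 x), y).
  apply: etrans (etrans _ (key (cst 1) (@measurable_cst _ _ _ _ _ _) (fun=> lee01))) _.
    by apply: eq_integral => z _; rewrite mul1e.
  by apply: eq_integral => y _; apply: eq_integral => x _; rewrite mul1e.
apply: (@polar_integral2 _ _ _ _ _ _ R nu3 (@sigma R) leb3 (@sdir R \o @vec3 R)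
  (fun p => enorm (vec3 p)) (@measurable_sdir R) measurable_enorm_vec3 sphere_area) => //.
by move=> A t mA; exact: nu3_polar_rays.
Qed.

Local Close Scope ereal_scope.

Lemma bd6_sqnorm : bd6 (fun z : R6 => dotp (vec3 z.1) (vec3 z.1)) /\
  bd6 (fun z : R6 => dotp (vec3 z.2) (vec3 z.2)).
Proof.
have [m1 m2] := measurable_sqnorm6.
split; split=> //; exists 1 => z zB; rewrite ger0_norm ?dotp_ge0//.
  by have := dotp_ge0 (vec3 z.2); move: zB; rewrite /ball6/=; lra.
by have := dotp_ge0 (vec3 z.1); move: zB; rewrite /ball6/=; lra.
Qed.

(** A box of positive volume, away from the origin, whose square lies in [ball6]. It witnesses the
    positivity of the area of the sphere and of [kappa]. *)
Definition box3 : set (R3 R) :=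
  (`[(4^-1)%R, (3^-1)%R] `*` `[(4^-1)%R, (3^-1)%R]) `*` `[(4^-1)%R, (3^-1)%R].

Lemma measurable_box3 : measurable box3.
Proof. by apply: measurableX; [apply: measurableX|]; exact: measurable_itv. Qed.

Lemma box3_gt0 : (0 < leb3 box3)%E.
Proof.
pose J : set mR := `[(4^-1)%R, (3^-1)%R]%classic.
have mJ : measurable J by exact: measurable_itv.
have J0 : (0 < lebesgue_measure J)%E.
  rewrite /J lebesgue_measure_itv/= lte_fin ltf_pV2 ?posrE// ifT; last by rewrite ltr_nat.
  by rewrite lte_fin subr_gt0 ltf_pV2 ?posrE// ltr_nat.
have E2 := product_measure1E (@lebesgue_measure R) lebesgue_measure mJ mJ.
have E3 := product_measure1E (@lebesgue2 R) lebesgue_measure (measurableX mJ mJ) mJ.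
have J2 : (0 < @lebesgue2 R (J `*` J))%E.
  rewrite [X in (_ < X)%E](E2 : lebesgue2 _ = _).
  by rewrite mule_gt0.
suff : (0 < (@lebesgue2 R \x lebesgue_measure) ((J `*` J) `*` J))%E by [].
by rewrite E3 mule_gt0.
Qed.

Lemma box3_sqnorm p : box3 p -> 16^-1 <= dotp (vec3 p) (vec3 p) <= 2^-1.
Proof.
rewrite /box3/= !in_itv/= => -[[/andP[a1 a2] /andP[b1 b2]] /andP[c1 c2]].
rewrite dotp3E !vec3_coord.
move: (p.1.1) (p.1.2) (p.2) a1 a2 b1 b2 c1 c2 => a b c a1 a2 b1 b2 c1 c2.
by apply/andP; split; nra.
Qed.

Lemma sphere_area_gt0 : 0 < sphere_area%:num.
Proof.
rewrite -lte_fin sphere_areaE sigmaE mule_gt0//.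
apply: (lt_le_trans box3_gt0); apply: le_measure; rewrite ?inE.
- exact: measurable_box3.
- exact: measurable_cone.
- move=> p /box3_sqnorm/andP[p1 p2]; split => //; have := enorm_ge0 (vec3 p).
  rewrite -sqr_enorm in p1; rewrite -sqr_enorm in p2 => p0.
  by apply/andP; split; nra.
Qed.

Lemma int6_sqnorm_gt0 : 0 < int6 (fun z : R6 => dotp (vec3 z.1) (vec3 z.1)).
Proof.
have [b1 _] := bd6_sqnorm; have i1 := bd6_integrable b1.
have f1 := integrable_fin_num (@measurable_ball6 R) i1.
rewrite -lte_fin /int6 /Rintegral fineK//.
have mQ : measurable (box3 `*` box3) by apply: measurableX; exact: measurable_box3.
have QB : box3 `*` box3 `<=` ball6.
  move=> z [/box3_sqnorm/andP[_ h1] /box3_sqnorm/andP[_ h2]].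
  by rewrite /ball6/=; lra.
have Q0 : (0 < @lebesgue6 R (box3 `*` box3))%E.
  have E := product_measure1E leb3 leb3 measurable_box3 measurable_box3.
  suff : (0 < (leb3 \x leb3) (box3 `*` box3))%E by [].
  by rewrite E mule_gt0// box3_gt0.
apply: (@lt_le_trans _ _ (\int[@lebesgue6 R]_(z in box3 `*` box3) (16^-1)%:E)%E).
  by rewrite integral_cst// mule_gt0// lte_fin.
apply: (@le_trans _ _ (\int[@lebesgue6 R]_(z in box3 `*` box3) (dotp (vec3 z.1) (vec3 z.1))%:E)%E).
  apply: ge0_le_integral => //.
  - by apply/measurable_EFinP; exact: measurable_funTS measurable_sqnorm6.1.
  - by move=> z [/box3_sqnorm/andP[h _] _]; rewrite lee_fin.
apply: ge0_subset_integral => //; first exact: measurable_ball6.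
  by apply/measurable_EFinP; exact: measurable_funTS measurable_sqnorm6.1.
by move=> z _; rewrite lee_fin dotp_ge0.
Qed.

(** The ratio between the integral of [|x|^2 * G (x / |x|)] over the six-dimensional ball and the
    integral of [G] over the sphere. Only its sign matters afterwards. *)
Definition kappa : R := int6 (fun z : R6 => dotp (vec3 z.1) (vec3 z.1)) / sphere_area%:num.

Lemma kappa_gt0 : 0 < kappa.
Proof. by rewrite divr_gt0// ?int6_sqnorm_gt0// sphere_area_gt0. Qed.

Lemma S2_integrable (G : S2 R -> R) (M : R) : measurable_fun setT G ->
  (forall u, `|G u| <= M) -> (@sigma R).-integrable setT (EFin \o G).
Proof.
move=> mG GM; apply: measurable_bounded_integrable => //.
  by rewrite -ge0_fin_numE//; exact: fin_num_measure.
exists M; split; first exact: num_real.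
by move=> x Mx u _ /=; exact: le_trans (GM u) (ltW Mx).
Qed.

Lemma bd6_sdir (G : S2 R -> R) (M : R) (w : R6 -> R) : measurable_fun setT G ->
  (forall u, `|G u| <= M) -> bd6 w -> bd6 (fun z => G (sdir (vec3 z.1)) * w z).
Proof.
move=> mG GM bw; apply: (@bd6M R (fun z => G (sdir (vec3 z.1))) w) => //; split.
  by apply: measurableT_comp mG _; exact: measurableT_comp (@measurable_sdir R) measurable_fst.
by exists M => z _.
Qed.

Let ball6_polar_real (G : S2 R -> R) (M : R) (w : R6 -> R) (psi : mR * R3 R -> R) :
  measurable_fun setT G -> (forall u, 0 <= G u <= M) ->
  measurable_fun setT psi -> (forall z, 0 <= psi z) -> bd6 w ->
  (forall z : R6, w z = psi (enorm (vec3 z.1), z.2)) ->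
  sphere_area%:num * int6 (fun z => G (sdir (vec3 z.1)) * w z) =
  (\int[@sigma R]_u G u) * int6 w.
Proof.
move=> mG GM mpsi psi0 bw wE.
have GM' u : `|G u| <= M by have /andP[G0 ?] := GM u; rewrite ger0_norm.
have bGw := bd6_sdir mG GM' bw.
have fGw := integrable_fin_num (@measurable_ball6 R) (bd6_integrable bGw).
have fw := integrable_fin_num (@measurable_ball6 R) (bd6_integrable bw).
have fG := integrable_fin_num measurableT (S2_integrable mG GM').
apply: EFin_inj; rewrite !EFinM /int6 /Rintegral !fineK//.
have G0 u : (0 <= (G u)%:E)%E by rewrite lee_fin; have /andP[] := GM u.
have p0 z : (0 <= (psi z)%:E)%E by rewrite lee_fin.
have mGE : measurable_fun setT (EFin \o G) by exact/measurable_EFinP.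
have mpE : measurable_fun setT (EFin \o psi) by exact/measurable_EFinP.
have := ball6_polar mGE G0 mpE p0; rewrite sphere_areaE.
have -> : (fun z : R6 => (w z)%:E) = fun z => (EFin \o psi) (enorm (vec3 z.1), z.2).
  by apply/funext => z; rewrite wE.
have -> : (fun z : R6 => (G (sdir (vec3 z.1)) * w z)%:E) = fun z =>
    ((EFin \o G) (sdir (vec3 z.1)) * (EFin \o psi) (enorm (vec3 z.1), z.2))%E.
  by apply/funext => z; rewrite wE.
by [].
exact: fin_num_measure.
Qed.

Lemma int6_polar (G : S2 R -> R) (M : R) :
  measurable_fun setT G -> (forall u, 0 <= G u <= M) ->
  int6 (fun z => G (sdir (vec3 z.1)) * dotp (vec3 z.1) (vec3 z.1)) =
    kappa * \int[@sigma R]_u G u /\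
  int6 (fun z => G (sdir (vec3 z.1)) * dotp (vec3 z.2) (vec3 z.2)) =
    kappa * \int[@sigma R]_u G u.
Proof.
move=> mG GM; have [b1 b2] := bd6_sqnorm.
have sn0 : sphere_area%:num != 0 :> R by rewrite gt_eqF// sphere_area_gt0.
(* The rotation by a right angle exchanges the two factors, up to a sign that the square ignores. *)
have UT : int6 (fun z : R6 => dotp (vec3 z.2) (vec3 z.2)) =
    int6 (fun z : R6 => dotp (vec3 z.1) (vec3 z.1)).
  have c1 : (0 : R) ^+ 2 + 1 ^+ 2 = 1 by rewrite expr0n/= add0r expr1n.
  have c2 : (0 : R) != -1 by rewrite eq_sym oppr_eq0 oner_eq0.
  rewrite -(int6_rot6 c1 c2 b1); congr int6; apply/funext => z /=.
  by rewrite vec3_comb3 scale0r add0r scale1r.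
have mT : measurable_fun setT (fun w : mR * R3 R => w.1 ^+ 2).
  by apply: measurable_funX; exact: measurable_fst.
have mU : measurable_fun setT (fun w : mR * R3 R => dotp (vec3 w.2) (vec3 w.2)).
  exact: measurableT_comp (measurable_vec3_comp (@sqnorm_continuous R)) measurable_snd.
have T0 (w : mR * R3 R) : 0 <= w.1 ^+ 2 by exact: sqr_ge0.
have U0 (w : mR * R3 R) : 0 <= dotp (vec3 w.2) (vec3 w.2) by exact: dotp_ge0.
have ET := ball6_polar_real mG GM mT T0 b1 (fun z => esym (sqr_enorm _)).
have EU := ball6_polar_real mG GM mU U0 b2 (fun z => erefl).
split; apply: (mulfI sn0); rewrite ?ET ?EU ?UT /kappa.
  by rewrite [RHS]mulrA [X in _ = X * _]mulrC mulfVK// mulrC.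
by rewrite [RHS]mulrA [X in _ = X * _]mulrC mulfVK// mulrC.
Qed.

End polar_sphere.

(** * Derivatives of sublinear functions *)

Section directional_derivative.
Context {R : realType}.
Local Notation V := 'rV[R]_3.
Implicit Types (h : V -> R) (x v w : V) (t : R).

Definition dquot h x v t := (h (x + t *: v) - h x) / t.

(* One-sided directional derivative of a convex function: the difference
   quotients are monotone, hence the infimum. *)
Definition pd h x v := inf [set dquot h x v t | t in [set t | 0 < t]].

Variable h : V -> R.
Hypothesis sh : sublinear h.

Let hconv x y a b : 0 <= a -> 0 <= b -> h (a *: x + b *: y) <= a * h x + b * h y.
Proof. by move=> a0 b0; rewrite (le_trans (sh.1 _ _))// !sh.2. Qed.

Lemma dquot_mono x v s t : 0 < s -> s <= t -> dquot h x v s <= dquot h x v t.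
Proof.
move=> s0 st; have t0 := lt_le_trans s0 st.
rewrite /dquot ler_pdivrMr// mulrAC ler_pdivlMr//.
have -> : x + s *: v = (1 - s / t) *: x + (s / t) *: (x + t *: v).
  rewrite scalerDr addrA -scalerDl subrK scale1r scalerA divfK ?gt_eqF//.
have a0 : 0 <= 1 - s / t by rewrite subr_ge0 ler_pdivrMr// mul1r.
have b0 : 0 <= s / t by rewrite divr_ge0// ltW.
have := hconv x (x + t *: v) a0 b0.
have : (1 - s / t) * t = t - s by rewrite mulrBl mul1r divfK ?gt_eqF.
have : s / t * t = s by rewrite divfK ?gt_eqF.
set c := s / t => e1 e2 H.
have := ler_wpM2r (ltW t0) H.
rewrite mulrDl [(1 - c) * _ * _]mulrAC e2 [c * _ * _]mulrAC e1.
by move: (h _) (h x) (h _) => A B C; rewrite !mulrBl; lra.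
Qed.

Let lbq x v : lbound [set dquot h x v t | t in [set t | 0 < t]] (- h (- v)).
Proof.
move=> _ [t /= t0 <-]; rewrite /dquot ler_pdivlMr//.
have := sh.1 (x + t *: v) (t *: - v).
have -> : x + t *: v + t *: - v = x by rewrite scalerN addrK.
by rewrite (sh.2 _ _ (ltW t0)); lra.
Qed.

Lemma pd_le x v t : 0 < t -> pd h x v <= dquot h x v t.
Proof. by move=> t0; apply: ge_inf; [exists (- h (- v)); exact: lbq|exists t]. Qed.

Lemma pd_ge x v : - h (- v) <= pd h x v.
Proof.
by apply: lb_le_inf; [exists (dquot h x v 1), 1 => /=|exact: lbq].
Qed.

Lemma pd_near x v e : 0 < e -> exists2 d, 0 < d &
  forall t, 0 < t -> t <= d -> dquot h x v t < pd h x v + e.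
Proof.
move=> e0; have ne : [set dquot h x v t | t in [set t | 0 < t]] !=set0.
  by exists (dquot h x v 1), 1 => /=.
have : pd h x v < pd h x v + e by rewrite ltrDl.
move=> /(inf_lt ne)[_ [d /= d0 <-] dl]; exists d => // t t0 td.
exact: le_lt_trans (dquot_mono _ _ t0 td) dl.
Qed.

Lemma pd_le_bound x v a : (forall e, 0 < e -> exists2 t, 0 < t & dquot h x v t <= a + e) ->
  pd h x v <= a.
Proof.
move=> H; apply/ler_addgt0Pr => e e0; have [t t0 ht] := H e e0.
exact: le_trans (pd_le _ _ t0) ht.
Qed.

Lemma sublinear_pd x : sublinear (pd h x).
Proof.
split=> [v w|a v].
  apply: pd_le_bound => e e0; have e20 : 0 < e / 2 by rewrite divr_gt0.
  have [d1 d10 h1] := pd_near x v e20; have [d2 d20 h2] := pd_near x w e20.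
  pose d := Num.min d1 d2; have d0 : 0 < d by rewrite lt_min d10.
  exists (d / 2); first by rewrite divr_gt0.
  have q1 := h1 _ d0; have q2 := h2 _ d0.
  have {q1} q1 : dquot h x v d < pd h x v + e / 2 by apply: q1; rewrite ge_min lexx.
  have {q2} q2 : dquot h x w d < pd h x w + e / 2 by apply: q2; rewrite ge_min lexx orbT.
  suff : dquot h x (v + w) (d / 2) <= dquot h x v d + dquot h x w d by lra.
  rewrite /dquot -mulrDl ler_pdivrMr ?divr_gt0// mulrA mulfVK ?gt_eqF//.
  have -> : x + (d / 2) *: (v + w) = 2^-1 *: (x + d *: v) + 2^-1 *: (x + d *: w).
    by apply: rV3P; rewrite !mxE; field.
  have p2 : 0 <= 2^-1 :> R by rewrite invr_ge0.
  by have := hconv (x + d *: v) (x + d *: w) p2 p2; lra.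
rewrite le_eqVlt => /predU1P[<-|a0].
  rewrite mul0r scale0r; apply/eqP; rewrite eq_le; apply/andP; split.
    have := pd_le x 0 (ltr01 : 0 < 1); rewrite /dquot scaler0 addr0 subrr mul0r //.
  by have := pd_ge x 0; rewrite oppr0 sublinear0// oppr0.
have le (b : R) (y : V) : 0 < b -> pd h x (b *: y) <= b * pd h x y.
  move=> b0; apply: pd_le_bound => e e0.
  have eb0 : 0 < e / b by rewrite divr_gt0.
  have [d d0 hd] := pd_near x y eb0; exists (d / b); first by rewrite divr_gt0.
  have := hd _ d0 (lexx _); rewrite /dquot scalerA divfK ?gt_eqF// => hd'.
  rewrite invf_div mulrCA -ler_pdivlMl// mulrDr mulKf ?gt_eqF// [b^-1 * e]mulrC.
  exact: ltW.
apply/eqP; rewrite eq_le le//=.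
have aV0 : 0 < a^-1 by rewrite invr_gt0.
have := le _ (a *: v) aV0; rewrite scalerA mulVf ?gt_eqF// scale1r.
by rewrite mulrC ler_pdivlMr// mulrC.
Qed.

Lemma pd_scale x v (a : R) : 0 < a -> pd h (a *: x) v = pd h x v.
Proof.
move=> a0.
have le b y : 0 < b -> pd h (b *: y) v <= pd h y v.
  move=> b0; apply: pd_le_bound => e e0; have [d d0 hd] := pd_near y v e0.
  exists (b * d); first by rewrite mulr_gt0.
  apply: ltW; apply: le_lt_trans (hd _ d0 (lexx _)).
  rewrite /dquot -scalerA -scalerDr !(sh.2 _ _ (ltW b0)).
  by rewrite -mulrBr -mulf_div divff ?gt_eqF// mul1r.
apply/eqP; rewrite eq_le le//=.
have aV0 : 0 < a^-1 by rewrite invr_gt0.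
by have := le _ (a *: x) aV0; rewrite scalerA mulVf ?gt_eqF// scale1r.
Qed.

(** Euler's identity for 1-homogeneous functions. *)
Lemma pd_self x : pd h x x = h x.
Proof.
have q (t : R) : 0 < t -> dquot h x x t = h x.
  move=> t0; rewrite /dquot -{1}(scale1r x) -scalerDl.
  rewrite (sh.2 _ _ (addr_ge0 ler01 (ltW t0))).
  by field; rewrite gt_eqF.
apply/eqP; rewrite eq_le -{1}(q 1)// pd_le//=.
by apply: lb_le_inf; [exists (dquot h x x 1), 1 => /=|move=> _ [t /= t0 <-]; rewrite q].
Qed.

(** Two-sided derivatives along the three axes are enough for linearity in all directions: [pd h x]
    is sublinear, and antisymmetric on the axes. *)
Definition smooth_at x := forall i, pd h x (e3 i) + pd h x (- e3 i) = 0.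

Definition grad x : V := \row_i pd h x (e3 i).

Lemma smooth_pd x v : smooth_at x -> pd h x v = dotp (grad x) v.
Proof.
move=> sx; apply: sublinear_linear; first exact: sublinear_pd.
by move=> i; have := sx i; lra.
Qed.

Lemma dquot_cvg x v : pd h x v + pd h x (- v) = 0 ->
  dquot h x v t @[t --> 0^'] --> pd h x v.
Proof.
move=> sx; apply/cvgrPdist_le => e e0; have [d1 d10 h1] := pd_near x v e0.
have [d2 d20 h2] := pd_near x (- v) e0.
have d0 : 0 < Num.min d1 d2 by rewrite lt_min d10.
apply/nbhs_ballP; exists (Num.min d1 d2) => //= t.
rewrite /ball/= sub0r normrN => /ltW; rewrite le_min => /andP[td1 td2] tn0.
rewrite distrC; have [t0|t0|/eqP] := ltgtP t 0; last by rewrite (negbTE tn0).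
  have Nt0 : 0 < - t by rewrite oppr_gt0.
  have := h2 _ Nt0; have := pd_le x (- v) Nt0.
  have -> : dquot h x (- v) (- t) = - dquot h x v t.
    by rewrite /dquot scalerN scaleNr opprK invrN mulrN.
  rewrite (ltr0_norm t0) in td2 => a1 /(_ td2) a2.
  by rewrite ler_norml; apply/andP; split; lra.
have := h1 _ t0; have := pd_le x v t0.
rewrite (gtr0_norm t0) in td1 => a1 /(_ td1) a2.
by rewrite ler_norml; apply/andP; split; lra.
Qed.

(** The library derivative has a default value where the limit does not exist, so the set where it
    is genuine has to be described exactly. This is the direction from convergence to the vanishing
    of the gap. *)
Lemma dquot_cvg_smooth x v : cvg (dquot h x v t @[t --> 0^']) ->
  pd h x v + pd h x (- v) = 0.
Proof.
move=> /cvg_ex[l hl]; suff H e : 0 < e -> `|pd h x v + pd h x (- v)| <= e.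
  by apply/eqP; rewrite -normr_le0; apply/ler_addgt0Pr => e e0; rewrite add0r; exact: H.
move=> e0; have e40 : 0 < e / 4 by rewrite divr_gt0.
have [d1 d10 h1] := pd_near x v e40; have [d2 d20 h2] := pd_near x (- v) e40.
move/cvgrPdist_le : hl => /(_ _ e40); move=> /nbhs_ballP[d3 /= d30 h3].
pose d := Num.min (Num.min d1 d2) (d3 / 2).
have d0 : 0 < d by rewrite !lt_min d10 d20 divr_gt0.
have dd1 : d <= d1 by rewrite !ge_min lexx.
have dd2 : d <= d2 by rewrite !ge_min lexx orbT.
have dd3 : d < d3 by rewrite gt_min ltr_pdivrMr// ltr_pMr// ltr1n orbT.
have := h1 _ d0 dd1; have := h2 _ d0 dd2.
have := pd_le x v d0; have := pd_le x (- v) d0.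
have -> : dquot h x (- v) d = - dquot h x v (- d).
  by rewrite /dquot scalerN scaleNr invrN mulrN opprK.
have := h3 d; rewrite /ball/= sub0r normrN gtr0_norm// => /(_ dd3 (lt0r_neq0 d0)).
have := h3 (- d); rewrite /ball/= sub0r normrN normrN gtr0_norm// oppr_eq0.
move=> /(_ dd3 (lt0r_neq0 d0)); rewrite !ler_norml => /andP[a1 a2] /andP[b1 b2] *.
by apply/andP; split; lra.
Qed.

Lemma pd_cvg x v : dquot h x v (n.+1%:R^-1) @[n --> \oo] --> pd h x v.
Proof.
apply/cvgrPdist_le => e e0; have [d d0 hd] := pd_near x v e0.
near=> n; have n0 : 0 < n.+1%:R^-1 :> R by rewrite invr_gt0.
rewrite ler_norml; have := pd_le x v n0.
have : n.+1%:R^-1 <= d.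
  by apply: ltW; near: n; exact: (near_infty_natSinv_lt (PosNum d0)).
by move=> /(hd _ n0) a b; apply/andP; split; lra.
Unshelve. all: by end_near. Qed.

End directional_derivative.

Section enorm_derivative.
Context {R : realType}.
Local Notation V := 'rV[R]_3.
Implicit Types (x v : V).

Lemma sublinear_enorm : sublinear (@enorm R).
Proof. by split=> [|a u a0]; [exact: ler_enormD|rewrite enormZ ger0_norm]. Qed.

Lemma enorm_taylor_ge x v (t : R) : x != 0 ->
  enorm x + t * (dotp x v / enorm x) <= enorm (x + t *: v).
Proof.
move=> x0; have nx0 : 0 < enorm x by rewrite enorm_gt0.
rewrite -(ler_pM2r nx0) (le_trans _ (dotp_le_enorm _ _))//.
by rewrite dotpDl dotpZl (dotpC v x) -sqr_enorm le_eqVlt; apply/orP; left; apply/eqP;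
  field; rewrite gt_eqF.
Qed.

Lemma enorm_taylor_le x v (t : R) : x != 0 ->
  enorm (x + t *: v) <=
  enorm x + t * (dotp x v / enorm x) + t ^+ 2 * (enorm v ^+ 2 / (2 * enorm x)).
Proof.
move=> x0; have nx0 : 0 < enorm x by rewrite enorm_gt0.
rewrite -(@ler_pM2l _ (2 * enorm x)) ?mulr_gt0//.
have -> : 2 * enorm x * (enorm x + t * (dotp x v / enorm x) +
      t ^+ 2 * (enorm v ^+ 2 / (2 * enorm x))) =
    enorm x ^+ 2 + enorm (x + t *: v) ^+ 2.
  rewrite (sqr_enorm (x + _)) dotpDl !dotpDr !dotpZl !dotpZr -!sqr_enorm (dotpC v x).
  by field; rewrite gt_eqF.
by have := sqr_ge0 (enorm x - enorm (x + t *: v)); rewrite sqrrB; lra.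
Qed.

Lemma pd_enorm x v : x != 0 -> pd (@enorm R) x v = dotp x v / enorm x.
Proof.
move=> x0; apply/eqP; rewrite eq_le; apply/andP; split; last first.
  apply: lb_le_inf; first by exists (dquot (@enorm R) x v 1), 1 => /=.
  move=> _ [t /= t0 <-]; rewrite /dquot ler_pdivlMr// mulrC lerBrDl.
  exact: enorm_taylor_ge.
apply: (pd_le_bound sublinear_enorm) => e e0.
pose K := enorm v ^+ 2 / (2 * enorm x).
have K0 : 0 <= K by rewrite divr_ge0 ?sqr_ge0// mulr_ge0// enorm_ge0.
have K1 : 0 < K + 1 by rewrite ltr_wpDl.
have t0 : 0 < e / (K + 1) by rewrite divr_gt0.
exists (e / (K + 1)) => //; rewrite /dquot ler_pdivrMr// lerBlDl.
apply: (le_trans (enorm_taylor_le v _ x0)).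
rewrite -/K expr2 [(_ + e) * _]mulrDl addrA [_ / _ * _]mulrC lerD2l -mulrA mulrC.
rewrite ler_wpM2r ?(ltW t0)// mulrAC ler_pdivrMr//.
by rewrite mulrDr mulr1; lra.
Qed.

End enorm_derivative.

Lemma measurable_val_coord (R : realType) (j : 'I_3) :
  measurable_fun setT (fun u : S2 R => \val u 0 j).
Proof.
apply: continuous_S2_measurable => v.
have E : (fun v : S2 R => \val v 0 j) = (fun v : S2 R => dotp (e3 j) (\val v)).
  by apply/funext => w; rewrite dotpC dotp_e3.
rewrite E; apply: continuous_comp; first exact: val_S2_continuous.
exact: dotp_continuous.
Qed.

(** * Almost everywhere differentiability of a sublinear function on the sphere *)

Section hext_smooth_ae.
Context {R : realType}.
Local Notation V := 'rV[R]_3.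
Local Notation leb3 := (@lebesgue3 R).
Implicit Types (x y v : V) (p : R3 R).

Lemma cube3_integrable (F : R3 R -> R) (M : R) : measurable_fun setT F ->
  (forall p, `|F p| <= M) -> (forall p, ~ cube3 p -> F p = 0) ->
  leb3.-integrable setT (EFin \o F).
Proof.
move=> mF FM F0.
have M0 : 0 <= M := le_trans (normr_ge0 _) (FM (0, 0, 0)).
have -> : EFin \o F = (EFin \o F) \_ (@cube3 R).
  apply/funext => p; rewrite patchE /=; case: ifPn => // /negP cp.
  by rewrite F0// => c; apply: cp; rewrite inE.
have E := @integrable_mkcond _ _ _ leb3 (@cube3 R) (EFin \o F) (@measurable_cube3 R).
apply: (iffLR E); apply: measurable_bounded_integrable.
- exact: measurable_cube3.
- exact: cube3_fin.
- exact: measurable_funS mF.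
exists M; split; first exact: num_real.
by move=> x Mx z /= _; exact: le_trans (FM z) (ltW Mx).
Qed.

Lemma cube3_le (F : R3 R -> R) (M : R) : measurable_fun setT F ->
  (forall p, F p <= M) -> (forall p, ~ cube3 p -> F p = 0) ->
  leb3.-integrable setT (EFin \o F) ->
  \int[leb3]_p F p <= M * fine (leb3 (@cube3 R)).
Proof.
move=> mF FM F0 iF.
have E : \int[leb3]_p F p = \int[leb3]_(p in @cube3 R) F p.
  have E2 := @Rintegral_mkcond _ _ _ leb3 (@cube3 R) F; rewrite E2.
  congr (Rintegral _ _ _); apply/funext => p; rewrite patchE.
  by case: ifPn => // /negP cp; rewrite F0// => c; apply: cp; rewrite inE.
have E3 := @Rintegral_cst _ _ _ leb3 (@cube3 R) (@measurable_cube3 R) M.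
rewrite E -E3; apply: le_Rintegral.
- exact: measurable_cube3.
- exact: integrableS (measurableT) (@measurable_cube3 R) (@subsetT _ _) iF.
- apply: measurable_bounded_integrable.
  + exact: measurable_cube3.
  + exact: cube3_fin.
  + exact: measurable_cst.
  + exists `|M|; split; first exact: num_real.
    by move=> x Mx z /= _; exact: ltW.
- by move=> p _; exact: FM.
Qed.

Variable h : V -> R.
Hypothesis sh : sublinear h.
Variable L : R.
Hypothesis L0 : 0 < L.
Hypothesis hL : forall x y, `|h x - h y| <= L * enorm (x - y).

(** The gap between the right and left derivatives along an axis: nonnegative by convexity, so that
    it vanishes almost everywhere once its integral does. *)
Definition ddiff i x := pd h x (e3 i) + pd h x (- e3 i).

Lemma ddiff_ge0 i x : 0 <= ddiff i x.
Proof.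
have := sublinearN (- e3 i) (sublinear_pd sh x).
by rewrite opprK -subr_ge0 opprK addrC.
Qed.

Lemma measurable_pd d (T : measurableType d) (F : T -> V) v :
  (forall i, measurable_fun setT (fun t => F t 0 i)) ->
  measurable_fun setT (fun t => pd h (F t) v).
Proof.
move=> mF; apply: (@measurable_fun_cvg _ _ _ _ (fun n t => dquot h (F t) v n.+1%:R^-1)).
  move=> n; apply: measurable_funM => //; apply: measurable_funB.
    apply: (@measurable_comp_continuous _ _ _ (fun t => F t + n.+1%:R^-1 *: v)).
      move=> i; under eq_fun do rewrite mxE.
      exact: measurable_funD.
    exact: sublinear_continuous.
  by apply: measurable_comp_continuous => //; exact: sublinear_continuous.
by move=> t _; exact: pd_cvg.
Qed.

Lemma measurable_ddiff d (T : measurableType d) (F : T -> V) i :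
  (forall i, measurable_fun setT (fun t => F t 0 i)) ->
  measurable_fun setT (fun t => ddiff i (F t)).
Proof. by move=> mF; apply: measurable_funD; exact: measurable_pd. Qed.

Lemma ddiff_le_quot i x t : 0 < t ->
  t * ddiff i x <= h (x + t *: e3 i) + h (x - t *: e3 i) - 2 * h x.
Proof.
move=> t0; rewrite mulrC -ler_pdivlMr//.
have := pd_le sh x (e3 i) t0; have := pd_le sh x (- e3 i) t0.
by rewrite /ddiff /dquot scalerN; lra.
Qed.

(** A 1-Lipschitz cut-off supported in the ball of radius 1/2: shifts by at most 1/2 keep its
    support inside [cube3]. *)
Let chi (x : V) : R := Num.max 0 (2^-1 - enorm x).

Let chi_ge0 x : 0 <= chi x. Proof. by rewrite /chi le_max lexx. Qed.

Let chi_le x : chi x <= 1.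
Proof. by rewrite /chi ge_max ler01/=; have := enorm_ge0 x; lra. Qed.

Let chi_supp x : 2^-1 <= enorm x -> chi x = 0.
Proof. by move=> x2; apply/max_idPl; lra. Qed.

Let chi_lip x y : `|chi x - chi y| <= enorm (x - y).
Proof.
apply: le_trans (ler_dist_enorm x y).
by rewrite /chi; case: (leP 0 _) => a; case: (leP 0 _) => b; rewrite ler_norml;
  case: (ger0P (enorm x - enorm y)) => c; apply/andP; split; lra.
Qed.

Let chi_continuous : continuous chi.
Proof.
apply: (@enorm_lipschitz_continuous _ _ 1) => x y.
by rewrite mul1r (le_trans (ler_norm _)).
Qed.

Let dshift i t p : R3 R := (1 * p.1.1 + t * e3 i 0 0, 1 * p.1.2 + t * e3 i 0 1,
  1 * p.2 + t * e3 i 0 2%:R).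

Let vec3_dshift i t p : vec3 (dshift i t p) = vec3 p + t *: e3 i.
Proof. by apply: rV3P; rewrite !mxE /= ?mxE !mul1r. Qed.

Let enorm_e3 i t : 0 <= t -> enorm (t *: e3 i : V) = t.
Proof. by move=> t0; rewrite enormZ enorm_e3 mulr1 ger0_norm. Qed.

Let hsub_le i t x : 0 <= t -> `|h (x + t *: e3 i) - h x| <= L * t.
Proof. by move=> t0; rewrite (le_trans (hL _ _))// addrC addKr enorm_e3. Qed.

Let ddiff_le i x : ddiff i x <= 2 * L.
Proof.
have := hsub_le i x (ler01 : 0 <= 1 :> R).
have := hsub_le i (x - 1 *: e3 i) (ler01 : 0 <= 1 :> R); rewrite subrK.
have := ddiff_le_quot i x (ltr01 : 0 < 1 :> R).
by rewrite !ler_norml => a /andP[b1 b2] /andP[c1 c2]; lra.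
Qed.

Let chi_out p : ~ cube3 p -> chi (vec3 p) = 0.
Proof.
move=> cp; apply: chi_supp; rewrite leNgt; apply/negP => lt; apply: cp.
by apply: enorm_cube3; lra.
Qed.

Let chi_shift_out i t p : 0 <= t -> t <= 2^-1 -> ~ cube3 p ->
  chi (vec3 p + t *: e3 i) = 0.
Proof.
move=> t0 t2 cp; apply: chi_supp; rewrite leNgt; apply/negP => lt; apply: cp.
apply: enorm_cube3; have := ler_enormB (vec3 p + t *: e3 i) (t *: e3 i).
by rewrite addrK enorm_e3//; lra.
Qed.

Let measurable_comp_h (F : R3 R -> V) : (forall i, measurable_fun setT (fun p => F p 0 i)) ->
  measurable_fun setT (fun p => h (F p)).
Proof. by move=> mF; apply: measurable_comp_continuous => //; exact: sublinear_continuous. Qed.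

Let measurable_vec3_shift v i : measurable_fun setT (fun p : R3 R => (vec3 p + v) 0 i).
Proof.
under eq_fun do rewrite mxE.
by apply: measurable_funD; [exact: measurable_vec3_coord|exact: measurable_cst].
Qed.

Let measurable_h_shift v : measurable_fun setT (fun p : R3 R => h (vec3 p + v)).
Proof. by apply: measurable_comp_h => j; exact: measurable_vec3_shift. Qed.

Let measurable_chi_shift v : measurable_fun setT (fun p : R3 R => chi (vec3 p + v)).
Proof.
apply: measurable_comp_continuous; last exact: chi_continuous.
by move=> j; exact: measurable_vec3_shift.
Qed.

Let measurable_chi : measurable_fun setT (fun p : R3 R => chi (vec3 p)).
Proof. by apply: measurable_vec3_comp; exact: chi_continuous. Qed.

Let measurable_h : measurable_fun setT (fun p : R3 R => h (vec3 p)).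
Proof. by apply: measurable_vec3_comp; exact: sublinear_continuous. Qed.

Let integrable_chi_ddiff i :
  leb3.-integrable setT (EFin \o (fun p => chi (vec3 p) * ddiff i (vec3 p))).
Proof.
apply: (@cube3_integrable _ (2 * L)).
- apply: measurable_funM; first exact: measurable_chi.
  by apply: measurable_ddiff => j; exact: measurable_vec3_coord.
- move=> p; rewrite normrM !ger0_norm ?ddiff_ge0//.
  have := ddiff_le i (vec3 p); have := ddiff_ge0 i (vec3 p).
  by have := chi_ge0 (vec3 p); have := chi_le (vec3 p); nra.
- by move=> p /chi_out ->; rewrite mul0r.
Qed.

(* Discrete integration by parts: moving one difference from [h] to the
   Lipschitz cut-off [chi] gains a factor [t]. *)
Let chi_ddiff_le i t : 0 < t -> t <= 2^-1 ->
  t * \int[leb3]_p (chi (vec3 p) * ddiff i (vec3 p)) <= t ^+ 2 * L * fine (leb3 (@cube3 R)).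
Proof.
move=> t0 t2; have t0' := ltW t0; set v : V := t *: e3 i.
pose A p := chi (vec3 p) * (h (vec3 p + v) - h (vec3 p)).
pose B p := chi (vec3 p) * (h (vec3 p) - h (vec3 p - v)).
pose B' p := chi (vec3 p + v) * (h (vec3 p + v) - h (vec3 p)).
have mA : measurable_fun setT A.
  exact: (measurable_funM measurable_chi (measurable_funB (measurable_h_shift v) measurable_h)).
have mB : measurable_fun setT B.
  exact: (measurable_funM measurable_chi (measurable_funB measurable_h (measurable_h_shift (- v)))).
have mB' : measurable_fun setT B'.
  exact: (measurable_funM (measurable_chi_shift v) (measurable_funB (measurable_h_shift v) measurable_h)).
have bd (x y : V) : `|h (x + v) - h x| <= L * t by exact: hsub_le.
have bd1 (a b : R) : 0 <= a -> a <= 1 -> `|b| <= L * t -> `|a * b| <= L * t.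
  by move=> a0 a1 b1; rewrite normrM (ger0_norm a0) (le_trans _ b1)// ler_piMl.
have iA : leb3.-integrable setT (EFin \o A).
  apply: (@cube3_integrable _ (L * t)) => //.
    by move=> p; apply: bd1 => //; exact: hsub_le.
  by move=> p cp; rewrite /A chi_out// mul0r.
have iB : leb3.-integrable setT (EFin \o B).
  apply: (@cube3_integrable _ (L * t)) => //.
    move=> p; apply: bd1 => //; have := hsub_le i (vec3 p - v) t0'.
    by rewrite subrK.
  by move=> p cp; rewrite /B chi_out// mul0r.
have iB' : leb3.-integrable setT (EFin \o B').
  apply: (@cube3_integrable _ (L * t)) => //.
    by move=> p; apply: bd1 => //; exact: hsub_le.
  by move=> p cp; rewrite /B' chi_shift_out// mul0r.
have EB : \int[leb3]_p B p = \int[leb3]_p B' p.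
  have n1 : `|1 : R| = 1 by rewrite normr1.
  have P := lebesgue3_preserving_affine (t * e3 i 0 0) (t * e3 i 0 1) (t * e3 i 0 2%:R) n1 n1 n1.
  have E := Rintegral_preserving P measurableT mB.
  rewrite E preimage_setT; congr (Rintegral _ _ _); apply/funext => p.
  by rewrite /B /B' -[(_, _, _)]/(dshift i t p) vec3_dshift addrK.
have E1 := @RintegralB _ _ _ leb3 setT A B' measurableT iA iB'.
have E2 := @RintegralZl _ _ _ leb3 setT _ t measurableT (integrable_chi_ddiff i).
have E3 := @RintegralB _ _ _ leb3 setT A B measurableT iA iB.
rewrite -E2; apply: (@le_trans _ _ (\int[leb3]_p (A p - B p))).
  apply: le_Rintegral.
  - exact: measurableT.
  - exact: (@integrableZl _ _ _ leb3 setT measurableT t _ (integrable_chi_ddiff i)).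
  - exact: (@integrableB _ _ _ leb3 setT measurableT _ _ iA iB).
  - move=> p _; rewrite mulrCA -mulrBr ler_wpM2l//.
    have := ddiff_le_quot i (vec3 p) t0; rewrite -/v => H.
    by apply: le_trans H _; rewrite le_eqVlt; apply/orP; left; apply/eqP; ring.
rewrite E3 EB -E1; apply: cube3_le.
- exact: (measurable_funB mA mB').
- move=> p; rewrite /A /B' -mulrBl (le_trans (ler_norm _))// normrM.
  have -> : t ^+ 2 * L = t * (L * t) by rewrite expr2 -mulrA [t * L]mulrC.
  rewrite ler_pM ?normr_ge0//; last exact: hsub_le.
  by rewrite distrC (le_trans (chi_lip _ _))// addrC addKr enorm_e3.
- by move=> p cp; rewrite /A /B' chi_out// chi_shift_out// !mul0r subrr.
- exact: (@integrableB _ _ _ leb3 setT measurableT _ _ iA iB').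
Qed.

(** Divided by [t], the previous bound makes the integral at most a constant times [t] for every
    small [t], hence 0; the integrand is nonnegative. *)
Let ae_ddiff i : {ae leb3, forall p, chi (vec3 p) * ddiff i (vec3 p) = 0}.
Proof.
set F := fun p => chi (vec3 p) * ddiff i (vec3 p).
have F0 p : 0 <= F p by rewrite mulr_ge0// ddiff_ge0.
have mF : measurable_fun setT F.
  apply: (measurable_funM measurable_chi).
  by apply: measurable_ddiff => j; exact: measurable_vec3_coord.
have I0 : \int[leb3]_p F p = 0.
  apply/eqP; rewrite eq_le Rintegral_ge0// andbT.
  apply/ler_addgt0Pr => e e0; rewrite add0r.
  set K := L * fine (leb3 (@cube3 R)).
  have K0 : 0 <= K by rewrite mulr_ge0 ?(ltW L0)// fine_ge0.
  have K1 : 0 < K + 1 by rewrite ltr_wpDl.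
  set t := Num.min 2^-1 (e / (K + 1)).
  have t0 : 0 < t by rewrite lt_min invr_gt0 ltr0n divr_gt0.
  have t2 : t <= 2^-1 by rewrite ge_min lexx.
  have te : t * (K + 1) <= e by rewrite -ler_pdivlMr// ge_min lexx orbT.
  have := chi_ddiff_le i t0 t2; rewrite expr2 -!mulrA ler_pM2l//.
  by rewrite -/K => H; rewrite (le_trans H)//; nra.
have := @ae_eq_integral_abs _ _ _ leb3 setT measurableT (EFin \o F).
have mF' : measurable_fun setT (EFin \o F) by exact/measurable_EFinP.
move=> /(_ mF')[/(_ _)]; have -> : (\int[leb3]_p `|(EFin \o F) p| = 0)%E.
  transitivity (\int[leb3]_p (F p)%:E)%E.
    by apply: eq_integral => p _; rewrite gee0_abs// lee_fin.
  have fi := @integrable_fin_num _ _ _ leb3 setT measurableT _ (integrable_chi_ddiff i).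
  by rewrite -(fineK fi); congr (_ %:E).
move=> /(_ erefl) H _; move: H; apply: filterS => p /(_ I) /=; rewrite /F.
by move=> [].
Qed.

(** The gap is 0-homogeneous, so the cone over the bad directions is bad as well. The cone is cut at
    radius 1/4, where the cut-off is positive, and its volume is a multiple of the measure of its
    trace on the sphere. *)
Lemma ddiff_sphere_negligible i : sigma [set u : S2 R | ddiff i (\val u) != 0] = 0%E.
Proof.
set Bad := [set u | _].
have mBad : measurable Bad.
  have -> : Bad = setT `&` (fun u : S2 R => ddiff i (\val u)) @^-1` (~` [set 0]).
    by rewrite setTI; apply/seteqP; split => u /= /eqP.
  have H : measurable_fun setT (fun u : S2 R => ddiff i (\val u)).
    by apply: measurable_ddiff; exact: measurable_val_coord.
  by apply: H => //; exact/measurableC.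
have q0 : 0 < 4^-1 :> R by rewrite invr_gt0.
have Z : leb3 (cone 4^-1 Bad) = 0%E.
  apply: measure_negligible; first exact: measurable_cone.
  apply: negligibleS (ae_ddiff i) => p [/andP[p0 p4]]; rewrite /Bad/= => b.
  have pn0 : vec3 p != 0 by rewrite -enorm_gt0.
  rewrite val_sdir_neq0// /ddiff !pd_scale ?invr_gt0// -/(ddiff i (vec3 p)) in b.
  move=> /eqP; rewrite mulf_eq0 (negbTE b) orbF => /eqP.
  rewrite /chi => H; have : 2^-1 - enorm (vec3 p) <= 0 by rewrite -H le_max lexx orbT.
  by lra.
have := cone_scale mBad q0; rewrite Z sigmaE => /esym/eqP.
rewrite mule_eq0 => /orP[|/eqP ->]; last by rewrite mule0.
by rewrite eqe expf_eq0/= gt_eqF.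
Qed.

End hext_smooth_ae.

(** * Limits and symmetries of integrals over the six-dimensional ball *)

Section negligible6.
Context {R : realType}.

(** Inside the ball the bad set is covered by two cylinders [A x R^3], over the origin and over the
    cone on [B], both with a null base. *)
Lemma negligible6_sphere (B : set (S2 R)) : measurable B -> sigma B = 0%E ->
  (@lebesgue6 R).-negligible
    (@ball6 R `&` [set z | vec3 z.1 = 0 \/ B (sdir (vec3 z.1))]).
Proof.
move=> mB B0; pose O : set (R3 R) := [set p | vec3 p = 0].
have mO : measurable O.
  have -> : O = setT `&` (fun p => enorm (vec3 p)) @^-1` [set 0].
    rewrite setTI; apply/seteqP; split => p /=; first by move=> ->; rewrite enorm0.
    by move=> /eqP; rewrite enorm_eq0 => /eqP.
  by apply: measurable_enorm_vec3.
have Z (A : set (R3 R)) : measurable A -> lebesgue3 A = 0%E ->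
    (@lebesgue6 R).-negligible (A `*` setT).
  move=> mA A0; apply/negligibleP; first exact: measurableX.
  have E := @product_measure1E _ _ _ _ _ (@lebesgue3 R) (@lebesgue3 R) A setT mA measurableT.
  suff : (@lebesgue3 R \x @lebesgue3 R)%E (A `*` setT) = 0%E by [].
  apply: (etrans E); apply/eqP; rewrite mule_eq0; apply/orP; left.
  by apply/eqP; exact: A0.
have C0 : lebesgue3 (cone 1 B) = 0%E.
  move: B0; rewrite sigmaE => /eqP; rewrite mule_eq0 => /orP[|/eqP//].
  by rewrite eqe pnatr_eq0.
have := negligibleU (Z _ mO (negligible_origin)) (Z _ (measurable_cone 1 mB) C0).
apply: negligibleS => z [bz] [z0|Bz]; first by left.
have [z0|z0] := eqVneq (vec3 z.1) 0; first by left.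
by right; split => //; split => //; rewrite enorm_gt0 z0 (ball6_enorm bz).1.
Qed.

End negligible6.

Section int6_more.
Context {R : realType}.
Local Notation R6 := (R3 R * R3 R)%type.
Implicit Types (F G : R6 -> R).

Lemma int6_cvg (Fn : nat -> R6 -> R) F (M : R) (Z : set R6) :
  (forall n, measurable_fun setT (Fn n)) -> measurable_fun setT F ->
  (forall n z, ball6 z -> `|Fn n z| <= M) ->
  (@lebesgue6 R).-negligible (@ball6 R `&` Z) ->
  (forall z, ball6 z -> ~ Z z -> Fn n z @[n --> \oo] --> F z) ->
  int6 (Fn n) @[n --> \oo] --> int6 F.
Proof.
move=> mFn mF FM nZ FF.
have mFn' n : measurable_fun (@ball6 R) (EFin \o Fn n).
  by apply: measurable_funTS; apply/measurable_EFinP; exact: mFn.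
have mF' : measurable_fun (@ball6 R) (EFin \o F).
  by apply: measurable_funTS; apply/measurable_EFinP; exact: mF.
have ae1 : {ae @lebesgue6 R, forall z, ball6 z -> (EFin \o Fn n) z @[n --> \oo] --> (EFin \o F) z}.
  apply: negligibleS nZ => z /= /not_implyP[bz H]; split => //.
  have [//|Zz] := pselect (Z z); exfalso; apply: H.
  by apply: cvg_EFin; [exact: nearW|exact: FF].
have iM : (@lebesgue6 R).-integrable (@ball6 R) (EFin \o (fun=> M)).
  apply: bd6_integrable; split; first exact: measurable_cst.
  by exists `|M| => z _.
have ae2 : {ae @lebesgue6 R, forall z, forall n, ball6 z -> (`|(EFin \o Fn n) z| <= (EFin \o (fun=> M)) z)%E}.
  by apply: aeW => z n bz /=; rewrite lee_fin; exact: FM.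
have [iF _ H] := @dominated_convergence _ _ _ (@lebesgue6 R) (@ball6 R) (@measurable_ball6 R)
  _ _ _ mFn' mF' ae1 iM ae2.
apply: (@fine_cvg _ _ _ _ (fun n => \int[@lebesgue6 R]_(z in @ball6 R) (Fn n z)%:E)%E).
have fi := @integrable_fin_num _ _ _ (@lebesgue6 R) (@ball6 R) (@measurable_ball6 R) _ iF.
have E : (int6 F)%:E = (\int[@lebesgue6 R]_(z in @ball6 R) (F z)%:E)%E by exact: (fineK fi).
by rewrite E; exact: H.
Qed.

Lemma int6_snd (T : R3 R -> R3 R) F :
  measure_preserving (@lebesgue3 R) (@lebesgue3 R) T ->
  (forall q, dotp (vec3 (T q)) (vec3 (T q)) = dotp (vec3 q) (vec3 q)) ->
  measurable_fun setT F -> int6 (fun z => F (z.1, T z.2)) = int6 F.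
Proof.
move=> PT dT mF.
have mT : measurable_fun setT (fun z : R6 => T z.2).
  exact: (measurableT_comp PT.1 measurable_snd).
have P := @measure_preserving_shear2 _ _ _ _ _ (@lebesgue3 R) (@lebesgue3 R) _ mT (fun _ => PT).
have E := Rintegral_preserving P (@measurable_ball6 R) (measurable_funTS mF).
rewrite /int6 /lebesgue6 E.
suff -> : (fun z : R6 => (z.1, T z.2)) @^-1` @ball6 R = @ball6 R by [].
by apply/seteqP; split => z; rewrite /ball6/= dT.
Qed.

Lemma bd6_coord2 (i : 'I_3) : bd6 (fun z : R6 => vec3 z.2 0 i).
Proof.
split; first exact: (measurableT_comp (measurable_vec3_coord _) measurable_snd).
exists 1 => z /ball6_enorm[_ H]; exact: le_trans (norm_coord_le_enorm _ _) H.
Qed.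

Variable phi : R3 R -> R.
Hypothesis bphi : bd6 (fun z : R6 => phi z.1).

Let c2 i (z : R6) := vec3 z.2 0 i.

Let b2 i j : bd6 (fun z : R6 => phi z.1 * (c2 i z * c2 j z)).
Proof. by apply: bd6M bphi (bd6M (bd6_coord2 i) (bd6_coord2 j)). Qed.

Let n1 : `|1 : R| = 1. Proof. exact: normr1. Qed.
Let nN1 : `|-1 : R| = 1. Proof. by rewrite normrN normr1. Qed.

Let int6_anti F (T : R3 R -> R3 R) :
  measure_preserving (@lebesgue3 R) (@lebesgue3 R) T ->
  (forall q, dotp (vec3 (T q)) (vec3 (T q)) = dotp (vec3 q) (vec3 q)) ->
  bd6 F -> (forall z, F (z.1, T z.2) = - F z) -> int6 F = 0.
Proof.
move=> PT dT bF FT; have := int6_snd PT dT bF.1.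
have -> : (fun z => F (z.1, T z.2)) = -1 \*o F.
  by apply/funext => z /=; rewrite FT mulN1r.
by rewrite int6Z// mulN1r => H; lra.
Qed.

Let flip1 := lebesgue3_preserving_affine 0 0 0 nN1 n1 n1.
Let flip2 := lebesgue3_preserving_affine 0 0 0 n1 nN1 n1.

(** Reflecting one of two distinct coordinates of [y] changes the sign of the integrand. Reflections
    of the first two coordinates suffice, since two distinct indices cannot both be the last one. *)
Lemma int6_coord_offdiag i j : i != j -> int6 (fun z : R6 => phi z.1 * (c2 i z * c2 j z)) = 0.
Proof.
have d1 (q : R3 R) : dotp (vec3 (-1 * q.1.1 + 0, 1 * q.1.2 + 0, 1 * q.2 + 0))
    (vec3 (-1 * q.1.1 + 0, 1 * q.1.2 + 0, 1 * q.2 + 0)) = dotp (vec3 q) (vec3 q).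
  by rewrite !dotp3E !vec3_coord /=; ring.
have d2 (q : R3 R) : dotp (vec3 (1 * q.1.1 + 0, -1 * q.1.2 + 0, 1 * q.2 + 0))
    (vec3 (1 * q.1.1 + 0, -1 * q.1.2 + 0, 1 * q.2 + 0)) = dotp (vec3 q) (vec3 q).
  by rewrite !dotp3E !vec3_coord /=; ring.
have [] : or3 ((i == 0) || (j == 0)) ((i == 1) || (j == 1)) ((i == 2%:R) && (j == 2%:R)).
- by case: i => -[|[|[|//]]] ?; case: j => -[|[|[|//]]] ?; [constructor 1|constructor 1|constructor 1|
   constructor 1|constructor 2|constructor 2|constructor 1|constructor 2|constructor 3].
- move=> ij0 ij; apply: (int6_anti flip1 d1 (b2 i j)) => z; rewrite /c2 /=.
  move: ij0 ij; case: i => -[|[|[|//]]] ?; case: j => -[|[|[|//]]] ? //= _ _;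
  rewrite !mxE /=; ring.
- move=> ij0 ij; apply: (int6_anti flip2 d2 (b2 i j)) => z; rewrite /c2 /=.
  move: ij0 ij; case: i => -[|[|[|//]]] ?; case: j => -[|[|[|//]]] ? //= _ _;
  rewrite !mxE /=; ring.
- by move=> /andP[/eqP -> /eqP ->]; rewrite eqxx.
Qed.

(** Transpositions of the coordinates of [y] make the three integrals equal, and they add up to the
    one with [|y|^2]. *)
Lemma int6_coord_diag i : int6 (fun z : R6 => phi z.1 * (c2 i z * c2 i z)) =
  3^-1 * int6 (fun z : R6 => phi z.1 * dotp (vec3 z.2) (vec3 z.2)).
Proof.
have d1 (q : R3 R) : dotp (vec3 (q.1.2, q.1.1, q.2)) (vec3 (q.1.2, q.1.1, q.2)) =
    dotp (vec3 q) (vec3 q).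
  by rewrite !dotp3E !vec3_coord /=; ring.
have d2 (q : R3 R) : dotp (vec3 (q.1.1, q.2, q.1.2)) (vec3 (q.1.1, q.2, q.1.2)) =
    dotp (vec3 q) (vec3 q).
  by rewrite !dotp3E !vec3_coord /=; ring.
have e1 := int6_snd (lebesgue3_preserving_swap12) d1 (b2 0 0).1.
have e2 := int6_snd (lebesgue3_preserving_swap23) d2 (b2 1 1).1.
have E1 : int6 (fun z : R6 => phi z.1 * (c2 1 z * c2 1 z)) =
    int6 (fun z : R6 => phi z.1 * (c2 0 z * c2 0 z)).
  by rewrite -e1; congr int6; apply/funext => z; rewrite /c2 !vec3_coord.
have E2 : int6 (fun z : R6 => phi z.1 * (c2 2%:R z * c2 2%:R z)) =
    int6 (fun z : R6 => phi z.1 * (c2 1 z * c2 1 z)).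
  by rewrite -e2; congr int6; apply/funext => z; rewrite /c2 !vec3_coord.
have S : int6 (fun z : R6 => phi z.1 * dotp (vec3 z.2) (vec3 z.2)) =
    3 * int6 (fun z : R6 => phi z.1 * (c2 0 z * c2 0 z)).
  have -> : (fun z : R6 => phi z.1 * dotp (vec3 z.2) (vec3 z.2)) =
      (fun z : R6 => phi z.1 * (c2 0 z * c2 0 z)) \+
      ((fun z : R6 => phi z.1 * (c2 1 z * c2 1 z)) \+
      (fun z : R6 => phi z.1 * (c2 2%:R z * c2 2%:R z))).
    by apply/funext => z; rewrite /c2 dotp3E /=; ring.
  have H1 := bd6D (b2 1 1) (b2 2%:R 2%:R).
  rewrite (int6D (b2 0 0) H1) (int6D (b2 1 1) (b2 2%:R 2%:R)) E2 E1; ring.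
have H0 : int6 (fun z : R6 => phi z.1 * (c2 i z * c2 i z)) =
    int6 (fun z : R6 => phi z.1 * (c2 0 z * c2 0 z)).
  case: i => -[|[|[|//]]] Hi.
  - by rewrite (_ : Ordinal Hi = 0)//; exact: val_inj.
  - by rewrite (_ : Ordinal Hi = 1)//; exact: val_inj.
  - by rewrite (_ : Ordinal Hi = 2%:R) ?E2//; exact: val_inj.
by rewrite H0 S mulKf ?pnatr_eq0.
Qed.

End int6_more.

Section isotropy.
Context {R : realType}.
Local Notation R6 := (R3 R * R3 R)%type.

(* Reflections and permutations of the coordinates of the second factor average
   the quadratic form [(W . y)^2] to [|W|^2 |y|^2 / 3]. *)
Lemma int6_isotropy (W : R3 R -> 'rV[R]_3) :
  (forall i, bd6 (fun z : R6 => W z.1 0 i)) ->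
  int6 (fun z : R6 => dotp (W z.1) (vec3 z.2) ^+ 2) =
  3^-1 * int6 (fun z : R6 => dotp (W z.1) (W z.1) * dotp (vec3 z.2) (vec3 z.2)).
Proof.
move=> bW.
pose w (i j : 'I_3) (p : R3 R) := W p 0 i * W p 0 j.
have bw i j : bd6 (fun z : R6 => w i j z.1) by exact: bd6M (bW i) (bW j).
pose T i j (z : R6) := w i j z.1 * (vec3 z.2 0 i * vec3 z.2 0 j).
have bT i j : bd6 (T i j) by apply: bd6M (bw i j) (bd6M (bd6_coord2 i) (bd6_coord2 j)).
pose U i (z : R6) := w i i z.1 * dotp (vec3 z.2) (vec3 z.2).
have bU i : bd6 (U i) by apply: bd6M (bw i i) (@bd6_sqnorm R).2.
have TU i : int6 (T i i) = 3^-1 * int6 (U i) by apply: int6_coord_diag; exact: bw.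
have T0 i j : i != j -> int6 (T i j) = 0 by apply: int6_coord_offdiag; exact: bw.
have -> : (fun z : R6 => dotp (W z.1) (vec3 z.2) ^+ 2) =
    (T 0 0 \+ (T 1 1 \+ T 2%:R 2%:R)) \+ 2 \*o (T 0 1 \+ (T 0 2%:R \+ T 1 2%:R)).
  by apply/funext => z; rewrite /T /w dotp3E /=; ring.
have -> : (fun z : R6 => dotp (W z.1) (W z.1) * dotp (vec3 z.2) (vec3 z.2)) =
    U 0 \+ (U 1 \+ U 2%:R).
  by apply/funext => z; rewrite /U /w (dotp3E (W _)) /=; ring.
have b1 := bd6D (bT 1 1) (bT 2%:R 2%:R); have b2 := bd6D (bT 0 2%:R) (bT 1 2%:R).
have b3 := bd6D (bT 0 1) b2; have b4 := bd6D (bT 0 0) b1; have b5 := bd6Z 2 b3.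
have b6 := bd6D (bU 1) (bU 2%:R).
rewrite (int6D b4 b5) (int6D (bT 0 0) b1) (int6D (bT 1 1) (bT 2%:R 2%:R)).
rewrite (int6Z 2 b3) (int6D (bT 0 1) b2) (int6D (bT 0 2%:R) (bT 1 2%:R)).
rewrite (int6D (bU 0) b6) (int6D (bU 1) (bU 2%:R)) !TU !T0//; ring.
Qed.

End isotropy.

Lemma sublinear_lipschitz (R : realType) (h : 'rV[R]_3 -> R) : sublinear h ->
  exists2 L, 0 < L & (forall x y, `|h x - h y| <= L * enorm (x - y)) /\
    forall x, `|h x| <= L * enorm x.
Proof.
move=> sh; have [L L0 hL] := sublinear_bound sh; exists L => //.
have H x y : h x - h y <= L * enorm (x - y).
  by rewrite lerBlDr (le_trans _ (lerD (hL _) (lexx _)))// -{1}(subrK y x) sh.1.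
have H1 x y : `|h x - h y| <= L * enorm (x - y).
  by rewrite ler_norml H andbT lerNl opprB enormB.
by split=> // x; have := H1 x 0; rewrite sublinear0// !subr0.
Qed.

(** * The tangential gradient and the gradient of the homogeneous extension *)

Section gradient.
Context {R : realType}.
Local Notation V := 'rV[R]_3.
Variable g : S2 R -> R.
Hypothesis Cg : calC g.

Let h := hext g.
Let sh : sublinear h. Proof. by have [_ []] := (calCP g).1 Cg. Qed.

Definition rough : set (S2 R) := [set u | exists i, ddiff h i (\val u) != 0].

Let mdd i : measurable_fun setT (fun u : S2 R => ddiff h i (\val u)).
Proof. by apply: (measurable_ddiff sh); exact: measurable_val_coord. Qed.

Let mddset i : measurable [set u : S2 R | ddiff h i (\val u) != 0].
Proof.
have -> : [set u : S2 R | ddiff h i (\val u) != 0] =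
    setT `&` (fun u : S2 R => ddiff h i (\val u)) @^-1` (~` [set 0]).
  by rewrite setTI; apply/seteqP; split => u /= /eqP.
by apply: mdd => //; exact/measurableC.
Qed.

Let roughE : rough = \bigcup_(i in [set: 'I_3]) [set u : S2 R | ddiff h i (\val u) != 0].
Proof. by apply/seteqP; split => u [i]; [exists i|exists i]. Qed.

Lemma measurable_rough : measurable rough.
Proof. by rewrite roughE; apply: fin_bigcup_measurable => // i _; exact: mddset. Qed.

Lemma rough_negligible : sigma rough = 0%E.
Proof.
have [L L0 [hL _]] := sublinear_lipschitz sh.
apply: measure_negligible; first exact: measurable_rough.
rewrite roughE; have -> : \bigcup_(i in [set: 'I_3]) [set u : S2 R | ddiff h i (\val u) != 0] =
    [set u : S2 R | ddiff h 0 (\val u) != 0] `|`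
    ([set u : S2 R | ddiff h 1 (\val u) != 0] `|`
    [set u : S2 R | ddiff h 2%:R (\val u) != 0]).
  apply/seteqP; split => u.
    move=> [i _] /=; case: i => -[|[|[|//]]] Hi H.
    - by left; rewrite (_ : 0 = Ordinal Hi)//; exact: val_inj.
    - by right; left; rewrite (_ : 1 = Ordinal Hi)//; exact: val_inj.
    - by right; right; rewrite (_ : 2%:R = Ordinal Hi)//; exact: val_inj.
  by case=> [H|[H|H]]; [exists 0|exists 1|exists 2%:R].
have N i := iffRL (negligibleP (@sigma R) (mddset i)) (ddiff_sphere_negligible sh L0 hL i).
by apply: negligibleU => //; apply: negligibleU.
Qed.

Lemma smooth_notin_rough (x : V) : x != 0 -> ~ rough (sdir x) -> smooth_at h x.
Proof.
move=> x0 nr i; apply/eqP/negPn/negP => H; apply: nr; exists i.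
by rewrite val_sdir_neq0// /ddiff !pd_scale ?invr_gt0 ?enorm_gt0.
Qed.

Let val_neq0 (u : S2 R) : \val u != 0 :> V.
Proof. by rewrite -enorm_gt0 enorm_S2. Qed.

Let pd_enorm_sym (x v : V) : x != 0 -> pd (@enorm R) x v + pd (@enorm R) x (- v) = 0.
Proof. by move=> x0; rewrite !pd_enorm// dotpNr mulNr subrr. Qed.

(** The quotient rule at the level of difference quotients: off the origin [g o sdir + 1/2] is [h]
    divided by the norm. *)
Let hquot (u : S2 R) (v : V) (t : R) : \val u + t *: v != 0 ->
  t^-1 *: (((g \o @sdir R) \o shift (\val u)) (t *: v) - (g \o @sdir R) (\val u)) =
  (dquot h (\val u) v t - h (\val u) * dquot (@enorm R) (\val u) v t) / enorm (\val u + t *: v).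
Proof.
move=> n0 /=; rewrite [t *: v + _]addrC sdir_val /dquot enorm_S2.
have e0 : 0 < enorm (\val u + t *: v) by rewrite enorm_gt0.
have hE x : h x = enorm x * (g (sdir x) + 2^-1) by [].
rewrite (hE (_ + _)) (hE (\val u)) enorm_S2 sdir_val.
have [->|t0] := eqVneq t 0; first by rewrite invr0 scale0r !mulr0 subrr mul0r.
by rewrite -[_ *: _]/(_ * _); field; rewrite gt_eqF.
Qed.

Let enorm_cvg1 (u : S2 R) (v : V) : enorm (\val u + t *: v) @[t --> (0:R)^'] --> (1 : R).
Proof.
rewrite -(enorm_S2 u); apply/cvgrPdist_le => e e0.
have v1 : 0 < enorm v + 1 by rewrite ltr_wpDl// enorm_ge0.
apply/nbhs_ballP; exists (e / (enorm v + 1)); first by rewrite /= divr_gt0.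
move=> t; rewrite /ball/= sub0r normrN => te _.
rewrite (le_trans (ler_dist_enorm _ _))// opprD addrA subrr sub0r enormN enormZ.
move/ltW : te; rewrite ler_pdivlMr//; apply: le_trans.
by rewrite ler_wpM2l// lerDl.
Qed.

Let near_neq0 (u : S2 R) (v : V) : \forall t \near (0:R)^', \val u + t *: v != 0.
Proof.
have h2 : (2^-1 : R) < 1 by lra.
have : \forall t \near (0:R)^', 2^-1 < enorm (\val u + t *: v).
  by apply: (cvgr_gt 1) => //; exact: enorm_cvg1.
by apply: filterS => t H; rewrite -enorm_gt0 (lt_trans _ H)// invr_gt0.
Qed.

(** Where the right and left derivatives of [h] differ, the limit that defines the derivative fails
    and evaluates to [point]. Having the exact value everywhere gives measurability and boundedness
    of the gradient without discarding a null set. *)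
Lemma sgradE u i : sgrad g u 0 i =
  if ddiff h i (\val u) == 0 then pd h (\val u) (e3 i) - h (\val u) * \val u 0 i
  else point.
Proof.
rewrite mxE -/(e3 i) /derive; set q := fun t : R => t^-1 *: _.
have qE : \forall t \near (0:R)^', (dquot h (\val u) (e3 i) t - h (\val u) * dquot (@enorm R) (\val u) (e3 i) t)
    / enorm (\val u + t *: e3 i) = q t.
  by apply: filterS (near_neq0 u (e3 i)) => t n0; rewrite /q hquot.
have cE := dquot_cvg sublinear_enorm (pd_enorm_sym (e3 i) (val_neq0 u)).
rewrite pd_enorm// enorm_S2 divr1 dotp_e3 in cE.
have c1 := @enorm_cvg1 u (e3 i).
case: ifPn => [/eqP d0|dn0].
  apply/cvg_lim => //.
  apply: cvg_trans (near_eq_cvg qE) _.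
  have c2 : dquot h (\val u) (e3 i) t - h (\val u) * dquot (@enorm R) (\val u) (e3 i) t
      @[t --> 0^'] --> pd h (\val u) (e3 i) - h (\val u) * \val u 0 i.
    by apply: cvgB; [exact: (dquot_cvg sh d0)|apply: cvgM cE; exact: cvg_cst].
  have c3 : (enorm (\val u + t *: e3 i))^-1 @[t --> (0:R)^'] --> (1^-1 : R).
    by apply: cvgV; [exact: oner_neq0|exact: c1].
  have -> : pd h (\val u) (e3 i) - h (\val u) * \val u 0 i =
    (pd h (\val u) (e3 i) - h (\val u) * \val u 0 i) * 1^-1 by rewrite invr1 mulr1.
  by apply: cvgM; [exact: c2|exact: c3].
(* If the quotients of [g o sdir] converged, solving for those of [h] would make them converge too,
   against the gap. *)
apply: dvgP => cq; move/eqP : dn0; apply; apply: (dquot_cvg_smooth sh).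
have qE' : \forall t \near (0:R)^', q t * enorm (\val u + t *: e3 i) +
    h (\val u) * dquot (@enorm R) (\val u) (e3 i) t = dquot h (\val u) (e3 i) t.
  near=> t; have <- : (dquot h (\val u) (e3 i) t - h (\val u) * dquot (@enorm R) (\val u) (e3 i) t)
    / enorm (\val u + t *: e3 i) = q t by near: t.
  have n0 : \val u + t *: e3 i != 0 by near: t; exact: near_neq0.
  by rewrite divfK ?subrK// gt_eqF// enorm_gt0.
have H : q t * enorm (\val u + t *: e3 i) + h (\val u) * dquot (@enorm R) (\val u) (e3 i) t
    @[t --> (0:R)^'] --> (lim (q t @[t --> (0:R)^']) : R) * 1 + h (\val u) * \val u 0 i.
  apply: cvgD; last by apply: cvgM cE; exact: cvg_cst.
  by apply: cvgM; [exact: cq|exact: c1].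
by apply: cvgP; exact: (cvg_trans (near_eq_cvg qE') H).
Unshelve. all: by end_near. Qed.

Lemma measurable_sgrad i : measurable_fun setT (fun u => sgrad g u 0 i).
Proof.
under eq_fun do rewrite sgradE.
apply: measurable_fun_ifT.
- exact: (measurable_fun_eqr (mdd i) (measurable_cst _)).
- apply: measurable_funB; first by apply: (measurable_pd sh); exact: measurable_val_coord.
  apply: measurable_funM; last exact: measurable_val_coord.
  apply: (@measurable_comp_continuous _ _ _ (fun u : S2 R => \val u)); first exact: measurable_val_coord.
  exact: sublinear_continuous.
- exact: measurable_cst.
Qed.

Lemma sgrad_bounded : exists2 M, 0 <= M & forall u i, `|sgrad g u 0 i| <= M.
Proof.
have [L L0 [hL hL0]] := sublinear_lipschitz sh.
exists (`|point : R| + 2 * L); first by rewrite addr_ge0// mulr_ge0// ltW.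
move=> u i; rewrite sgradE; case: ifPn => _; last by rewrite lerDl mulr_ge0// ltW.
apply: (@le_trans _ _ (2 * L)); last by rewrite lerDr.
have p1 := pd_ge sh (\val u) (e3 i); have p2 := pd_le sh (\val u) (e3 i) ltr01.
have b1 := hL0 (- e3 i); have b2 := hL0 (\val u); have b3 := hL (\val u + 1 *: e3 i) (\val u).
have b4 := norm_coord_le_enorm (\val u : V) i.
rewrite /dquot divr1 in p2; rewrite addrAC subrr add0r scale1r enorm_e3 mulr1 in b3.
rewrite enormN enorm_e3 mulr1 in b1; rewrite enorm_S2 in b4; rewrite enorm_S2 mulr1 in b2.
have b5 : `|h (\val u) * \val u 0 i| <= L.
  by rewrite normrM -[L]mulr1 ler_pM.
rewrite (le_trans (ler_normB _ _))// mulr_natl mulr2n lerD//.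
by move: b1 b3; rewrite scale1r in p2; rewrite !ler_norml => /andP[? ?] /andP[? ?]; apply/andP; split; lra.
Qed.

(* On smooth points this is the Euclidean gradient of [fext g]. *)
Definition full_grad u : V := sgrad g u + g u *: \val u.

Lemma full_grad_dquot (x v : V) : x != 0 -> ~ rough (sdir x) ->
  dquot (fext g) x v t @[t --> 0^'] --> dotp (full_grad (sdir x)) v.
Proof.
move=> x0 nr; have sx := smooth_notin_rough x0 nr.
set u := sdir x.
have su : smooth_at h (\val u) by apply: smooth_notin_rough; [exact: val_neq0|rewrite sdir_val].
have ru i : ddiff h i (\val u) = 0 by exact: su.
have nx : 0 < enorm x by rewrite enorm_gt0.
have -> : dotp (full_grad u) v = pd h x v - 2^-1 * (dotp x v / enorm x).
  have -> : full_grad u = grad h (\val u) - 2^-1 *: \val u.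
    apply/rowP => i; rewrite /full_grad [LHS]mxE [X in X + _]sgradE ru eqxx !mxE.
    have -> : h (\val u) = g u + 2^-1 by exact: hext_val.
    by ring.
  rewrite dotpDl dotpNl dotpZl -smooth_pd// /u val_sdir_neq0// pd_scale ?invr_gt0//.
  by rewrite dotpZl [_ * dotp x v]mulrC.
have -> : dquot (fext g) x v = (fun t => dquot h x v t - 2^-1 * dquot (@enorm R) x v t).
  by apply/funext => t; rewrite /dquot !fextE -/h; ring.
apply: cvgB.
  apply: dquot_cvg => //; rewrite !(smooth_pd sh)// dotpNr subrr //.
apply: cvgM; first exact: cvg_cst.
by rewrite -pd_enorm//; apply: (dquot_cvg sublinear_enorm); exact: pd_enorm_sym.
Qed.

(** Pythagoras: by Euler's identity the tangential gradient is orthogonal to [u]. *)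
Lemma sqr_full_grad u : ~ rough u ->
  dotp (full_grad u) (full_grad u) = enorm (sgrad g u) ^+ 2 + g u ^+ 2.
Proof.
move=> nr; have su : smooth_at h (\val u) by apply: smooth_notin_rough; [exact: val_neq0|rewrite sdir_val].
have sE : sgrad g u = grad h (\val u) - h (\val u) *: \val u.
  by apply/rowP => i; rewrite sgradE [ddiff _ _ _]su eqxx !mxE.
have o : dotp (sgrad g u) (\val u) = 0.
  by rewrite sE dotpDl dotpNl dotpZl dotp_S2 -smooth_pd// pd_self// mulr1 subrr.
rewrite /full_grad !dotpDl !dotpDr !dotpZl !dotpZr dotp_S2 [dotp (\val u) _]dotpC o -sqr_enorm.
by ring.
Qed.

End gradient.

(** * The energy as a limit of rotation forms *)

Section tangents.
Context {R : realType}.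
Implicit Types n : nat.

(** The index is shifted so that the angles start at [pi / 4]: the right angle has no finite
    tangent. *)
Definition chalf n : R := cos (half_angle n.+1).
Definition shalf n : R := sin (half_angle n.+1).
Definition thalf n : R := shalf n / chalf n.

Lemma chalf_gt0 n : 0 < chalf n. Proof. exact: cos_half_angleS_gt0. Qed.

Lemma shalf_gt0 n : 0 < shalf n.
Proof.
apply: sin_gt0_pi; rewrite half_angle_gt0/=.
by rewrite (le_lt_trans (half_angle_le _))// ltr_pdivrMr// ltr_pMr ?pi_gt0// ltr1n.
Qed.

Lemma sqr_chalf n : chalf n ^+ 2 + shalf n ^+ 2 = 1.
Proof. exact: cos2Dsin2. Qed.

Lemma chalf_le1 n : chalf n <= 1. Proof. exact: cos_le1. Qed.

Lemma thalf_gt0 n : 0 < thalf n.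
Proof. by rewrite divr_gt0 ?shalf_gt0 ?chalf_gt0. Qed.

Lemma chalfS n : chalf n = 2 * chalf n.+1 ^+ 2 - 1.
Proof. exact: cos_half_angleS. Qed.

Lemma shalfS n : shalf n ^+ 2 = (2 * shalf n.+1 * chalf n.+1) ^+ 2.
Proof.
have := sqr_chalf n; have := sqr_chalf n.+1; rewrite (chalfS n) => e1 e2.
have -> : shalf n ^+ 2 = 1 - (2 * chalf n.+1 ^+ 2 - 1) ^+ 2 by lra.
rewrite !exprMn (_ : shalf n.+1 ^+ 2 = 1 - chalf n.+1 ^+ 2); last by lra.
by ring.
Qed.

Lemma shalf_sqr_le n : shalf n ^+ 2 <= 2^-1 ^+ n.
Proof.
elim: n => [|n IH].
  by rewrite expr0; have := sqr_chalf 0; have := sqr_ge0 (chalf 0); lra.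
have := sqr_chalf n.+1; have := chalfS n; have := chalf_gt0 n => c0 e1 e2.
have e3 := shalfS n; rewrite !exprMn in e3; rewrite [_ ^+ n.+1]exprS.
have : 2^-1 <= chalf n.+1 ^+ 2 by lra.
have : 0 <= shalf n.+1 ^+ 2 by exact: sqr_ge0.
by rewrite e3 in IH; nra.
Qed.

Lemma shalf_cvg0 : shalf n ^+ 2 @[n --> \oo] --> (0 : R).
Proof.
apply: (@squeeze_cvgr _ _ _ _ (fun=> 0) (fun n => 2^-1 ^+ n)).
- by apply: nearW => n; rewrite sqr_ge0 shalf_sqr_le.
- exact: cvg_cst.
- by apply: cvg_expr; rewrite ger0_norm ?invr_ge0// invf_lt1// ltr1n.
Qed.

Lemma chalf_cvg1 : chalf n @[n --> \oo] --> (1 : R).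
Proof.
apply: (@squeeze_cvgr _ _ _ _ (fun n => 1 - shalf n ^+ 2) (fun=> 1)).
- apply: nearW => n; rewrite chalf_le1 andbT.
  by have := sqr_chalf n; have := chalf_gt0 n; have := chalf_le1 n; nra.
- by rewrite -[X in _ --> X]subr0; apply: cvgB; [exact: cvg_cst|exact: shalf_cvg0].
- exact: cvg_cst.
Qed.

(** [2 tan t <= tan (2 t)], squared. The factor 4 matches the one of [incr_form_half], so that the
    normalised increments are monotone. *)
Lemma thalfS n : 4 * thalf n.+1 ^+ 2 <= thalf n ^+ 2.
Proof.
have := sqr_chalf n.+1; have := chalfS n; have := chalf_gt0 n; have := chalf_gt0 n.+1.
rewrite /thalf !expr_div_n (shalfS n) => c1 c0 e1 e2.
have cc1 := exprn_gt0 2 c1; have cc0 := exprn_gt0 2 c0; have s0 := shalf_gt0 n.+1.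
rewrite mulrA ler_pdivrMr// mulrAC ler_pdivlMr//.
have -> : 4 * shalf n.+1 ^+ 2 * chalf n ^+ 2 = (2 * shalf n.+1 * chalf n) ^+ 2 by ring.
have -> : (2 * shalf n.+1 * chalf n.+1) ^+ 2 * chalf n.+1 ^+ 2 =
  (2 * shalf n.+1 * chalf n.+1 ^+ 2) ^+ 2 by ring.
have n0 : 0 <= 2 * shalf n.+1 * chalf n by rewrite !mulr_ge0// ltW.
have n1 : 0 <= 2 * shalf n.+1 * chalf n.+1 ^+ 2 by rewrite !mulr_ge0// ltW.
rewrite ler_sqr ?nnegrE// ler_pM2l; last by rewrite mulr_gt0.
by have := sqr_ge0 (shalf n.+1); lra.
Qed.

Lemma chalf_div n : (1 - chalf n) / thalf n = chalf n * shalf n / (1 + chalf n).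
Proof.
have c0 := chalf_gt0 n; have s0 := shalf_gt0 n; have e := sqr_chalf n.
have -> : (1 - chalf n) = shalf n ^+ 2 / (1 + chalf n).
  have -> : shalf n ^+ 2 = (1 - chalf n) * (1 + chalf n) by rewrite -subr_sqr expr1n; lra.
  by rewrite mulfK// gt_eqF// addr_gt0.
by rewrite /thalf; field; rewrite !gt_eqF// addr_gt0.
Qed.

Lemma thalf_le n : thalf n <= thalf 0 * 2^-1 ^+ n.
Proof.
elim: n => [|n IH]; first by rewrite expr0 mulr1.
have t1 := thalf_gt0 n.+1; have t0 := thalf_gt0 n.
have : 2 * thalf n.+1 <= thalf n.
  rewrite -ler_sqr ?nnegrE ?(ltW t0)//; last by rewrite mulr_ge0// ltW.
  by rewrite exprMn (le_trans _ (thalfS n))// -natrX.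
by move=> H; rewrite exprS mulrCA ler_pdivlMl//; exact: le_trans H IH.
Qed.

Lemma thalf_cvg0 : thalf n @[n --> \oo] --> (0 : R).
Proof.
apply: (@squeeze_cvgr _ _ _ _ (fun=> 0) (fun n => thalf 0 * 2^-1 ^+ n)).
- by apply: nearW => n; rewrite thalf_le (ltW (thalf_gt0 n)).
- exact: cvg_cst.
- rewrite -[X in _ --> X](mulr0 (thalf 0)); apply: cvgM; first exact: cvg_cst.
  by apply: cvg_expr; rewrite ger0_norm ?invr_ge0// invf_lt1// ltr1n.
Qed.

Lemma chalf_div_cvg : (1 - chalf n) / thalf n @[n --> \oo] --> (0 : R).
Proof.
apply: (@squeeze_cvgr _ _ _ _ (fun=> 0) thalf).
- apply: nearW => n; rewrite chalf_div.
  have c0 := chalf_gt0 n; have s0 := shalf_gt0 n; have c1 := chalf_le1 n.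
  have d0 : 0 < 1 + chalf n by rewrite addr_gt0.
  rewrite divr_ge0 ?mulr_ge0 ?(ltW c0) ?(ltW s0) ?(ltW d0)//= /thalf.
  rewrite ler_pdivrMr// mulrAC ler_pdivlMr//.
  have : chalf n * chalf n <= 1 by nra.
  by nra.
- exact: cvg_cst.
- exact: thalf_cvg0.
Qed.

Lemma chalf_div2_cvg : (1 - chalf n) / thalf n ^+ 2 @[n --> \oo] --> (2^-1 : R).
Proof.
have -> : (fun n => (1 - chalf n) / thalf n ^+ 2) = (fun n => chalf n * chalf n * (1 + chalf n)^-1).
  apply/funext => n; have c0 := chalf_gt0 n; have s0 := shalf_gt0 n.
  have t0 := thalf_gt0 n.
  rewrite expr2 invfM mulrA chalf_div /thalf; field.
  by rewrite !gt_eqF// addr_gt0.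
have -> : (2^-1 : R) = 1 * 1 * (1 + 1)^-1 by rewrite !mul1r.
apply: cvgM; first by apply: cvgM; exact: chalf_cvg1.
apply: cvgV; first by rewrite gt_eqF.
by apply: cvgD; [exact: cvg_cst|exact: chalf_cvg1].
Qed.

End tangents.

Section energy_form.
Context {R : realType}.
Local Notation R6 := (R3 R * R3 R)%type.
Implicit Types (g : S2 R -> R) (F : R6 -> R).

Definition fext6 g (z : R6) : R := fext g (vec3 z.1).
Definition sq6 F : R := sq_form (@int6 R) F.
(** The normalisation is by the squared tangent rather than the squared angle: for a 1-homogeneous
    function the rotated value is [cos t * f(x + tan t * y)], which leads to difference quotients of
    step [tan t]. *)
Definition incr6 n F : R := incr_form (@int6 R) (@rho6 R) n.+1 F / thalf n ^+ 2.
Definition rot6_form n F : R := rot_form (@int6 R) (@rho6 R) n.+1 F / thalf n ^+ 2.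

Let bdD := @bd6D R. Let bdZ := @bd6Z R. Let bdM := @bd6M R.
Let ID := @int6D R. Let IZ := @int6Z R. Let I0 := @int6_ge0 R.
Let bdr := @bd6_rho6 R. Let Ir := @int6_rho6 R. Let rS := @rho6S R.

Let thalf2_gt0 n : 0 < thalf n ^+ 2 :> R.
Proof. by rewrite exprn_gt0// thalf_gt0. Qed.

(** Splits the form into a part monotone in [n] and a multiple of the squared norm whose coefficient
    tends to 1. *)
Lemma rot6_formE n F : bd6 F ->
  rot6_form n F = incr6 n F - 2 * ((1 - chalf n) / thalf n ^+ 2) * sq6 F.
Proof.
move=> bF; rewrite /rot6_form /incr6 (incr_formE bdD bdZ bdM ID IZ bdr Ir)//.
rewrite /rot_form -/(chalf n) -/(sq6 F); field.
by rewrite gt_eqF// thalf_gt0.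
Qed.

Lemma incr6_mono n F : bd6 F -> incr6 n F <= incr6 n.+1 F.
Proof.
move=> bF; have H := incr_form_half bdD bdZ bdM ID IZ I0 bdr Ir rS n.+1 bF.
rewrite /incr6 ler_pdivrMr//; apply: (le_trans H).
rewrite mulrAC ler_pdivlMr// mulrAC mulrC ler_wpM2l ?thalfS//.
rewrite /incr_form; apply: I0 => [|z]; last by rewrite /= -expr2 sqr_ge0.
have b : bd6 (F \o rho6 n.+2 \- F).
  have -> : F \o rho6 n.+2 \- F = F \o rho6 n.+2 \+ -1 \*o F.
    by apply/funext => z /=; rewrite mulN1r.
  by apply: bdD (bdr _ bF) (bdZ _ bF).
exact: bdM.
Qed.

Lemma bd6_fext g : calC g -> bd6 (fext6 g).
Proof.
move=> Cg; split.
  have m : measurable_fun setT (fun p : R3 R => fext g (vec3 p)).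
    by apply: measurable_vec3_comp; exact: calC_fext_continuous.
  exact: (measurableT_comp m measurable_fst).
have [M M0 gM] := continuous_S2_bounded (calC_C_S2 Cg).
exists M => z /ball6_enorm[z1 _]; rewrite (le_trans (norm_fext_le _ gM))//.
by rewrite ler_piMr// ltW.
Qed.

Lemma fext6_odd g z : calC g -> fext6 g (rho6 0 (rho6 0 z)) = - fext6 g z.
Proof. by move=> Cg; rewrite /fext6 vec3_rho60 fextN. Qed.

Lemma fext6_quot n g z : (fext6 g (rho6 n.+1 z) - fext6 g z) / thalf n =
  chalf n * dquot (fext g) (vec3 z.1) (vec3 z.2) (thalf n) -
  (1 - chalf n) / thalf n * fext6 g z.
Proof.
have c0 := chalf_gt0 (R := R) n; have t0 := thalf_gt0 (R := R) n.
have -> : fext6 g (rho6 n.+1 z) = chalf n * fext g (vec3 z.1 + thalf n *: vec3 z.2).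
  rewrite /fext6 vec3_rho6 -(fext_scale _ _ (ltW c0)) scalerDr scalerA.
  by rewrite /thalf mulrC divfK// gt_eqF.
by rewrite /dquot -/(fext6 g z); field; rewrite gt_eqF.
Qed.

Let incr_integrand g n (z : R6) := ((fext6 g (rho6 n.+1 z) - fext6 g z) / thalf n) ^+ 2.

Let bd6_incr_integrand g n : calC g -> bd6 (incr_integrand g n).
Proof.
move=> Cg; have b := bd6_fext Cg.
have b1 : bd6 ((thalf n)^-1 \*o (fext6 g \o rho6 n.+1 \+ -1 \*o fext6 g)).
  by apply: bd6Z; apply: bd6D (bdr _ b) (bd6Z _ b).
have -> : incr_integrand g n = (((thalf n)^-1 \*o (fext6 g \o rho6 n.+1 \+ -1 \*o fext6 g)) \*
  ((thalf n)^-1 \*o (fext6 g \o rho6 n.+1 \+ -1 \*o fext6 g))).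
  by apply/funext => z; rewrite /incr_integrand /=; ring.
exact: bd6M.
Qed.

Lemma incr6_int g n : calC g -> incr6 n (fext6 g) = int6 (incr_integrand g n).
Proof.
move=> Cg; have b := bd6_incr_integrand n Cg.
have t0 := thalf_gt0 (R := R) n.
have -> : incr6 n (fext6 g) = (thalf n ^+ 2)^-1 * int6 (thalf n ^+ 2 \*o incr_integrand g n).
  rewrite /incr6 mulrC /incr_form; congr (_ * int6 _); apply/funext => z.
  by rewrite /incr_integrand /=; field; rewrite gt_eqF.
by rewrite int6Z// mulKf// gt_eqF.
Qed.

(** The bound for dominated convergence: a Lipschitz constant controls the difference quotient, and
    also the function on the ball since [fext g] vanishes at 0. *)
Let thalf_small (z : R6) n L g : calC g -> (forall x y, `|fext g x - fext g y| <= L * enorm (x - y)) ->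
  ball6 z -> 0 < L -> `|(fext6 g (rho6 n.+1 z) - fext6 g z) / thalf n| <= 2 * L.
Proof.
move=> Cg gL /ball6_enorm[z1 z2] L0; rewrite fext6_quot.
have c0 := chalf_gt0 (R := R) n; have t0 := thalf_gt0 (R := R) n; have c1 := chalf_le1 (R := R) n.
have s0 := shalf_gt0 (R := R) n.
have q1 : `|dquot (fext g) (vec3 z.1) (vec3 z.2) (thalf n)| <= L.
  rewrite /dquot normrM normfV (gtr0_norm t0) ler_pdivrMr// (le_trans (gL _ _))//.
  by rewrite addrAC subrr add0r enormZ gtr0_norm// ler_pM2l// ler_piMr// ltW.
have q2 : `|fext6 g z| <= L.
  have := gL (vec3 z.1) 0; have -> : fext g 0 = 0 by rewrite /fext enorm0 mul0r.
  by rewrite !subr0 => H; rewrite (le_trans H)// ler_piMr// ltW.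
have q3 : `|(1 - chalf n) / thalf n : R| <= 1.
  rewrite chalf_div; have d0 : 0 < 1 + chalf n :> R by rewrite addr_gt0.
  rewrite ger0_norm ?divr_ge0 ?mulr_ge0 ?(ltW c0) ?(ltW s0) ?(ltW d0)//.
  rewrite ler_pdivrMr// mul1r; have := sin_le1 (half_angle n.+1 : R); rewrite -/(shalf n).
  by nra.
rewrite (le_trans (ler_normB _ _))// mulr_natl mulr2n lerD// normrM.
  by rewrite gtr0_norm// -[L]mul1r ler_pM// ltW.
by rewrite -[L]mul1r ler_pM.
Qed.

Lemma measurable_full_grad g i : calC g ->
  measurable_fun setT (fun u => full_grad g u 0 i).
Proof.
move=> Cg.
have -> : (fun u => full_grad g u 0 i) = (fun u => sgrad g u 0 i + g u * \val u 0 i).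
  by apply/funext => u; rewrite /full_grad mxE [X in _ + X]mxE.
apply: measurable_funD; first exact: measurable_sgrad.
apply: measurable_funM; last exact: measurable_val_coord.
by apply: continuous_S2_measurable; exact: calC_C_S2.
Qed.

Lemma full_grad_bounded g : calC g -> exists2 M, 0 <= M & forall u i, `|full_grad g u 0 i| <= M.
Proof.
move=> Cg; have [M M0 hM] := sgrad_bounded Cg.
have [N N0 hN] := continuous_S2_bounded (calC_C_S2 Cg).
exists (M + N) => [|u i]; first by rewrite addr_ge0// ltW.
have -> : full_grad g u 0 i = sgrad g u 0 i + g u * \val u 0 i.
  by rewrite /full_grad mxE [X in _ + X]mxE.
rewrite (le_trans (ler_normD _ _))// lerD// normrM -[N]mulr1 ler_pM//.
by rewrite -(enorm_S2 u) norm_coord_le_enorm.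
Qed.

Lemma bd6_full_grad g i : calC g ->
  bd6 (fun z : R6 => full_grad g (sdir (vec3 z.1)) 0 i).
Proof.
move=> Cg; have [M M0 hM] := full_grad_bounded Cg.
have b1 : bd6 (fun _ : R6 => 1 : R).
  by split; [exact: measurable_cst|exists 1 => z _; rewrite normr1].
have := bd6_sdir (measurable_full_grad i Cg) (fun u => hM u i) b1.
by under eq_fun do rewrite mulr1.
Qed.

Let limit_integrand g (z : R6) := dotp (full_grad g (sdir (vec3 z.1))) (vec3 z.2) ^+ 2.

Let bd6_limit_integrand g : calC g -> bd6 (limit_integrand g).
Proof.
move=> Cg; pose w i (z : R6) := full_grad g (sdir (vec3 z.1)) 0 i * vec3 z.2 0 i.
have bw i : bd6 (w i) by apply: bd6M; [exact: bd6_full_grad|exact: bd6_coord2].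
have b : bd6 (w 0 \+ (w 1 \+ w 2%:R)) by apply: bd6D => //; exact: bd6D.
have -> : limit_integrand g = (w 0 \+ (w 1 \+ w 2%:R)) \* (w 0 \+ (w 1 \+ w 2%:R)).
  by apply/funext => z; rewrite /limit_integrand dotp3E /w /=; ring.
exact: bd6M.
Qed.

Lemma incr6_cvg g : calC g ->
  incr6 n (fext6 g) @[n --> \oo] --> int6 (limit_integrand g).
Proof.
move=> Cg; have [L L0 gL] := calC_lipschitz Cg.
under eq_fun do rewrite (incr6_int _ Cg).
have nZ := negligible6_sphere (measurable_rough Cg) (rough_negligible Cg).
apply: (@int6_cvg _ _ _ ((2 * L) ^+ 2)) nZ _.
- by move=> n; exact: (bd6_incr_integrand n Cg).1.
- exact: (bd6_limit_integrand Cg).1.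
- move=> n z bz; rewrite /incr_integrand normrX lerXn2r ?nnegrE ?mulr_ge0 ?(ltW L0)//.
  exact: (@thalf_small z n L).
- move=> z bz /= /not_orP[z0 zr]; have {}z0 : vec3 z.1 != 0 by apply/eqP.
  have D := full_grad_dquot Cg (v := vec3 z.2) z0 zr.
  have Dn : dquot (fext g) (vec3 z.1) (vec3 z.2) (thalf n) @[n --> \oo] -->
      dotp (full_grad g (sdir (vec3 z.1))) (vec3 z.2).
    move/cvgr_dnbhsP : D; apply; split; last exact: thalf_cvg0.
    by move=> n; rewrite gt_eqF// thalf_gt0.
  have : (fext6 g (rho6 n.+1 z) - fext6 g z) / thalf n @[n --> \oo] -->
      dotp (full_grad g (sdir (vec3 z.1))) (vec3 z.2).
    under eq_fun do rewrite fext6_quot.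
    have -> : dotp (full_grad g (sdir (vec3 z.1))) (vec3 z.2) =
      1 * dotp (full_grad g (sdir (vec3 z.1))) (vec3 z.2) - 0 * fext6 g z.
      by rewrite mul1r mul0r subr0.
    apply: cvgB; first by apply: cvgM; [exact: chalf_cvg1|exact: Dn].
    by apply: cvgM; [exact: chalf_div_cvg|exact: cvg_cst].
  by move=> H; rewrite /limit_integrand /incr_integrand expr2; exact: (cvgM H H).
Qed.

(** In the limit the increments contribute [kappa / 3] times the integral of [|grad g|^2 + g^2],
    with 1/3 coming from isotropy in [y]. Subtracting [kappa] times the integral of [g^2] leaves
    [kappa / 3] times that of [|grad g|^2 - 2 g^2], which is twice the energy density. *)
Definition energy_scale : R := 2 * (kappa / 3).

Lemma energy_scale_gt0 : 0 < energy_scale.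
Proof. by rewrite mulr_gt0// divr_gt0// kappa_gt0. Qed.

Lemma sq6_fext g : calC g -> sq6 (fext6 g) = kappa * \int[@sigma R]_u (g u ^+ 2).
Proof.
move=> Cg; have [N N0 hN] := continuous_S2_bounded (calC_C_S2 Cg).
have m : measurable_fun setT (fun u : S2 R => g u ^+ 2).
  by apply: measurable_funX; apply: continuous_S2_measurable; exact: calC_C_S2.
have b u : 0 <= g u ^+ 2 <= N ^+ 2.
  by rewrite sqr_ge0/= -real_normK ?num_real// lerXn2r ?nnegrE// ltW.
rewrite -(int6_polar m b).1; congr int6; apply/funext => z.
by rewrite /fext6 /fext /= -sqr_enorm; ring.
Qed.

Lemma int6_limit g : calC g ->
  int6 (limit_integrand g) =
  kappa / 3 * \int[@sigma R]_u (dotp (full_grad g u) (full_grad g u)).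
Proof.
move=> Cg; have [M M0 hM] := full_grad_bounded Cg.
have m : measurable_fun setT (fun u : S2 R => dotp (full_grad g u) (full_grad g u)).
  under eq_fun do rewrite dotp3E.
  by apply: measurable_funD; [apply: measurable_funD|]; apply: measurable_funM; exact: measurable_full_grad.
have b u : 0 <= dotp (full_grad g u) (full_grad g u) <= 3 * (M * M).
  rewrite dotp_ge0/= dotp3E.
  have q i : full_grad g u 0 i * full_grad g u 0 i <= M * M.
    by rewrite (le_trans (ler_norm _))// normrM ler_pM.
  by have := q 0; have := q 1; have := q 2%:R; lra.
have E := int6_isotropy (W := fun p => full_grad g (sdir (vec3 p))) (fun i => bd6_full_grad i Cg).
by rewrite /limit_integrand E (int6_polar m b).2; ring.
Qed.

(** Off the null set of rough directions [|full_grad g|^2] exceeds [|sgrad g|^2] by [g^2], which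
    changes the coefficient of [g^2] from 1 to 3/2. *)
Lemma energyE g : calC g -> energy g =
  (2^-1 * \int[@sigma R]_u (dotp (full_grad g u) (full_grad g u)) -
   3 / 2 * \int[@sigma R]_u (g u ^+ 2))%:E.
Proof.
move=> Cg; have [M M0 hM] := full_grad_bounded Cg.
have [N N0 hN] := continuous_S2_bounded (calC_C_S2 Cg).
have mg : measurable_fun setT g by apply: continuous_S2_measurable; exact: calC_C_S2.
pose A u : R := dotp (full_grad g u) (full_grad g u); pose B u : R := g u ^+ 2.
have mB : measurable_fun setT B by exact: measurable_funX.
have mA : measurable_fun setT A.
  rewrite /A; under eq_fun do rewrite dotp3E.
  by apply: measurable_funD; [apply: measurable_funD|]; apply: measurable_funM; exact: measurable_full_grad.
have bA u : `|A u| <= 3 * (M * M).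
  rewrite ger0_norm ?dotp_ge0// /A dotp3E.
  have q i : full_grad g u 0 i * full_grad g u 0 i <= M * M.
    by rewrite (le_trans (ler_norm _))// normrM ler_pM.
  by have := q 0; have := q 1; have := q 2%:R; lra.
have bB u : `|B u| <= N ^+ 2 by rewrite normrX lerXn2r ?nnegrE// ltW.
have iA := S2_integrable mA bA; have iB := S2_integrable mB bB.
have iA' := @integrableZl _ _ _ (@sigma R) setT measurableT 2^-1 _ iA.
have iB' := @integrableZl _ _ _ (@sigma R) setT measurableT (3 / 2) _ iB.
rewrite /energy asboolT//.
have E1 := RintegralZl 2^-1 measurableT iA; have E2 := RintegralZl (3 / 2) measurableT iB.
have E3 := RintegralB measurableT iA' iB'.
have iC := integrableB measurableT iA' iB'.
have fi := integrable_fin_num measurableT iC.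
rewrite -[X in _ = X%:E]/(2^-1 * \int[@sigma R]_u A u - 3 / 2 * \int[@sigma R]_u B u).
rewrite -E1 -E2 -E3 /Rintegral fineK//.
apply: ae_eq_integral => //.
- apply/measurable_EFinP; apply: measurable_funB => //; apply: measurable_funM => //.
  under eq_fun do rewrite sqr_enorm dotp3E.
  by apply: measurable_funD; [apply: measurable_funD|]; apply: measurable_funM; exact: measurable_sgrad.
- exact: (measurable_int _ iC).
have nr : (@sigma R).-negligible (rough g).
  by apply/negligibleP; [exact: measurable_rough|exact: rough_negligible].
apply: negligibleS nr => u /= H; have [//|nr] := pselect (rough g u); exfalso; apply: H => _.
congr (_ %:E); rewrite /A /B sqr_full_grad//; lra.
Qed.

(** The last clause, valid at every angle by monotonicity, is the uniform bound from which lower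
    semicontinuity is deduced. *)
Lemma energy_limit g : calC g -> exists e : R, [/\ energy g = e%:E,
  rot6_form n (fext6 g) @[n --> \oo] --> energy_scale * e &
  forall n, incr6 n (fext6 g) <= energy_scale * e + sq6 (fext6 g)].
Proof.
move=> Cg; have bF := bd6_fext Cg; have cv := incr6_cvg Cg.
exists (2^-1 * \int[@sigma R]_u (dotp (full_grad g u) (full_grad g u)) -
   3 / 2 * \int[@sigma R]_u (g u ^+ 2)).
have E : energy_scale * (2^-1 * \int[@sigma R]_u (dotp (full_grad g u) (full_grad g u)) -
   3 / 2 * \int[@sigma R]_u (g u ^+ 2)) = int6 (limit_integrand g) - sq6 (fext6 g).
  by rewrite int6_limit// sq6_fext// /energy_scale; field.
split; first exact: energyE.
  rewrite E; under eq_fun do rewrite rot6_formE//.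
  apply: cvgB; first exact: cv.
  have {2}-> : sq6 (fext6 g) = 2 * 2^-1 * sq6 (fext6 g) by rewrite divff// mul1r.
  apply: cvgM; last exact: cvg_cst.
  by apply: cvgM; [exact: cvg_cst|exact: chalf_div2_cvg].
move=> n; rewrite E subrK.
have mono : nondecreasing_seq (fun n => incr6 n (fext6 g)).
  by apply/nondecreasing_seqP => k; exact: incr6_mono.
by rewrite -(cvg_lim _ cv)//; apply: nondecreasing_cvgn_le => //; apply/cvg_ex; eexists; exact: cv.
Qed.

End energy_form.

(** * Sign, convexity, invariance and lower semicontinuity of the energy *)

Section energy_properties.
Context {R : realType}.
Local Notation R6 := (R3 R * R3 R)%type.
Local Notation V := 'rV[R]_3.
Implicit Types (g : S2 R -> R).

Definition renergy g : R := fine (energy g).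

Let bdD := @bd6D R. Let bdZ := @bd6Z R. Let bdM := @bd6M R.
Let ID := @int6D R. Let IZ := @int6Z R. Let I0 := @int6_ge0 R.
Let bdr := @bd6_rho6 R. Let Ir := @int6_rho6 R. Let rS := @rho6S R.

Lemma renergyP g : calC g -> [/\ energy g = (renergy g)%:E,
  rot6_form n (fext6 g) @[n --> \oo] --> energy_scale * renergy g &
  forall n, incr6 n (fext6 g) <= energy_scale * renergy g + sq6 (fext6 g)].
Proof. by move=> /energy_limit[e [E H1 H2]]; rewrite /renergy E. Qed.

Let rot6_form_cvg g : calC g ->
  rot6_form n (fext6 g) @[n --> \oo] --> energy_scale * renergy g.
Proof. by move=> /renergyP[]. Qed.

Let escale0 : 0 < energy_scale :> R := energy_scale_gt0.

Let thalf2_gt0 n : 0 < thalf n ^+ 2 :> R.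
Proof. by rewrite exprn_gt0// thalf_gt0. Qed.

Let lim_uniq (u : nat -> R) (a b : R) : u n @[n --> \oo] --> a -> u n @[n --> \oo] --> b -> a = b.
Proof. by move=> ua ub; rewrite -(cvg_lim (@Rhausdorff R) ua) (cvg_lim (@Rhausdorff R) ub). Qed.

Let lim_le (u v : nat -> R) (a b : R) : u n @[n --> \oo] --> a -> v n @[n --> \oo] --> b ->
  (forall n, u n <= v n) -> a <= b.
Proof. by move=> ua vb uv; apply: (ler_cvg_to ua vb); apply: nearW. Qed.

Lemma renergy_ge0 g : calC g -> 0 <= renergy g.
Proof.
move=> Cg; rewrite -(pmulr_rge0 _ escale0).
apply: (lim_le (cvg_cst 0) (rot6_form_cvg Cg)) => n.
rewrite /rot6_form divr_ge0 ?(ltW (thalf2_gt0 n))//.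
apply: (rot_form_ge0 bdD bdZ bdM ID IZ I0 bdr Ir rS n.+1 (bd6_fext Cg)) => z.
exact: fext6_odd.
Qed.

Lemma renergy_conv g1 g2 (s : R) : 0 <= s <= 1 -> calC g1 -> calC g2 ->
  renergy (s \*o g1 \+ (1 - s) \*o g2) <= s * renergy g1 + (1 - s) * renergy g2.
Proof.
move=> s01 C1 C2; have C3 := calC_conv s01 C1 C2; move: s01 => /andP[s0 s1].
have b1 := bd6_fext C1; have b2 := bd6_fext C2.
rewrite -(ler_pM2l escale0).
have H : s * rot6_form n (fext6 g1) + (1 - s) * rot6_form n (fext6 g2) @[n --> \oo] -->
    s * (energy_scale * renergy g1) + (1 - s) * (energy_scale * renergy g2).
  by apply: cvgD; apply: cvgM (rot6_form_cvg _) => //; exact: cvg_cst.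
have -> : energy_scale * (s * renergy g1 + (1 - s) * renergy g2) =
    s * (energy_scale * renergy g1) + (1 - s) * (energy_scale * renergy g2) by ring.
apply: (lim_le (rot6_form_cvg C3) H) => n; rewrite /rot6_form.
have -> : fext6 (s \*o g1 \+ (1 - s) \*o g2) = (s \*o fext6 g1) \+ ((1 - s) \*o fext6 g2).
  by apply/funext => z; rewrite /fext6 fextD !fextZ.
have E := rot_form_conv bdD bdZ bdM ID IZ bdr n.+1 s b1 b2.
rewrite E !mulrA -mulrDl ler_pM2r ?invr_gt0// lerBlDr lerDl.
have bB : bd6 (fext6 g1 \- fext6 g2).
  have -> : fext6 g1 \- fext6 g2 = fext6 g1 \+ -1 \*o fext6 g2.
    by apply/funext => z /=; rewrite mulN1r.
  exact: bdD (bdZ _ b2).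
have r0 : 0 <= rot_form (@int6 R) (@rho6 R) n.+1 (fext6 g1 \- fext6 g2).
  apply: (rot_form_ge0 bdD bdZ bdM ID IZ I0 bdr Ir rS n.+1 bB) => z /=.
  by rewrite !fext6_odd// opprB addrC opprK.
by apply: mulr_ge0 (r0); apply: mulr_ge0; rewrite ?subr_ge0.
Qed.

Lemma calC_lin a : calC (@linS2 R a).
Proof.
have := calC_linS2 a (@calC0 R); congr calC; apply/funext => u /=; exact: add0r.
Qed.

Let fext6_lin a (z : R6) : fext6 (linS2 a) z = dotp a (vec3 z.1).
Proof. exact: fext_linS2. Qed.

(* [x . a] and [y . a] are uncorrelated by the reflection [y |-> - y]. *)
Let rot_form_lin n a : rot_form (@int6 R) (@rho6 R) n (fext6 (linS2 a)) = 0.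
Proof.
have bF := bd6_fext (calC_lin a); set F := fext6 _ in bF *.
pose G (z : R6) := dotp a (vec3 z.2).
have bG : bd6 G.
  split; first by apply: (measurableT_comp (f := fun p => dotp a (vec3 p))) => //;
    apply: measurable_vec3_comp; exact: dotp_continuous.
  exists (enorm a) => z /ball6_enorm[_ z2].
  by rewrite (le_trans (norm_dotp_le _ _))// ler_piMr// enorm_ge0.
have FG0 : int6 (F \* G) = 0.
  have nN1 : `|-1 : R| = 1 by rewrite normrN normr1.
  have P := lebesgue3_preserving_affine 0 0 0 nN1 nN1 nN1.
  have vN (q : R3 R) : vec3 (-1 * q.1.1 + 0, -1 * q.1.2 + 0, -1 * q.2 + 0) = - vec3 q.
    by apply: rV3P; rewrite !mxE /= ?mxE; ring.
  have dN (q : R3 R) : dotp (vec3 (-1 * q.1.1 + 0, -1 * q.1.2 + 0, -1 * q.2 + 0))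
     (vec3 (-1 * q.1.1 + 0, -1 * q.1.2 + 0, -1 * q.2 + 0)) = dotp (vec3 q) (vec3 q).
    by rewrite vN dotpNl dotpNr opprK.
  have := int6_snd P dN (bdM bF bG).1.
  have -> : (fun z : R6 => (F \* G) (z.1, (-1 * z.2.1.1 + 0, -1 * z.2.1.2 + 0, -1 * z.2.2 + 0))) =
      -1 \*o (F \* G).
    by apply/funext => z /=; rewrite /G /= vN dotpNr /F /fext6 /= mulrN mulN1r.
  rewrite IZ ?mulN1r; last exact: bdM.
  by move=> H; lra.
rewrite /rot_form /corr_form.
have -> : F \* (F \o rho6 n) = cos (half_angle n) \*o (F \* F) \+ sin (half_angle n) \*o (F \* G).
  apply/funext => z /=; rewrite /F !fext6_lin vec3_rho6 dotpDr !dotpZr /G; ring.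
have bFF := bdM bF bF; have bFG := bdM bF bG.
rewrite ID ?IZ// ?FG0; [|exact: bdZ|exact: bdZ].
by rewrite /sq_form; ring.
Qed.

Lemma renergy0 : renergy (fun=> 0 : R) = 0.
Proof.
have Cl := calC_lin (0 : V); have E : linS2 (0 : V) = fun=> 0.
  by apply/funext => u; rewrite /linS2 dotp0l.
rewrite -E; apply: (mulfI (lt0r_neq0 escale0)); rewrite mulr0.
apply: (lim_uniq (rot6_form_cvg Cl)); rewrite /rot6_form.
by under eq_fun do rewrite rot_form_lin mul0r; exact: cvg_cst.
Qed.

Lemma renergy_lin g a : calC g -> renergy (g \+ linS2 a) = renergy g.
Proof.
move=> Cg; have Cl := calC_lin a; have Cs := calC_linS2 a Cg.
apply: (mulfI (lt0r_neq0 escale0)).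
apply: (lim_uniq (rot6_form_cvg Cs)).
suff -> : (fun n => rot6_form n (fext6 (g \+ linS2 a))) = (fun n => rot6_form n (fext6 g)).
  exact: rot6_form_cvg.
apply/funext => n; rewrite /rot6_form; congr (_ / _).
have -> : fext6 (g \+ linS2 a) = fext6 g \+ fext6 (linS2 a).
  by apply/funext => z; rewrite /fext6 fextD.
apply: (rot_form_kernel bdD bdZ bdM ID IZ I0 bdr Ir rS (bd6_fext Cg) (bd6_fext Cl)).
- by move=> z; exact: fext6_odd.
- by move=> z; exact: fext6_odd.
- exact: rot_form_lin.
Qed.

Lemma renergy_opp g : calC g -> renergy (fun u => - g u) = renergy g.
Proof.
move=> Cg; have CN := calC_opp Cg.
apply: (mulfI (lt0r_neq0 escale0)).
apply: (lim_uniq (rot6_form_cvg CN)).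
suff -> : (fun n => rot6_form n (fext6 (fun u => - g u))) = (fun n => rot6_form n (fext6 g)).
  exact: rot6_form_cvg.
apply/funext => n; rewrite /rot6_form; congr (_ / _).
have fN z : fext6 (fun u => - g u) z = - fext6 g z.
  by rewrite /fext6 /fext mulrN.
rewrite /rot_form /sq_form /corr_form; congr (_ * int6 _ - _ * int6 _).
  by apply/funext => z /=; rewrite !fN mulrNN.
by apply/funext => z /=; rewrite !fN mulrNN.
Qed.

(** For a fixed angle [m], [incr6 m] and [sq6] pass to the limit by dominated convergence, so that
    the bound by [energy_scale * c + sq6] survives for every [m]; letting [m] grow afterwards
    recovers the energy of [g]. *)
Lemma renergy_lsc (gn : nat -> S2 R -> R) g (M c : R) (cn : nat -> R) :
  (forall n, calC (gn n)) -> C_S2 g -> (forall n u, `|gn n u| <= M) ->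
  (forall u, gn n u @[n --> \oo] --> g u) ->
  (forall n, renergy (gn n) <= cn n) -> cn n @[n --> \oo] --> c ->
  calC g /\ renergy g <= c.
Proof.
move=> Cn Cg gM gg gc cc; have C := calC_closed Cn Cg gg; split => //.
have M0 : 0 <= M := le_trans (normr_ge0 _) (gM 0%N (pole R)).
have fM n (z : R6) : ball6 z -> `|fext6 (gn n) z| <= M.
  by move=> /ball6_enorm[z1 _]; rewrite (le_trans (norm_fext_le _ (gM n)))// ler_piMr.
have cF (z : R6) : fext6 (gn n) z @[n --> \oo] --> fext6 g z.
  by apply: cvgM; [exact: cvg_cst|exact: gg].
have n0 : (@lebesgue6 R).-negligible (@ball6 R `&` set0).
  by rewrite setI0; exact: negligible_set0.
have csq : sq6 (fext6 (gn n)) @[n --> \oo] --> sq6 (fext6 g).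
  apply: (@int6_cvg _ _ _ (M * M)) n0 _.
  - by move=> n; apply: (bdM _ _).1; exact: bd6_fext.
  - by apply: (bdM _ _).1; exact: bd6_fext.
  - by move=> n z bz; rewrite /= normrM ler_pM// fM.
  - by move=> z bz _; apply: cvgM; exact: cF.
have cinc m : incr6 m (fext6 (gn n)) @[n --> \oo] --> incr6 m (fext6 g).
  apply: cvgM; last exact: cvg_cst.
  have bI (G : R6 -> R) : bd6 G -> bd6 (G \o rho6 m.+1 \- G).
    move=> bG; have -> : G \o rho6 m.+1 \- G = G \o rho6 m.+1 \+ -1 \*o G.
      by apply/funext => z /=; rewrite mulN1r.
    exact: bdD (bdr _ bG) (bdZ _ bG).
  have br (z : R6) : ball6 z -> ball6 (rho6 m.+1 z).
    have := @rot6_ball6 R (cos (half_angle m.+1)) (sin (half_angle m.+1)) (cos2Dsin2 _).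
    by move=> E bz; rewrite -E in bz.
  have cI (z : R6) : (fext6 (gn n) \o rho6 m.+1 \- fext6 (gn n)) z @[n --> \oo] -->
      (fext6 g \o rho6 m.+1 \- fext6 g) z.
    by apply: cvgB; exact: cF.
  have q n (z : R6) : ball6 z -> `|(fext6 (gn n) \o rho6 m.+1 \- fext6 (gn n)) z| <= 2 * M.
    move=> bz; rewrite /= (le_trans (ler_normB _ _))// mulr_natl mulr2n.
    by rewrite lerD// fM//; exact: br.
  apply: (@int6_cvg _ _ _ (2 * M * (2 * M))) n0 _.
  - by move=> n; apply: (bdM _ _).1; apply: bI; exact: bd6_fext.
  - by apply: (bdM _ _).1; apply: bI; exact: bd6_fext.
  - by move=> n z bz; rewrite /= normrM ler_pM// q.
  - by move=> z bz _; apply: cvgM; exact: cI.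
have inc m : incr6 m (fext6 g) <= energy_scale * c + sq6 (fext6 g).
  have H0 : energy_scale * cn n + sq6 (fext6 (gn n)) @[n --> \oo] -->
      energy_scale * c + sq6 (fext6 g).
    by apply: cvgD => //; apply: cvgM => //; exact: cvg_cst.
  apply: (lim_le (cinc m) H0) => n.
  have [_ _ H] := renergyP (Cn n); apply: (le_trans (H m)).
  by rewrite lerD2r ler_pM2l.
have bF := bd6_fext C.
rewrite -(ler_pM2l escale0).
have H2 : incr6 n (fext6 g) - 2 * ((1 - chalf n) / thalf n ^+ 2) * sq6 (fext6 g) @[n --> \oo]
    --> energy_scale * renergy g.
  by have := rot6_form_cvg C; under eq_fun do rewrite rot6_formE//.
have H3 : energy_scale * c + sq6 (fext6 g) - 2 * ((1 - chalf n) / thalf n ^+ 2) * sq6 (fext6 g)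
   @[n --> \oo] --> energy_scale * c + sq6 (fext6 g) - 2 * 2^-1 * sq6 (fext6 g).
  apply: cvgB; first exact: cvg_cst.
  apply: cvgM; last exact: cvg_cst.
  by apply: cvgM; [exact: cvg_cst|exact: chalf_div2_cvg].
have -> : energy_scale * c = energy_scale * c + sq6 (fext6 g) - 2 * 2^-1 * sq6 (fext6 g).
  by rewrite divff// mul1r addrK.
by apply: (lim_le H2 H3) => n; rewrite lerD2r.
Qed.

End energy_properties.

(** * The conjugate energy *)

Section conjugate.
Context {R : realType}.
Local Notation V := 'rV[R]_3.
Implicit Types (g h : S2 R -> R) (eta zeta : M_S2 R).

(** An annihilator of the linear functions does not see translations, and a suitable translate is
    bounded by 1/2. Consequently [E^*] is finite on all of [Pperp]. *)
Lemma calC_pairing_bounded eta : Pperp eta -> exists2 K, 0 <= K &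
  forall g, calC g -> `|pairing eta g| <= K.
Proof.
move=> Pe; have [K K0 hK] := pairing_bounded eta; exists (K * 2^-1); first by rewrite mulr_ge0.
move=> g Cg; have [a [ga _]] := calC_translate Cg.
have C1 := calC_C_S2 Cg; have C2 := @C_S2_linS2 _ a.
have -> : pairing eta g = pairing eta (g \+ linS2 a) by rewrite pairingD// Pe addr0.
by apply: hK => //; exact: C_S2D.
Qed.

Lemma energy_conj_ge eta g : calC g -> ((pairing eta g - renergy g)%:E <= energy_conj eta)%E.
Proof.
move=> Cg; apply: ereal_sup_ubound; exists g => //.
by have [-> _ _] := renergyP Cg.
Qed.

Lemma energy_conj_le eta (M : R) :
  (forall g, calC g -> pairing eta g - renergy g <= M) -> (energy_conj eta <= M%:E)%E.
Proof.
move=> H; apply: ge_ereal_sup => _ [g Cg <-].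
by have [-> _ _] := renergyP Cg; rewrite -EFinB lee_fin H.
Qed.

Lemma C_S2_0 : C_S2 (fun=> 0 : R). Proof. exact: C_S2_cst. Qed.

Lemma pairing0 eta : pairing eta (fun=> 0) = 0.
Proof.
have E : (fun=> 0 : R) = (fun u : S2 R => 0 * (fun=> 0 : R) u) by apply/funext => u; rewrite mul0r.
by rewrite E pairingZ ?mul0r//; exact: C_S2_0.
Qed.

Lemma energy_conj_ge0 eta : (0 <= energy_conj eta)%E.
Proof.
by have := energy_conj_ge eta (@calC0 R); rewrite pairing0 renergy0 subrr.
Qed.

Definition renergy_conj eta : R := fine (energy_conj eta).

Lemma energy_conjE eta : Pperp eta -> energy_conj eta = (renergy_conj eta)%:E.
Proof.
move=> Pe; have [K K0 hK] := calC_pairing_bounded Pe.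
rewrite /renergy_conj fineK// ge0_fin_numE; last exact: energy_conj_ge0.
apply: le_lt_trans (ltry K); apply: energy_conj_le => g Cg.
rewrite lerBlDr (le_trans (ler_norm _))// (le_trans (hK _ Cg))// lerDl.
exact: renergy_ge0.
Qed.

Definition axis (i : 'I_3) : S2 R := sdir (e3 i).

Lemma val_axis i : \val (axis i) = e3 i :> V.
Proof.
have n0 : e3 i != 0 :> V by rewrite -enorm_gt0 enorm_e3.
by rewrite /axis val_sdir_neq0// enorm_e3 invr1 scale1r.
Qed.

(* Representative of the class of [g] vanishing on the coordinate axes. *)
Definition axis_coef g : V := \row_i g (axis i).
Definition normalize g : S2 R -> R := g \+ linS2 (- axis_coef g).

Lemma normalizeE g u : normalize g u = g u - dotp (axis_coef g) (\val u).
Proof. by rewrite /normalize/= /linS2 dotpNl. Qed.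

Lemma normalize_lin g a : normalize (g \+ linS2 a) = normalize g.
Proof.
apply/funext => u; rewrite !normalizeE /= /linS2.
have -> : axis_coef (g \+ linS2 a) = axis_coef g + a.
  by apply/rowP => i; rewrite !mxE /= /linS2 val_axis dotp_e3.
by rewrite dotpDl; ring.
Qed.

Lemma normalize_conv g1 g2 (s : R) u : normalize (s \*o g1 \+ (1 - s) \*o g2) u =
  s * normalize g1 u + (1 - s) * normalize g2 u.
Proof.
rewrite !normalizeE /=.
have -> : axis_coef (s \*o g1 \+ (1 - s) \*o g2) = s *: axis_coef g1 + (1 - s) *: axis_coef g2.
  by apply/rowP => i; rewrite !mxE.
by rewrite dotpDl !dotpZl; ring.
Qed.

Lemma C_S2_normalize g : C_S2 g -> C_S2 (normalize g).
Proof. by move=> Cg; apply: C_S2D Cg _; exact: C_S2_linS2. Qed.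

(** Unlike the choice made in [calC_translate], this normalization is linear in [g]. The price is a
    correction by a vector with coordinates at most 1/2, of effect at most 3/2, which the constants
    3 and 4 absorb. *)
Lemma calC_normalize_bound g : calC g -> (forall u, `|normalize g u| <= 3) /\
  forall u v, `|normalize g u - normalize g v| <= 4 * enorm (\val u - \val v : V).
Proof.
move=> Cg; have [a [ga gl]] := calC_translate Cg; rewrite -(normalize_lin g a).
set f := g \+ linS2 a in ga gl *.
have c (x : V) : `|dotp (axis_coef f) x| <= 3 / 2 * enorm x.
  rewrite dotp3E !mxE; have q i : `|f (axis i) * x 0 i| <= 2^-1 * enorm x.
    by rewrite normrM ler_pM//; [exact: ga|exact: norm_coord_le_enorm].
  have := ler_normD (f (axis 0) * x 0 0 + f (axis 1) * x 0 1) (f (axis 2%:R) * x 0 2%:R).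
  have := ler_normD (f (axis 0) * x 0 0) (f (axis 1) * x 0 1).
  by have := q 0; have := q 1; have := q 2%:R; lra.
split=> [u|u v]; rewrite !normalizeE.
  have := c (\val u); rewrite enorm_S2 => cu; have := ga u.
  by rewrite -/(f u) => H; rewrite (le_trans (ler_normB _ _))//; lra.
have -> : f u - dotp (axis_coef f) (\val u) - (f v - dotp (axis_coef f) (\val v)) =
    f u - f v - dotp (axis_coef f) (\val u - \val v) by rewrite dotpDr dotpNr; ring.
have := gl (\val u) (\val v); rewrite !fext_val => H.
have c' := c (\val u - \val v); have n0 := enorm_ge0 (\val u - \val v : V).
by rewrite (le_trans (ler_normB _ _))//; lra.
Qed.

Definition delta (u : S2 R) : M_S2 R := charge_of_finite_measure (dirac u).

(** Represents the evaluation of [normalize] at [u]. It annihilates the linear functions, so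
    combinations of such charges are admissible arguments of [E^*]. *)
Definition normalize_charge (u : S2 R) : M_S2 R :=
  csub (delta u) (cadd (cscale (\val u 0 0) (delta (axis 0)))
    (cadd (cscale (\val u 0 1) (delta (axis 1))) (cscale (\val u 0 2%:R) (delta (axis 2%:R))))).

Lemma pairing_normalize_charge u g : C_S2 g -> pairing (normalize_charge u) g = normalize g u.
Proof.
move=> Cg; rewrite (pairing_csub _ _ Cg) !(pairing_cadd _ _ Cg) !(pairing_cscale _ _ Cg).
by rewrite !(pairing_dirac _ Cg) normalizeE dotp3E !mxE; ring.
Qed.

Definition comb_charge (w : S2 R -> R) (l : seq (S2 R)) : M_S2 R :=
  foldr (fun u xi => cadd (cscale (w u) (normalize_charge u)) xi) (cscale 0 (delta (pole R))) l.

Lemma pairing_comb_charge w l g : C_S2 g ->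
  pairing (comb_charge w l) g = \sum_(u <- l) w u * normalize g u.
Proof.
move=> Cg; elim: l => [|u l IH] /=; first by rewrite pairing_cscale// mul0r big_nil.
by rewrite big_cons pairing_cadd// pairing_cscale// pairing_normalize_charge// IH.
Qed.

Lemma Pperp_comb_charge w l : Pperp (comb_charge w l).
Proof.
move=> a; rewrite pairing_comb_charge; last exact: C_S2_linS2.
rewrite big1_seq// => u _; have := normalize_lin (fun=> 0) a.
have -> : (fun=> 0) \+ linS2 a = linS2 a :> (S2 R -> R) by apply/funext => v /=; rewrite add0r.
move=> ->; rewrite normalizeE (_ : axis_coef _ = 0) ?dotp0l ?subrr ?mulr0//.
by apply/rowP => i; rewrite !mxE.
Qed.

(** * Fenchel biduality for the energy *)

Section fenchel.
Variables (h : S2 R -> R) (c : R).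
Hypothesis Ch : C_S2 h.
Hypothesis hc : forall eta, Pperp eta -> ((pairing eta h)%:E <= c%:E + energy_conj eta)%E.

Let sum_le_size (f : S2 R -> R) (K : R) l : (forall u, f u <= K) ->
  \sum_(u <- l) f u <= K * (size l)%:R.
Proof.
move=> fK; elim: l => [|u l IH]; first by rewrite big_nil mulr0.
by rewrite big_cons -natr1 mulrDr mulr1 addrC lerD.
Qed.

Let penalty (l : seq (S2 R)) g : R := \sum_(u <- l) (normalize g u - normalize h u) ^+ 2.

Let penalty_ge0 l g : 0 <= penalty l g.
Proof. by apply: sumr_ge0 => u _; exact: sqr_ge0. Qed.

(* Near-minimisers of the penalised energy [E + N * penalty] satisfy the Euler
   inequality up to [s], whose multiplier is a combination of Dirac masses. *)
Let near_minimiser l (N s : R) : 0 <= N -> 0 < s -> s <= 1 ->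
  exists2 g, calC g & renergy g + 2 * N * penalty l g <= c + s * (1 + N * (36 * (size l)%:R)).
Proof.
move=> N0 s0 s1.
pose F g := renergy g + N * penalty l g.
have F0 g : calC g -> 0 <= F g by move=> Cg; rewrite addr_ge0 ?renergy_ge0// mulr_ge0.
have ne : [set F g | g in @calC R] !=set0 by exists (F (fun=> 0)), (fun=> 0) => //; exact: calC0.
have lb : has_lbound [set F g | g in @calC R] by exists 0 => _ [g Cg <-]; exact: F0.
(* The gap [s ^ 2] is of second order: the comparison along a segment is made at parameter [s] and
   then divided by [s]. *)
have : inf [set F g | g in @calC R] < inf [set F g | g in @calC R] + s ^+ 2 by rewrite ltrDl exprn_gt0.
move=> /(inf_lt ne)[_ [gs Cs <-] Fs].
have Fm g : calC g -> F gs - s ^+ 2 <= F g.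
  move=> Cg; rewrite lerBlDr; apply: (le_trans (ltW Fs)); rewrite lerD2r.
  by apply: ge_inf => //; exists g.
exists gs => //.
pose a u := normalize gs u - normalize h u.
(* Minus the derivative of [N * penalty l] at [gs]. *)
pose eta := comb_charge (fun u => - (2 * N * a u)) l.
have Pe : Pperp eta by exact: Pperp_comb_charge.
have key g : calC g -> pairing eta g - renergy g <=
    pairing eta gs - renergy gs + s * (1 + N * (36 * (size l)%:R)).
  move=> Cg; pose b u := normalize g u - normalize gs u.
  have s01 : 0 <= s <= 1 by rewrite (ltW s0).
  have Cc := calC_conv s01 Cg Cs.
  have E1 := renergy_conv s01 Cg Cs; have E2 := Fm _ Cc.
  have P1 : penalty l (s \*o g \+ (1 - s) \*o gs) =
      penalty l gs + 2 * s * (\sum_(u <- l) a u * b u) + s ^+ 2 * (\sum_(u <- l) b u ^+ 2).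
    rewrite /penalty !mulr_sumr -!big_split /=; apply: eq_bigr => u _.
    by rewrite normalize_conv /a /b; ring.
  (* 36 is the square of 3 + 3, by the uniform bound on normalized members of [calC]. *)
  have B : \sum_(u <- l) b u ^+ 2 <= 36 * (size l)%:R.
    apply: sum_le_size => u; rewrite -real_normK ?num_real//.
    have -> : 36 = 6 ^+ 2 :> R by rewrite -natrX.
    rewrite lerXn2r ?nnegrE// (le_trans (ler_normB _ _))//.
    have := (calC_normalize_bound Cg).1 u; have := (calC_normalize_bound Cs).1 u.
    by lra.
  have P2 : pairing eta g - pairing eta gs = - (2 * N * (\sum_(u <- l) a u * b u)).
    rewrite !pairing_comb_charge; [|exact: calC_C_S2|exact: calC_C_S2].
    rewrite -sumrB mulr_sumr -sumrN; apply: eq_bigr => u _; rewrite /b; ring.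
  rewrite /F P1 in E2.
  set S := \sum_(u <- l) a u * b u in P2 E2 *; set T := \sum_(u <- l) b u ^+ 2 in B E2 *.
  have : 0 <= s * (renergy g - renergy gs + 2 * N * S + s * (1 + N * (36 * (size l)%:R))).
    have : N * T <= N * (36 * (size l)%:R) by rewrite ler_wpM2l.
    move: (N * (36 * _)) => K NT.
    have : s ^+ 2 * (N * T) <= s ^+ 2 * K by rewrite ler_wpM2l// sqr_ge0.
    by move: E1 E2; set X := renergy (_ \+ _); rewrite !mulrDr; lra.
  by rewrite pmulr_rge0//; lra.
have ec := energy_conj_le key.
have := hc Pe => /le_trans /(_ (leeD2l c%:E ec)); rewrite -EFinD lee_fin.
have P3 : pairing eta h - pairing eta gs = 2 * N * penalty l gs.
  rewrite !pairing_comb_charge//; last exact: calC_C_S2.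
  rewrite -sumrB /penalty mulr_sumr; apply: eq_bigr => u _; rewrite /a; ring.
by move: (s * _) => K; lra.
Qed.

Let finite_error (l : seq (S2 R)) (e : R) : 0 < e -> exists g, [/\ calC g, renergy g <= c + e &
  forall u, u \in l -> `|normalize g u - normalize h u| <= e].
Proof.
move=> e0; pose d := Num.min 1 e.
have d0 : 0 < d by rewrite lt_min ltr01.
have dle : d <= e by rewrite ge_min lexx orbT.
have d1 : d <= 1 by rewrite ge_min lexx.
(* Large enough that [2 * N * penalty <= |c| + 1], which follows from the nonnegativity of the
   energy, forces [penalty <= d ^ 2]. *)
pose N := (`|c| + 1) / d ^+ 2.
have N0 : 0 < N by rewrite divr_gt0 ?exprn_gt0// ltr_wpDl.
pose K := 1 + N * (36 * (size l)%:R).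
have K1 : 1 <= K by rewrite lerDl mulr_ge0 ?(ltW N0)// mulr_ge0.
have K0 : 0 < K by exact: lt_le_trans K1.
(* With [s = d / K] the error term of [near_minimiser] is exactly [d]. *)
have s0 : 0 < d / K by rewrite divr_gt0.
have s1 : d / K <= 1 by rewrite ler_pdivrMr// mul1r (le_trans d1).
have [g Cg] := @near_minimiser l N (d / K) (ltW N0) s0 s1.
rewrite -/K divfK ?gt_eqF// => H; exists g.
have E0 := renergy_ge0 Cg; have p0 := penalty_ge0 l g.
have Np : 0 <= 2 * N * penalty l g by apply: mulr_ge0 (p0); apply: mulr_ge0 (ltW N0).
split=> //; first by lra.
move=> u ul; have : (normalize g u - normalize h u) ^+ 2 <= penalty l g.
  rewrite /penalty (big_rem u)//= lerDl; apply: sumr_ge0 => v _; exact: sqr_ge0.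
move=> le; apply: (le_trans _ dle).
rewrite -ler_sqr ?nnegrE ?(ltW d0)// real_normK ?num_real//; apply: (le_trans le).
have : 2 * N * penalty l g <= `|c| + 1 by have := ler_norm c; lra.
have -> : `|c| + 1 = N * d ^+ 2 by rewrite /N divfK// gt_eqF// exprn_gt0.
rewrite [2 * N]mulrC -mulrA (ler_pM2l N0) => H2; lra.
Qed.

(* Members of [calC] are equi-Lipschitz once normalized, so that control on a
   finite net is control on the sphere. *)
Let uniform_error (e : R) : 0 < e -> exists g, [/\ calC g, renergy g <= c + e &
  forall u, `|normalize g u - normalize h u| <= e].
Proof.
move=> e0; pose d := e / 8; have d0 : 0 < d by rewrite divr_gt0.
pose f (u v : S2 R) := enorm (\val v - \val u : V) + `|normalize h v - normalize h u|.
have cf u : continuous (f u).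
  apply: (@C_S2D _ (fun v : S2 R => enorm (\val v - \val u : V))).
    apply: (@C_S2_val _ (fun x => enorm (x - \val u))).
    apply: (@enorm_lipschitz_continuous _ _ 1) => x y; rewrite mul1r.
    rewrite (le_trans (ler_norm _))// (le_trans (ler_dist_enorm _ _))//.
    by rewrite opprB addrA subrK.
  move=> v; apply: (@continuous_comp _ _ _ (normalize h) (fun x : R => `|x - normalize h u|)).
    exact: C_S2_normalize.
  by apply: cvg_norm; apply: cvgB; [exact: cvg_id|exact: cvg_cst].
have op u : open (f u @^-1` [set x | x < d]).
  by move/continuousP : (cf u); apply; exact: open_lt.
have := @compact_S2 R; rewrite compact_cover => /(_ (S2 R) setT (fun u => f u @^-1` [set x | x < d])).
move=> /(_ (fun u _ => op u))[].
  by move=> u _; exists u => //=; rewrite /f !subrr normr0 enorm0 addr0.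
move=> D _ cov; have [g [Cg Eg gD]] := finite_error (finmap.enum_fset D) d0.
exists g; split=> //; first by rewrite (le_trans Eg)// lerD2l /d; lra.
move=> v; have [u /= uD] := cov v I; rewrite /f => H.
have := gD _ uD; have := (calC_normalize_bound Cg).2 v u.
have := enorm_ge0 (\val v - \val u : V); have := normr_ge0 (normalize h v - normalize h u).
have -> : normalize g v - normalize h v = (normalize g v - normalize g u) +
  (normalize g u - normalize h u) - (normalize h v - normalize h u) by ring.
move: (enorm _) H => E H n0 E0 b1 b2.
rewrite (le_trans (ler_normB _ _))//.
by have := ler_normD (normalize g v - normalize g u) (normalize g u - normalize h u);
  rewrite /d in H b2; lra.
Qed.

(** The hypothesis on [h] says that its biconjugate energy is at most [c]. The penalised
    near-minimisers, once normalized, converge uniformly to the normalization of [h] with energies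
    at most [c + 1 / (n + 1)], and lower semicontinuity concludes; invariance under linear functions
    then undoes the normalization. *)
Lemma fenchel_bidual : calC h /\ renergy h <= c.
Proof.
have [gn gnP] : {gn : nat -> S2 R -> R & forall n, [/\ calC (gn n),
    renergy (gn n) <= c + n.+1%:R^-1 &
    forall u, `|normalize (gn n) u - normalize h u| <= n.+1%:R^-1]}.
  have H n : {g : S2 R -> R | [/\ calC g, renergy g <= c + n.+1%:R^-1 &
      forall u, `|normalize g u - normalize h u| <= n.+1%:R^-1]}.
    by apply: cid; apply: uniform_error; rewrite invr_gt0.
  by exists (fun n => projT1 (H n)) => n; exact: (projT2 (H n)).
have CN := C_S2_normalize Ch.
have Cn n : calC (normalize (gn n)) by have [C _ _] := gnP n; exact: calC_linS2.
have [] := @renergy_lsc _ (fun n => normalize (gn n)) (normalize h) 3 c (fun n => c + n.+1%:R^-1) Cn CN.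
- by move=> n u; have [C _ _] := gnP n; exact: (calC_normalize_bound C).1.
- move=> u; apply/cvgrPdist_le => e e0; near=> n; have [_ _ H] := gnP n.
  rewrite distrC (le_trans (H u))// ltW//; near: n; exact: (near_infty_natSinv_lt (PosNum e0)).
- by move=> n; have [C E _] := gnP n; rewrite renergy_lin.
- rewrite -[X in _ --> X]addr0; apply: cvgD; first exact: cvg_cst.
  exact: cvg_harmonic.
move=> Cnh; have hE : h = normalize h \+ linS2 (axis_coef h).
  by apply/funext => u; rewrite /normalize /linS2 /= dotpNl subrK.
by move=> E; rewrite hE; split; [exact: calC_linS2|rewrite renergy_lin].
Unshelve. all: by end_near. Qed.

End fenchel.

(** The subgradient inequality bounds the biconjugate at [- g] by [<zeta, - g> - E^*(zeta)].
    Biduality makes this a bound on [E(- g)], Young's inequality is the converse, and [E] is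
    even. *)
Lemma d_energy_conjP zeta g : Pperp zeta -> C_S2 g ->
  d_energy_conj zeta (fun u => - g u) ->
  calC g /\ renergy_conj zeta = - pairing zeta g - renergy g.
Proof.
move=> Pz Cg [CN sub].
have E := energy_conjE Pz.
have H eta : Pperp eta -> ((pairing eta (fun u => - g u))%:E <=
    (pairing zeta (fun u => - g u) - renergy_conj zeta)%:E + energy_conj eta)%E.
  move=> Pe; have := sub _ Pe; rewrite E (energy_conjE Pe) pairing_csub// -!EFinD !lee_fin.
  by lra.
have [CgN le] := fenchel_bidual CN H.
have NN : (fun u => - (fun u => - g u) u) = g by apply/funext => u; rewrite opprK.
have C : calC g by rewrite -NN; exact: calC_opp.
have EN := renergy_opp C; rewrite EN in le; split=> //.
have := energy_conj_ge zeta CgN; rewrite E lee_fin EN; rewrite pairingN// in le *.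
by lra.
Qed.

End conjugate.

(** * Absolutely continuous functions *)

Section time_measure.
Context {R : realType}.
Local Notation leb := (@completed_lebesgue_measure R).
Local Notation mR := (measurableTypeR R).

Lemma measurable_time_id : measurable_fun setT (fun t : time R => t : mR).
Proof. by move=> _ A mA; rewrite setTI; exact: sub_caratheodory. Qed.

Lemma measurable_time (A : set R) : measurable (A : set mR) -> measurable (A : set (time R)).
Proof. by move=> mA; have := measurable_time_id measurableT mA; rewrite setTI. Qed.

Lemma measurable_time_itv (i : interval R) : measurable ([set` i] : set (time R)).
Proof. by apply: measurable_time; exact: measurable_itv. Qed.

(** Densities are constructed and differentiated on Borel sets, whereas curves are measurable for
    the larger family of Lebesgue sets. The identity map transfers integrals from one setting to the
    other. *)
Lemma time_preserving : measure_preserving leb (@lebesgue_measure R) (fun t : time R => t : mR).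
Proof. by split; [exact: measurable_time_id|]. Qed.

Lemma measurable_fun_time d (T : measurableType d) (f : R -> T) (D : set R) :
  measurable (D : set mR) -> measurable_fun (D : set mR) f -> measurable_fun (D : set (time R)) f.
Proof. by move=> mD mf _ A mA; apply: measurable_time; exact: mf. Qed.

Lemma ae_time (P : R -> Prop) : {ae @lebesgue_measure R, forall t, P t} -> {ae leb, forall t, P t}.
Proof. by move=> [N [mN N0 PN]]; exists N; split => //; exact: measurable_time. Qed.

Lemma leb_set1 (a : R) : leb [set a] = 0%E.
Proof. exact: lebesgue_measure_set1. Qed.

End time_measure.

(** * Densities of monotone functions dominated by an absolutely continuous one *)

Section lebesgue_stieltjes_dominated.
Context {R : realType}.
Local Notation mR := (measurableTypeR R).
Local Notation mu := (@lebesgue_measure R).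
Variable nu : {finite_measure set mR -> \bar R}.
Variables F C : R -> R.
Hypothesis FE : forall a b, a <= b -> nu `]a, b]%classic = (F b - F a)%:E.
Hypothesis Cnd : {homo C : x y / x <= y}.
Hypothesis CF : forall a b, a <= b -> C b - C a <= F b - F a.
Hypothesis Fc : continuous F.

Let Fnd : {homo F : x y / x <= y}.
Proof. by move=> a b ab; have := CF ab; have := Cnd ab; lra. Qed.

Let Dnd : {homo (fun x => F x - C x) : x y / x <= y}.
Proof. by move=> a b ab; have := CF ab; lra. Qed.

Let CcF (g : R -> R) : {homo g : x y / x <= y} -> (forall a b, a <= b -> g b - g a <= F b - F a) ->
  continuous g.
Proof.
move=> gnd gF x; apply/cvgrPdist_le => e e0.
have Fx : F y @[y --> x] --> F x by exact: Fc.
move/cvgrPdist_le : Fx => /(_ _ e0); apply: filterS => y.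
case: (leP x y) => [xy|/ltW yx].
  have q1 : 0 <= F y - F x by rewrite subr_ge0 Fnd.
  have q2 : 0 <= g y - g x by rewrite subr_ge0 gnd.
  rewrite (distrC (F x)) (distrC (g x)) (ger0_norm q1) (ger0_norm q2).
  by apply: le_trans; exact: gF.
have q1 : 0 <= F x - F y by rewrite subr_ge0 Fnd.
have q2 : 0 <= g x - g y by rewrite subr_ge0 gnd.
by rewrite (ger0_norm q1) (ger0_norm q2); apply: le_trans; exact: gF.
Qed.

Let Cc : continuous C. Proof. exact: CcF. Qed.
Let Dc : continuous (fun x => F x - C x).
Proof. by move=> x; apply: cvgB; [exact: Fc|exact: Cc]. Qed.

Let mkcum (g : R -> R) (gnd : {homo g : x y / x <= y}) (gc : continuous g) : cumulative R R :=
  HB.pack g (isCumulative.Build R _ R g gnd (right_continuousW gc)).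

Let ls g gnd gc := lebesgue_stieltjes_measure (@mkcum g gnd gc).

Let lsE g gnd gc (a b : R) : a <= b -> @ls g gnd gc `]a, b]%classic = (g b - g a)%:E.
Proof.
move=> ab; have := measurable_mu_extE (wlength (@mkcum g gnd gc)) (is_ocitv a b).
by move=> H; apply: (etrans H); exact: wlength_itv_bnd.
Qed.

Let lsC := ls Cnd Cc. Let lsD := ls Dnd Dc. Let lsF := ls Fnd Fc.

Let ocitvE (X : set R) : ocitv X -> X = set0 \/ exists a b, a <= b /\ X = `]a, b]%classic.
Proof. by move=> /ocitvP[->|[x x12 ->]]; [left|right; exists x.1, x.2; split => //; exact: ltW]. Qed.

Let lsF_nu A : measurable A -> lsF A = nu A.
Proof.
apply: lebesgue_stieltjes_measure_unique => X /ocitvE[->|[a [b [ab ->]]]].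
  by rewrite !measure0.
by apply: (etrans (lsE Fnd Fc ab)); exact/esym/FE.
Qed.

Let lsF_sum A : measurable A -> lsF A = (lsC A + lsD A)%E.
Proof.
move=> mA; have H : lsF A = measure_add lsC lsD A.
  apply: lebesgue_stieltjes_measure_unique mA => X /ocitvE[->|[a [b [ab ->]]]].
    by rewrite !measure0.
  have eC : lsC `]a, b]%classic = (C b - C a)%:E by exact: lsE.
  have eD : lsD `]a, b]%classic = (F b - C b - (F a - C a))%:E by exact: (lsE Dnd Dc).
  apply: etrans _ (esym (measure_addE lsC lsD _)).
  apply: etrans _ (esym (f_equal2 adde eC eD)).
  apply: (etrans (lsE Fnd Fc ab)).
  by suff -> : F b - F a = C b - C a + (F b - C b - (F a - C a)) by []; ring.
by rewrite H measure_addE.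
Qed.

Let lsC_le A : measurable A -> (lsC A <= nu A)%E.
Proof. by move=> mA; rewrite -lsF_nu// lsF_sum// leeDl. Qed.

Hypothesis nu_mu : nu `<< mu.

(** [F] is the sum of the nondecreasing functions [C] and [F - C], so the Stieltjes measure of [C]
    is below [nu], hence absolutely continuous, and Radon-Nikodym applies. *)
Lemma dominated_density : exists psi : R -> R, mu.-integrable setT (EFin \o psi) /\
  forall a b, a <= b -> C b - C a = \int[mu]_(t in `]a, b]) psi t.
Proof.
have fin : fin_num_fun lsC.
  move=> A mA; rewrite ge0_fin_numE//; apply: le_lt_trans (lsC_le mA) _.
  by rewrite ltey_eq fin_num_measure.
pose m : {finite_measure set mR -> \bar R} :=
  HB.pack (lsC : set mR -> \bar R) (Measure.on lsC) (Measure_isFinite.Build _ _ _ lsC fin).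
have dom : m `<< mu.
  move=> N HN A mA AN; have nA : nu A = 0%E by exact: nu_mu HN A mA AN.
  suff : lsC A = 0%E by [].
  by apply/eqP; rewrite -measure_le0 -nA lsC_le.
have [rho [rho0 rhofin irho rhoE]] := radon_nikodym_sigma_finite dom.
have rhofE : EFin \o (fine \o rho) = rho by apply/funext => x /=; rewrite fineK.
exists (fine \o rho); split; first by rewrite rhofE.
move=> a b ab; apply/EFin_inj; rewrite -(lsE Cnd Cc ab).
have H := rhoE _ (@measurable_itv R `]a, b]); apply: (etrans H).
have mi : measurable (`]a, b]%classic : set mR) by exact: measurable_itv.
have irho' : mu.-integrable (`]a, b]%classic : set mR) rho by apply: integrableS irho.
have fi := @integrable_fin_num _ _ _ mu _ mi _ irho'.
have E : \int[mu]_(t in `]a, b]) (fine \o rho) t = fine (\int[mu]_(t in `]a, b]%classic) rho t)%E.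
  by rewrite /Rintegral; congr fine; apply: eq_integral => x _ /=; rewrite fineK.
by rewrite E fineK.
Qed.

End lebesgue_stieltjes_dominated.

Section absolutely_continuous_functions.
Context {R : realType}.
Local Notation leb := (@completed_lebesgue_measure R).
Local Notation mR := (measurableTypeR R).
Local Notation mu := (@lebesgue_measure R).
Variable f : time R -> R.
Hypothesis intf : leb.-integrable setT (EFin \o f).
Hypothesis f0 : forall t, 0 <= f t.

Let nu0 := induced_charge intf.
Let nu0_ge0 A : (0 <= nu0 A)%E.
Proof. by apply: integral_ge0 => t _; rewrite lee_fin. Qed.
Let nu1 : {measure set (time R) -> \bar R} := measure_of_charge nu0 nu0_ge0.
Let nu2 := push_measure nu1 (@measurable_time_id R).
Let nu2E (A : set R) : nu2 A = (\int[leb]_(t in A) (f t)%:E)%E.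
Proof. by rewrite /nu2 push_measureE. Qed.
Let nu2fin : fin_num_fun nu2.
Proof.
move=> A mA; rewrite nu2E; apply: integrable_fin_num; first exact: measurable_time.
by apply: integrableS intf => //; exact: measurable_time.
Qed.
Let nu : {finite_measure set mR -> \bar R} :=
  HB.pack (nu2 : set mR -> \bar R) (Measure.on nu2) (Measure_isFinite.Build _ _ _ nu2 nu2fin).

Let nuE (A : set R) : nu A = (\int[leb]_(t in A) (f t)%:E)%E.
Proof. exact: nu2E. Qed.

Let nu_mu : nu `<< mu.
Proof.
move=> N HN A mA AN; rewrite nuE; have A0 := HN A mA AN.
apply: null_set_integral; [exact: measurable_time| |exact: A0].
by apply: measurable_funTS; exact: (measurable_int _ intf).
Qed.

Let F x := fine (nu `]-oo, x]%classic).

Let FE a b : a <= b -> nu `]a, b]%classic = (F b - F a)%:E.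
Proof.
move=> ab; have mi (i : interval R) : measurable ([set` i] : set mR) by exact: measurable_itv.
have E : `]-oo, b]%classic = `]-oo, a]%classic `|` `]a, b]%classic :> set mR.
  by rewrite -itv_bndbnd_setU// bnd_simp.
have E2 : nu `]-oo, b]%classic = (nu `]-oo, a]%classic + nu `]a, b]%classic)%E.
  rewrite E; apply: measureU => //; apply/seteqP; split=> // x [] /=.
  by rewrite !in_itv/= => xa /andP[ax _]; move: (lt_le_trans ax xa); rewrite ltxx.
have f1 := fin_num_measure nu _ (mi `]-oo, a]); have f2 := fin_num_measure nu _ (mi `]a, b]).
by rewrite /F E2 fineD// addrC addKr fineK.
Qed.

Let F_le e : 0 < e -> exists2 d, 0 < d & forall a b, a <= b -> b - a < d -> F b - F a <= e.
Proof.
move=> e0; have [d [d0 H]] := integral_normr_continuous intf e0; exists d => // a b ab bad.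
have mi : measurable (`]a, b]%classic : set (time R)) by exact: measurable_time_itv.
have /(H _ mi) : (leb `]a, b]%classic < d%:E)%E.
  have -> : leb `]a, b]%classic = (b - a)%:E.
    apply: (etrans (lebesgue_measure_itv `]a, b])) => /=; rewrite lte_fin EFinN.
    by case: ltP => // ba; rewrite (@le_anti _ _ a b) ?ab// subrr.
  by rewrite lte_fin.
move=> /ltW; apply: le_trans; rewrite -lee_fin -FE// nuE.
under eq_Rintegral do rewrite ger0_norm//.
by rewrite /Rintegral fineK//; apply: integrable_fin_num => //; exact: integrableS intf.
Qed.

Let Fnd : {homo F : x y / x <= y}.
Proof. by move=> a b ab; rewrite -subr_ge0 -lee_fin -FE. Qed.

Let Fc : continuous F.
Proof.
move=> x; apply/cvgrPdist_le => e e0; have [d d0 H] := F_le e0.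
apply/nbhs_ballP; exists d => // y; rewrite /ball/= => xyd.
have [xy|/ltW yx] := leP x y.
  rewrite (distrC x) in xyd; rewrite (distrC (F x)) ger0_norm ?subr_ge0 ?Fnd//; apply: H => //.
  by rewrite ger0_norm ?subr_ge0 in xyd.
rewrite ger0_norm ?subr_ge0 ?Fnd//; apply: H => //.
by rewrite ger0_norm ?subr_ge0 in xyd.
Qed.

Variable W : R -> R.
Hypothesis WF : forall a b, a <= b ->
  (`|W b - W a|%:E <= \int[leb]_(t in `]a, b]%classic) (f t)%:E)%E.

Let WF' a b : a <= b -> `|W b - W a| <= F b - F a.
Proof. by move=> ab; have := WF ab; rewrite -nuE FE. Qed.

(** A function whose increments are bounded by an indefinite integral is itself one, and it is
    differentiable almost everywhere with its density as derivative. *)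
Theorem ac_density : exists psi : R -> R,
  [/\ mu.-integrable setT (EFin \o psi),
   forall a b, a <= b -> W b - W a = \int[mu]_(t in `]a, b]) psi t &
   {ae mu, forall x, (W (x + h) - W x) / h @[h --> 0^'] --> psi x}].
Proof.
(* Since the increments of [W] are at most those of [F] in absolute value, [C] is nondecreasing and
   dominated by [F]; [W] is recovered as [2 C - F]. *)
pose C x := (F x + W x) / 2.
have Cnd : {homo C : x y / x <= y}.
  by move=> a b ab; have := WF' ab; rewrite ler_norml /C => /andP[? ?]; lra.
have CF a b : a <= b -> C b - C a <= F b - F a.
  by move=> ab; have := WF' ab; rewrite ler_norml /C => /andP[? ?]; lra.
have [p1 [ip1 p1E]] := dominated_density FE Cnd CF Fc nu_mu.
have [p2 [ip2 p2E]] := dominated_density FE Fnd (fun a b _ => lexx (F b - F a)) Fc nu_mu.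
pose psi x := 2 * p1 x - p2 x.
have mT : measurable (setT : set mR) by exact: measurableT.
have i1 : mu.-integrable (setT : set mR) (EFin \o (fun x => 2 * p1 x)).
  exact: (@integrableZl _ mR _ mu setT mT 2 _ ip1).
have ipsi : mu.-integrable (setT : set mR) (EFin \o psi) by exact: (integrableB mT i1 ip2).
have WE a b : a <= b -> W b - W a = \int[mu]_(t in `]a, b]) psi t.
  move=> ab; have mi : measurable (`]a, b]%classic : set mR) by exact: measurable_itv.
  have j1 : mu.-integrable (`]a, b]%classic : set mR) (EFin \o p1) by exact: integrableS ip1.
  have j2 : mu.-integrable (`]a, b]%classic : set mR) (EFin \o p2) by exact: integrableS ip2.
  have j3 : mu.-integrable (`]a, b]%classic : set mR) (EFin \o (fun x => 2 * p1 x)).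
    exact: integrableS i1.
  have E1 := RintegralB mi j3 j2; have E2 := RintegralZl 2 mi j1.
  by apply/esym; apply: (etrans E1); rewrite E2 -p1E// -p2E// /C; field.
exists psi; split => //.
have iNy y : mu.-integrable `]-oo, y]%classic (EFin \o psi).
  by apply: (@integrableS _ mR _ mu setT) => //; exact: measurable_itv.
have loc : locally_integrable setT psi by apply: open_integrable_locally => //; exact: openT.
have := FTC1Ny iNy loc.
set H := fun x : R => \int[mu]_(t in `]-oo, x]) psi t => /= aeH.
(* [H] and [W] differ by a constant, so the fundamental theorem of calculus for [H] differentiates
   [W]. *)
have HE a b : a <= b -> H b - H a = W b - W a.
  by move=> ab; rewrite WE// /H; apply: Rintegral_itvB => //; rewrite ?bnd_simp.
have HE' a b : H b - H a = W b - W a.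
  have [ab|/ltW ba] := leP a b; first exact: HE.
  by have := HE _ _ ba; lra.
move: aeH; apply: filterS; first exact: (ae_filter_ringOfSetsType mu).
move=> x [dH H'x].
have : h^-1 *: ((H \o shift x) (h *: 1) - H x) @[h --> 0^'] --> psi x.
  by rewrite -H'x derive1E; exact: dH.
suff -> : (fun h => h^-1 *: ((H \o shift x) (h *: 1) - H x)) = (fun h => (W (x + h) - W x) / h) by [].
apply/funext => h /=; rewrite -[_ *: _]/(_ * _) -[h *: 1]/(h * 1) mulr1 [h + x]addrC HE'.
exact: mulrC.
Qed.

End absolutely_continuous_functions.

(** * Dual norm and curves in the dual space *)

Section time_integrals.
Context {R : realType}.
Local Notation leb := (@completed_lebesgue_measure R).
Implicit Types (f : time R -> R).

Lemma leb_integrable_sub f (a b c d : R) : c <= a -> b <= d ->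
  leb.-integrable `[c, d]%classic (EFin \o f) -> leb.-integrable `[a, b]%classic (EFin \o f).
Proof.
move=> ca bd; apply: integrableS; [exact: measurable_time_itv|exact: measurable_time_itv|].
by apply: subset_itv; rewrite bnd_simp.
Qed.

Lemma leb_integral_oc (f : time R -> \bar R) (a b : R) : a <= b ->
  leb.-integrable `[a, b]%classic f ->
  (\int[leb]_(t in `[a, b]%classic) f t = \int[leb]_(t in `]a, b]%classic) f t)%E.
Proof.
move=> ab intf; have m1 : measurable ([set a] : set (time R)).
  by apply: measurable_time; exact: measurable_set1.
have m2 : measurable (`[a, b]%classic : set (time R)) by exact: measurable_time_itv.
have H := negligible_integral m1 m2 intf (leb_set1 a).
apply: (etrans H); congr (integral _ _ _); apply/seteqP; split => x /=; rewrite !in_itv/=.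
  by move=> [/andP[ax ->] /eqP xa]; rewrite lt_neqAle eq_sym xa ax.
by move=> /andP[ax ->]; rewrite (ltW ax); split=> // xa; move: ax; rewrite xa ltxx.
Qed.

Lemma leb_Rintegral_split f (a b c : R) : a <= b -> b <= c ->
  leb.-integrable `[a, c]%classic (EFin \o f) ->
  \int[leb]_(t in `[a, c]%classic) f t =
  \int[leb]_(t in `[a, b]%classic) f t + \int[leb]_(t in `[b, c]%classic) f t.
Proof.
move=> ab bc intf; have ibc := leb_integrable_sub ab (lexx c) intf.
have E : \int[leb]_(t in `[b, c]%classic) f t = \int[leb]_(t in `]b, c]%classic) f t.
  by rewrite /Rintegral leb_integral_oc.
have S : `[a, c]%classic = `[a, b]%classic `|` `]b, c]%classic :> set (time R).
  by rewrite -itv_bndbnd_setU// bnd_simp.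
rewrite E S; apply: Rintegral_setU; [exact: measurable_time_itv|exact: measurable_time_itv| |].
  by rewrite -S.
apply/disj_setPS => x [] /=; rewrite !in_itv/= => /andP[_ xb] /andP[bx _].
by move: (lt_le_trans bx xb); rewrite ltxx.
Qed.

Lemma leb_Rintegral_point f (a : R) : leb.-integrable `[a, a]%classic (EFin \o f) ->
  \int[leb]_(t in `[a, a]%classic) f t = 0.
Proof.
move=> intf; rewrite /Rintegral leb_integral_oc// set_itv_ge ?bnd_simp ?ltxx//.
by rewrite integral_set0.
Qed.

Lemma leb_itv (a b : R) : a <= b -> leb `[a, b]%classic = (b - a)%:E.
Proof.
move=> ab; apply: (etrans (lebesgue_measure_itv `[a, b])) => /=; rewrite lte_fin EFinN.
by case: ltP => // ba; rewrite (@le_anti _ _ a b) ?ab// subrr.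
Qed.

Lemma leb_Rintegral_cst (c a b : R) : a <= b ->
  \int[leb]_(t in `[a, b]%classic) c = c * (b - a).
Proof.
move=> ab; have m2 : measurable (`[a, b]%classic : set (time R)) by exact: measurable_time_itv.
have H := @Rintegral_cst _ _ _ leb _ m2 c; apply: (etrans H); congr (_ * _).
exact: (congr1 fine (leb_itv ab)).
Qed.

Lemma leb_integrable_cst (c a b : R) : leb.-integrable `[a, b]%classic (EFin \o (fun _ : time R => c)).
Proof.
have [ab|ba] := leP a b; last first.
  rewrite set_itv_ge ?bnd_simp -?ltNge//; exact: integrable_set0.
apply: measurable_bounded_integrable.
- exact: measurable_time_itv.
- apply: le_lt_trans _ (ltry (b - a)); rewrite le_eqVlt; apply/orP; left.
  by apply/eqP; exact: leb_itv.
- exact: measurable_cst.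
- by exists `|c|; split; [exact: num_real|move=> x Mx z /= _; exact: ltW].
Qed.

End time_integrals.

Section dual_norm_theory.
Context {R : realType}.
Implicit Types (g : S2 R -> R) (eta zeta : M_S2 R).

Lemma quot_norm_le_bound g (M : R) : C_S2 g -> (forall u, `|g u| <= M) -> quot_norm g <= M.
Proof.
move=> Cg gM; apply: le_trans (quot_norm_le 0 Cg) _; apply: sup_norm_le => u.
by rewrite /= /linS2 dotp0l addr0.
Qed.

(** A class of norm at most 1 has a representative of sup norm below 2, the excess leaving room for
    the infimum, and [eta] takes the same value on both. *)
Lemma has_sup_dual_norm eta : Pperp eta ->
  has_sup [set pairing eta g | g in @C_S2 R `&` [set g | quot_norm g <= 1]].
Proof.
move=> Pe; split.
  exists (pairing eta (fun=> 0)), (fun=> 0) => //; split; first exact: C_S2_0.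
  by apply: quot_norm_le_bound; [exact: C_S2_0|move=> u; rewrite normr0].
have [K K0 hK] := pairing_bounded eta; exists (K * 2) => _ [g [Cg /= g1] <-].
have [a ga] : exists a, sup_norm (g \+ linS2 a) < 2.
  by apply: quot_norm_lt => //; rewrite (le_lt_trans g1)// ltr1n.
have C2 := @C_S2_linS2 _ a; have C3 := C_S2D Cg C2.
have -> : pairing eta g = pairing eta (g \+ linS2 a) by rewrite pairingD// Pe addr0.
rewrite (le_trans (ler_norm _))//; apply: hK => // u.
by rewrite (le_trans (sup_norm_ub u C3))// ltW.
Qed.

Lemma pairing_le_dual eta g : Pperp eta -> C_S2 g -> quot_norm g <= 1 ->
  pairing eta g <= dual_norm eta.
Proof.
by move=> Pe Cg g1; apply: ub_le_sup; [have [] := has_sup_dual_norm Pe|exists g].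
Qed.

Lemma dual_norm_ge0 eta : Pperp eta -> 0 <= dual_norm eta.
Proof.
move=> Pe; rewrite -(pairing0 eta); apply: pairing_le_dual => //; first exact: C_S2_0.
by apply: quot_norm_le_bound; [exact: C_S2_0|move=> u; rewrite normr0].
Qed.

Lemma norm_pairing_le eta g (M : R) : Pperp eta -> C_S2 g -> 0 < M ->
  (forall u, `|g u| <= M) -> `|pairing eta g| <= M * dual_norm eta.
Proof.
move=> Pe Cg M0 gM.
have H h : C_S2 h -> (forall u, `|h u| <= M) -> pairing eta h <= M * dual_norm eta.
  move=> Ch hM; rewrite mulrC -ler_pdivrMr// mulrC -pairingZ//; apply: pairing_le_dual => //.
    exact: C_S2Z.
  apply: quot_norm_le_bound; first exact: C_S2Z.
  by move=> u; rewrite normrM normfV (gtr0_norm M0) mulrC ler_pdivrMr// mul1r.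
rewrite ler_norml H// andbT lerNl -pairingN//; apply: H; first exact: C_S2N.
by move=> u; rewrite normrN.
Qed.

Lemma dual_norm_le eta (N : R) : Pperp eta ->
  (forall g, C_S2 g -> quot_norm g <= 1 -> pairing eta g <= N) -> dual_norm eta <= N.
Proof.
move=> Pe H; apply: ge_sup; first by have [] := has_sup_dual_norm Pe.
by move=> _ [g [Cg g1] <-]; exact: H.
Qed.

Lemma Pperp_csub eta zeta : Pperp eta -> Pperp zeta -> Pperp (csub eta zeta).
Proof.
by move=> Pe Pz a; rewrite pairing_csub ?Pe ?Pz ?subrr//; exact: C_S2_linS2.
Qed.

Lemma Pperp_cscale (k : R) eta : Pperp eta -> Pperp (cscale k eta).
Proof. by move=> Pe a; rewrite pairing_cscale ?Pe ?mulr0//; exact: C_S2_linS2. Qed.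

End dual_norm_theory.

Lemma measurable_nonneg_times (R : realType) : measurable (@nonneg_times R).
Proof.
have -> : @nonneg_times R = `[0, +oo[%classic.
  by apply/seteqP; split => t /=; rewrite in_itv/= andbT.
exact: measurable_time_itv.
Qed.

(** * Measurability of the energy along a measurable family of classes *)

Section energy_measurable.
Context {R : realType}.
Implicit Types (g : S2 R -> R).

Lemma energy_notin g : ~ calC g -> energy g = +oo%E.
Proof. by move=> nC; rewrite /energy asboolF. Qed.

(** Lower semicontinuity on the quotient, in the form that [class_measurable] can use. Were the set
    not open at [g], suitably translated functions of energy at most [c] would converge uniformly to
    [g]; finiteness of their energy places them in [calC]. *)
Lemma quot_open_energy (c : R) : quot_open [set g : S2 R -> R | (c%:E < energy g)%E].
Proof.
move=> g Cg /= cg.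
have [//|H] := pselect (exists2 e : R, 0 < e & forall h, C_S2 h -> quot_norm (h \- g) < e ->
  (c%:E < energy h)%E).
exfalso.
have {}H n : exists h, [/\ calC h, renergy h <= c & forall u, `|h u - g u| <= n.+1%:R^-1].
  have e0 : 0 < n.+1%:R^-1 :> R by rewrite invr_gt0.
  have [h [Ch hg hc]] : exists h, [/\ C_S2 h, quot_norm (h \- g) < n.+1%:R^-1 &
      ~~ (c%:E < energy h)%E].
    apply: contrapT => H2; apply: H; exists n.+1%:R^-1 => // h Ch hg.
    by apply: contrapT => /negP H3; apply: H2; exists h.
  have C : calC h.
    apply: contrapT => nC; move: hc; rewrite energy_notin// ltry//.
  have [E _ _] := renergyP C; move: hc; rewrite E lte_fin -leNgt => hc.
  have Chg := C_S2B Ch Cg.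
  have [a ha] := quot_norm_lt Chg hg.
  exists (h \+ linS2 a); split; [exact: calC_linS2|by rewrite renergy_lin|].
  move=> u; have C2 := C_S2D Chg (@C_S2_linS2 _ a).
  apply: le_trans (ltW ha); apply: le_trans _ (sup_norm_ub u C2).
  by rewrite /= addrAC.
have [hn hnP] : {hn : nat -> S2 R -> R & forall n, [/\ calC (hn n), renergy (hn n) <= c &
    forall u, `|hn n u - g u| <= n.+1%:R^-1]}.
  by exists (fun n => projT1 (cid (H n))) => n; exact: (projT2 (cid (H n))).
have [M M0 gM] := continuous_S2_bounded Cg.
have h1 n : calC (hn n) by have [] := hnP n.
have h2 n u : `|hn n u| <= M + 1.
  have [_ _ /(_ u) h] := hnP n; rewrite -(subrK (g u) (hn n u)).
  rewrite (le_trans (ler_normD _ _))// addrC lerD// (le_trans h)//.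
  by rewrite invf_le1// ler1n.
have h3 u : hn n u @[n --> \oo] --> g u.
  apply/cvgrPdist_le => e e0; near=> n; have [_ _ /(_ u) h] := hnP n.
  rewrite distrC (le_trans h)// ltW//; near: n; exact: (near_infty_natSinv_lt (PosNum e0)).
have h4 n : renergy (hn n) <= c by have [] := hnP n.
have [C E] := renergy_lsc h1 Cg h2 h3 h4 (cvg_cst c).
have [E2 _ _] := renergyP C; move: cg; rewrite E2 lte_fin => cg.
by move: (lt_le_trans cg E); rewrite ltxx.
Unshelve. all: by end_near. Qed.

Lemma class_measurable_energy (g : R -> S2 R -> R) : class_measurable g ->
  measurable_fun (@nonneg_times R) (fun t : time R => energy (g t)).
Proof.
move=> [_ gU].
have mN := @measurable_nonneg_times R.
apply: (measurability _ (ErealGenOInfty.measurableE R)).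
move=> _ [_ [c ->] <-].
have -> : @nonneg_times R `&` (fun t => energy (g t)) @^-1` `]c%:E, +oo[%classic =
   @nonneg_times R `&` [set t | (c%:E < energy (g t))%E].
  by apply/seteqP; split => t /=; rewrite in_itv/= andbT.
exact: gU (@quot_open_energy c).
Qed.

End energy_measurable.

Section almost_everywhere.
Context {R : realType}.
Local Notation leb := (@completed_lebesgue_measure R).
Implicit Types (f h : time R -> R).

Lemma ae_imply (P Q : R -> Prop) : (forall x, P x -> Q x) ->
  {ae leb, forall x, P x} -> {ae leb, forall x, Q x}.
Proof. by move=> PQ; apply: negligibleS => x /= nQ Px; apply: nQ; exact: PQ. Qed.

Lemma ae_interior (a b : R) (P : R -> Prop) : {ae leb, forall x : R, a < x -> x < b -> P x} ->
  {ae leb, forall x : R, `[a, b]%classic x -> P x}.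
Proof.
move=> H; have m1 (c : R) : measurable ([set c] : set (time R)).
  by apply: measurable_time; exact: measurable_set1.
have n1 (c : R) : leb.-negligible [set c] by exists [set c]; split => //; exact: leb_set1.
have := negligibleU H (negligibleU (n1 a) (n1 b)); apply: negligibleS => x /= /not_implyP[].
rewrite in_itv/= => /andP[ax xb] nP.
have [xa|xa] := eqVneq x a; first by right; left.
have [xb'|xb'] := eqVneq x b; first by right; right.
by left => Q; apply: nP; apply: Q; rewrite lt_neqAle ?ax ?xb ?andbT// eq_sym.
Qed.

Lemma ae_itv_eq_integrable f h (a b : R) :
  {ae leb, forall x : R, a < x -> x < b -> f x = h x} ->
  leb.-integrable `[a, b]%classic (EFin \o f) -> leb.-integrable `[a, b]%classic (EFin \o h).
Proof.
move=> /ae_interior fh intf.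
have mD : measurable (`[a, b]%classic : set (time R)) by exact: measurable_time_itv.
have ae1 : ae_eq leb `[a, b]%classic (EFin \o f) (EFin \o h).
  by apply: (ae_imply _ fh) => x H /H /= ->.
have mh := ae_measurable_fun (@completed_lebesgue_measure_is_complete R) ae1 (measurable_int _ intf).
have /integrableP[mf fI] := intf; apply/integrableP; split => //.
suff -> : (\int[leb]_(x in `[a, b]%classic) `|(EFin \o h) x| =
  \int[leb]_(x in `[a, b]%classic) `|(EFin \o f) x|)%E by [].
apply: ae_eq_integral; first exact: mD.
- by apply: measurableT_comp mh; exact: abse_measurable.
- by apply: measurableT_comp mf; exact: abse_measurable.
- by apply: (ae_imply _ fh) => x H /H /= ->.
Qed.

Lemma ae_itv_eq_Rintegral f h (a b : R) :
  {ae leb, forall x : R, a < x -> x < b -> f x = h x} ->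
  leb.-integrable `[a, b]%classic (EFin \o f) ->
  \int[leb]_(x in `[a, b]%classic) f x = \int[leb]_(x in `[a, b]%classic) h x.
Proof.
move=> fh intf; have inth := ae_itv_eq_integrable fh intf.
have mD : measurable (`[a, b]%classic : set (time R)) by exact: measurable_time_itv.
congr fine; apply: ae_eq_integral; [exact: mD|exact: (measurable_int _ intf)|exact: (measurable_int _ inth)|].
by apply: (ae_imply _ (ae_interior fh)) => x H /H /= ->.
Qed.

(** [h] is replaced by the maximum of [f] and [h], equal to it almost everywhere, so that the
    comparison holds at every point. *)
Lemma ae_itv_le_Rintegral f h (a b : R) :
  {ae leb, forall x : R, a < x -> x < b -> f x <= h x} ->
  leb.-integrable `[a, b]%classic (EFin \o f) -> leb.-integrable `[a, b]%classic (EFin \o h) ->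
  \int[leb]_(x in `[a, b]%classic) f x <= \int[leb]_(x in `[a, b]%classic) h x.
Proof.
move=> fh intf inth.
have mD : measurable (`[a, b]%classic : set (time R)) by exact: measurable_time_itv.
have E : {ae leb, forall x : R, a < x -> x < b -> h x = Num.max (f x) (h x)}.
  by apply: (ae_imply _ fh) => x H ax xb; rewrite max_r// H.
have i2 := ae_itv_eq_integrable E inth.
rewrite (ae_itv_eq_Rintegral E inth); apply: le_Rintegral => // x _.
by rewrite le_max lexx.
Qed.

(* Functions on [[s, T]] are extended by their end values. *)
Lemma ac_density_itv (s T : R) (k : time R -> R) (W : R -> R) : s <= T ->
  leb.-integrable `[s, T]%classic (EFin \o k) ->
  (forall t, s <= t -> t <= T -> 0 <= k t) ->
  (forall a b, s <= a -> a <= b -> b <= T -> `|W b - W a| <= \int[leb]_(t in `[a, b]%classic) k t) ->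
  exists psi : R -> R,
  [/\ leb.-integrable `[s, T]%classic (EFin \o (psi : time R -> R)),
   forall a b, s <= a -> a <= b -> b <= T -> W b - W a = \int[leb]_(t in `[a, b]%classic) psi t &
   {ae leb, forall x : R, s < x -> x < T -> (W (x + h) - W x) / h @[h --> 0^'] --> psi x}].
Proof.
move=> sT intk k0 Wk.
have mD : measurable (`[s, T]%classic : set (time R)) by exact: measurable_time_itv.
pose clip x := Num.max s (Num.min x T).
have clip1 x : s <= clip x by rewrite /clip le_max lexx.
have clip2 x : clip x <= T by rewrite /clip ge_max sT ge_min lexx orbT.
have clip3 x y : x <= y -> clip x <= clip y.
  by move=> xy; rewrite /clip; case: (leP x T) => ?; case: (leP y T) => ?;
    rewrite ?ge_max ?le_max ?lexx ?xy ?orbT//=; lra.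
have clipE x : s <= x -> x <= T -> clip x = x by move=> sx xT; rewrite /clip min_l// max_r.
pose f : time R -> R := (k : time R -> R) \_ `[s, T]%classic.
have fE t : s <= t -> t <= T -> f t = k t.
  by move=> st tT; rewrite /f patchE mem_set//= in_itv/= st tT.
have f0 t : 0 <= f t.
  by rewrite /f patchE; case: ifPn => // /set_mem/=; rewrite in_itv/= => /andP[]; exact: k0.
have intf : leb.-integrable setT (EFin \o f).
  have E := @integrable_mkcond _ _ _ leb (`[s, T]%classic : set (time R)) (EFin \o k) mD.
  have := iffLR E intk; congr (leb.-integrable _ _).
  by apply/funext => t /=; rewrite /f !patchE; case: ifP.
have mI (i : interval R) : measurable ([set` i] : set (time R)) by exact: measurable_time_itv.
have WF a b : a <= b ->
    (`|(W \o clip) b - (W \o clip) a|%:E <= \int[leb]_(t in `]a, b]%classic) (f t)%:E)%E.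
  move=> ab; have cab := clip3 _ _ ab.
  have ik : leb.-integrable `[clip a, clip b]%classic (EFin \o k).
    exact: leb_integrable_sub (clip1 a) (clip2 b) intk.
  have fin := integrable_fin_num (mI `[clip a, clip b]) ik.
  apply: (@le_trans _ _ (\int[leb]_(t in `[clip a, clip b]%classic) (k t)%:E)%E).
    by rewrite -(fineK fin) lee_fin; apply: Wk.
  rewrite (leb_integral_oc cab ik).
  have -> : (\int[leb]_(t in `]clip a, clip b]%classic) (k t)%:E =
     \int[leb]_(t in `]clip a, clip b]%classic) (f t)%:E)%E.
    apply: eq_integral => t /set_mem/=; rewrite in_itv/= => /andP[at' tb].
    by rewrite fE// (ltW (le_lt_trans (clip1 a) at'), le_trans tb (clip2 b)).
  apply: ge0_subset_integral; [exact: mI|exact: mI| | |].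
  - by apply: measurable_funTS; exact: measurable_int intf.
  - by move=> t _; rewrite lee_fin.
  - move=> t /=; rewrite !in_itv/= => /andP[at' tb].
    have st : s < t by exact: le_lt_trans (clip1 a) at'.
    have tT : t <= T by exact: le_trans tb (clip2 b).
    apply/andP; split.
      move: at'; rewrite /clip gt_max => /andP[_]; rewrite gt_min => /orP[//|Tt].
      by move: (lt_le_trans Tt tT); rewrite ltxx.
    move: tb; rewrite /clip le_max => /orP[ts|]; last by rewrite le_min => /andP[].
    by move: (lt_le_trans st ts); rewrite ltxx.
have [psi [ipsi WE aeW]] := ac_density intf f0 WF.
exists psi; split.
- have H := iffRL (integrable_preserving (@time_preserving R) measurableT (measurable_int _ ipsi)) ipsi.
  rewrite preimage_setT in H; apply: integrableS H => //.
- move=> a b sa ab bT; have sb := le_trans sa ab; have aT := le_trans ab bT.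
  have := WE _ _ ab; rewrite /= !clipE// => ->.
  have i1 := integrableS (@measurableT _ (measurableTypeR R)) (@measurable_itv R `]a, b]) (@subsetT _ _) ipsi.
  have E1 := Rintegral_preserving (@time_preserving R) (@measurable_itv R `]a, b]) (iffLR (measurable_EFinP _ _) (measurable_int _ i1)).
  apply: (etrans E1); rewrite /Rintegral leb_integral_oc//.
  have H := iffRL (integrable_preserving (@time_preserving R) measurableT (measurable_int _ ipsi)) ipsi.
  by rewrite preimage_setT in H; apply: integrableS H.
apply: (ae_imply _ (ae_time aeW)) => x cv sx xT.
apply: cvg_trans cv; apply: near_eq_cvg.
have d0 : 0 < Num.min (x - s) (T - x) by rewrite lt_min !subr_gt0 sx.
apply/nbhs_ballP; exists (Num.min (x - s) (T - x)) => //= h.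
rewrite /ball/= sub0r normrN lt_min !ltr_norml => /andP[/andP[h1 _] /andP[_ h2]] _.
have h3 : s <= x + h by rewrite -lerBlDl -opprB ltW.
have h4 : x + h <= T by rewrite -lerBrDl ltW.
by rewrite (clipE _ h3 h4) (clipE _ (ltW sx) (ltW xT)).
Qed.

End almost_everywhere.

Lemma norm_half_sqrB_le (R : realType) (N p q J : R) : 0 <= p <= N -> 0 <= q <= N ->
  `|p - q| <= J -> `|2^-1 * p ^+ 2 - 2^-1 * q ^+ 2| <= N * J.
Proof.
move=> /andP[p0 pN] /andP[q0 qN] pqJ.
have -> : 2^-1 * p ^+ 2 - 2^-1 * q ^+ 2 = 2^-1 * (p + q) * (p - q) by ring.
rewrite normrM ler_pM// ger0_norm; last by rewrite mulr_ge0// addr_ge0.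
by lra.
Qed.

(** * Absolutely continuous curves of measures *)

Section curves.
Context {R : realType}.
Local Notation leb := (@completed_lebesgue_measure R).
Variables xi xidot : R -> M_S2 R.
Hypothesis Pxi : Pperp_curve xi.
Hypothesis ACxi : absolutely_continuous_curve xi xidot.

Let Pdot : Pperp_curve xidot. Proof. by case: ACxi => _ []. Qed.

Lemma dual_norm_integrable (a b : R) : 0 <= a ->
  leb.-integrable `[a, b]%classic (EFin \o (fun t : time R => dual_norm (xidot t))).
Proof.
move=> a0; case: ACxi => _ [_ _ /(_ b) H] _.
exact: leb_integrable_sub a0 (lexx b) H.
Qed.

Lemma pairing_dot_integrable g (a b : R) : C_S2 g -> 0 <= a ->
  leb.-integrable `[a, b]%classic (EFin \o (fun t : time R => pairing (xidot t) g)).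
Proof.
move=> Cg a0; have [M M0 gM] := continuous_S2_bounded Cg.
have mD : measurable (`[a, b]%classic : set (time R)) by exact: measurable_time_itv.
have sub : (`[a, b]%classic : set (time R)) `<=` @nonneg_times R.
  by move=> t /=; rewrite in_itv/= => /andP[+ _]; exact: le_trans.
apply: (le_integrable mD _ _ (integrableZl mD M (dual_norm_integrable b a0))).
  apply/measurable_EFinP; apply: (measurable_funS (@measurable_nonneg_times R) sub).
  by case: ACxi => _ [_ H _] _; exact: (H g Cg).
move=> t tab /=; rewrite lee_fin (le_trans _ (ler_norm _))//.
by apply: norm_pairing_le => //; apply: Pdot; exact: sub.
Qed.

Lemma pairing_increment g (s t : R) : C_S2 g -> 0 <= s -> s <= t ->
  pairing (xi t) g - pairing (xi s) g = \int[leb]_(tau in `[s, t]%classic) pairing (xidot tau) g.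
Proof.
move=> Cg s0; rewrite le_eqVlt => /predU1P[<-|st].
  by rewrite subrr leb_Rintegral_point//; exact: pairing_dot_integrable.
by rewrite -pairing_csub//; case: ACxi => _ _; apply.
Qed.

(** Each admissible pairing moves by at most the integral of the speed, uniformly in the test
    function; taking suprema on both sides gives the bound for the norm. *)
Lemma dual_norm_increment (s t : R) : 0 <= s -> s <= t ->
  `|dual_norm (xi t) - dual_norm (xi s)| <=
  \int[leb]_(tau in `[s, t]%classic) dual_norm (xidot tau).
Proof.
move=> s0 st; have t0 := le_trans s0 st.
set I := Rintegral _ _ _.
have mD : measurable (`[s, t]%classic : set (time R)) by exact: measurable_time_itv.
have inc g : C_S2 g -> quot_norm g <= 1 -> `|pairing (xi t) g - pairing (xi s) g| <= I.
  have half h : C_S2 h -> quot_norm h <= 1 -> pairing (xi t) h - pairing (xi s) h <= I.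
    move=> Ch h1; rewrite pairing_increment//; apply: le_Rintegral => //.
    - exact: pairing_dot_integrable.
    - exact: dual_norm_integrable.
    - move=> tau /=; rewrite in_itv/= => /andP[st' _].
      by apply: pairing_le_dual => //; apply: Pdot; exact: le_trans st'.
  move=> Cg g1; rewrite ler_norml half// andbT.
  have qN : quot_norm (fun u => - g u) <= 1.
    apply/ler_addgt0Pr => e e0.
    have [a ga] : exists a, sup_norm (g \+ linS2 a) < 1 + e.
      by apply: quot_norm_lt => //; rewrite (le_lt_trans g1)// ltrDl.
    have C2 := C_S2D Cg (@C_S2_linS2 _ a).
    apply: le_trans (quot_norm_le (- a) (C_S2N Cg)) _; apply: sup_norm_le => u.
    rewrite /= /linS2 dotpNl -opprD normrN (le_trans (sup_norm_ub u C2))// ltW//.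
  by have := half _ (C_S2N Cg) qN; rewrite !pairingN//; lra.
rewrite ler_norml; apply/andP; split.
  rewrite lerBrDr addrC lerBlDr.
  apply: dual_norm_le; first exact: Pxi.
  move=> g Cg g1; have := inc g Cg g1; rewrite ler_norml => /andP[H _].
  by have := pairing_le_dual (Pxi t0) Cg g1; lra.
rewrite lerBlDr; apply: dual_norm_le; first exact: Pxi.
move=> g Cg g1; have := inc g Cg g1; rewrite ler_norml => /andP[_ H].
by have := pairing_le_dual (Pxi s0) Cg g1; lra.
Qed.

(* A pairing is the difference of two nondecreasing functions. *)
Lemma curve_weak_star_measurable : weak_star_measurable xi.
Proof.
move=> g Cg; have [M M0 gM] := continuous_S2_bounded Cg.
pose F t := \int[leb]_(tau in `[0, t]%classic) dual_norm (xidot tau).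
pose pos (t : R) := Num.max 0 t.
have pos0 t : 0 <= pos t by rewrite /pos le_max lexx.
have posnd s t : s <= t -> pos s <= pos t.
  by move=> st; rewrite /pos ge_max !le_max lexx st orbT.
have FS s t : 0 <= s -> s <= t -> F t - F s = \int[leb]_(tau in `[s, t]%classic) dual_norm (xidot tau).
  move=> s0 st; have H := leb_Rintegral_split s0 st (dual_norm_integrable t (lexx 0)).
  by rewrite /F H addrAC subrr add0r.
have Fnd s t : 0 <= s -> s <= t -> F s <= F t.
  move=> s0 st; rewrite -subr_ge0 FS//; apply: Rintegral_ge0 => tau /=.
  by rewrite in_itv/= => /andP[st' _]; apply: dual_norm_ge0; apply: Pdot; exact: le_trans st'.
have inc s t : 0 <= s -> s <= t -> `|pairing (xi t) g - pairing (xi s) g| <= M * (F t - F s).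
  move=> s0 st; rewrite pairing_increment// FS//.
  have mD : measurable (`[s, t]%classic : set (time R)) by exact: measurable_time_itv.
  have iD := dual_norm_integrable t s0.
  have E := RintegralZl M mD iD; rewrite -E.
  apply: le_trans (le_normr_Rintegral mD (pairing_dot_integrable t Cg s0)) _.
  apply: le_Rintegral => //.
  - exact: (integrable_norm (pairing_dot_integrable t Cg s0)).
  - exact: (integrableZl mD M iD).
  - move=> tau /=; rewrite in_itv/= => /andP[st' _].
    by apply: norm_pairing_le => //; apply: Pdot; exact: le_trans st'.
pose G1 (t : R) := M * F (pos t) + pairing (xi (pos t)) g.
pose G2 (t : R) := M * F (pos t).
have n1 : {homo G1 : x y / x <= y}.
  move=> s t st; have := inc _ _ (pos0 s) (posnd _ _ st).
  by rewrite ler_norml /G1 => /andP[+ _]; rewrite mulrBr; lra.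
have n2 : {homo G2 : x y / x <= y}.
  by move=> s t st; rewrite /G2 ler_wpM2l// ?(ltW M0)// Fnd// posnd.
have mT : measurable (setT : set (measurableTypeR R)) by exact: measurableT.
have m1 := measurable_fun_time mT (nondecreasing_measurable mT n1).
have m2 := measurable_fun_time mT (nondecreasing_measurable mT n2).
apply: (eq_measurable_fun (fun t : time R => G1 t - G2 t)).
  move=> t /set_mem t0; have pt : pos t = t by apply/max_idPr; exact: t0.
  by rewrite /G1 /G2 pt addrAC subrr add0r.
by apply: measurable_funTS; exact: (measurable_funB m1 m2).
Qed.

Definition half_sqr_norm (t : R) : R := 2^-1 * dual_norm (xi t) ^+ 2.

(** On [[0, T]] the norm is bounded by its initial value plus the length of the curve, and the
    square is Lipschitz on bounded sets. *)
Lemma half_sqr_norm_increment (T : R) : 0 <= T -> exists2 N, 0 <= N &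
  forall a b, 0 <= a -> a <= b -> b <= T -> `|half_sqr_norm b - half_sqr_norm a| <=
    \int[leb]_(tau in `[a, b]%classic) (N * dual_norm (xidot tau)).
Proof.
move=> T0; pose I := \int[leb]_(tau in `[0, T]%classic) dual_norm (xidot tau).
have I0 a b : 0 <= a -> 0 <= \int[leb]_(tau in `[a, b]%classic) dual_norm (xidot tau).
  move=> a0; apply: Rintegral_ge0 => tau /=.
  by rewrite in_itv/= => /andP[st' _]; apply: dual_norm_ge0; apply: Pdot; exact: le_trans st'.
pose N := dual_norm (xi 0) + I.
have N0 : 0 <= N by rewrite addr_ge0 ?I0// dual_norm_ge0//; exact: Pxi.
have xN t : 0 <= t -> t <= T -> dual_norm (xi t) <= N.
  move=> t0 tT; have := dual_norm_increment (lexx 0) t0; rewrite ler_norml => /andP[_ H].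
  have := leb_Rintegral_split t0 tT (dual_norm_integrable T (lexx 0)).
  rewrite -/I => E; rewrite lerBlDl in H.
  by apply: (le_trans H); rewrite lerD2l E lerDl I0.
exists N => // a b a0 ab bT; have b0 := le_trans a0 ab; have aT := le_trans ab bT.
have mD : measurable (`[a, b]%classic : set (time R)) by exact: measurable_time_itv.
have E := RintegralZl N mD (dual_norm_integrable b a0); rewrite E.
apply: norm_half_sqrB_le (dual_norm_increment a0 ab).
- by rewrite (dual_norm_ge0 (Pxi b0)) (xN _ b0 bT).
- by rewrite (dual_norm_ge0 (Pxi a0)) (xN _ a0 aT).
Qed.

End curves.

(** * Variation and energy balance *)

Lemma cvg_natSSinv (R : realType) : (n.+2%:R^-1 : R) @[n --> \oo] --> (0 : R).
Proof.
apply/cvgrPdist_le => e e0; near=> n; rewrite sub0r normrN ger0_norm ?invr_ge0//.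
apply: (@le_trans _ _ n.+1%:R^-1); first by rewrite lef_pV2 ?posrE// ler_nat.
by apply: ltW; near: n; exact: (near_infty_natSinv_lt (PosNum e0)).
Unshelve. all: by end_near. Qed.

Lemma path_lt_last_le (R : realType) (x : R) l : path <%R x l -> x <= last x l.
Proof. by elim: l x => //= y l IH x /andP[xy /IH]; apply: le_trans; exact: ltW. Qed.

Section variation.
Context {R : realType}.
Local Notation leb := (@completed_lebesgue_measure R).
Variables xi xidot : R -> M_S2 R.
Hypothesis Pxi : Pperp_curve xi.
Hypothesis ACxi : absolutely_continuous_curve xi xidot.
Variable T : R.
Let ce (t : R) : R := renergy_conj (xidot t).
Hypothesis ice : leb.-integrable `[0, T]%classic (EFin \o (ce : time R -> R)).

Let Pdot : Pperp_curve xidot. Proof. by case: ACxi => _ []. Qed.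

Let ce_ge0 t : 0 <= ce t. Proof. by rewrite fine_ge0// energy_conj_ge0. Qed.

Let ice_sub a b : 0 <= a -> b <= T -> leb.-integrable `[a, b]%classic (EFin \o (ce : time R -> R)).
Proof. by move=> a0 bT; exact: leb_integrable_sub a0 bT ice. Qed.

Definition mean_velocity (a b : R) : M_S2 R := cscale (b - a)^-1 (csub (xi b) (xi a)).

Definition step_cost (a b : R) : R := (b - a) * renergy_conj (mean_velocity a b).

Let Pmean a b : 0 <= a -> a <= b -> Pperp (mean_velocity a b).
Proof.
by move=> a0 ab; apply/Pperp_cscale/Pperp_csub; apply: Pxi => //; exact: le_trans ab.
Qed.

Lemma step_cost_ge0 a b : a <= b -> 0 <= step_cost a b.
Proof. by move=> ab; rewrite mulr_ge0 ?subr_ge0// fine_ge0// energy_conj_ge0. Qed.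

(** Scaling by the length of the interval turns the supremum defining [E^*] into one of
    [<xi(b) - xi(a), g> - (b - a) E(g)]. For a fixed [g] this is additive over adjacent intervals,
    so comparisons between costs reduce to adding inequalities for a single [g]. *)
Lemma step_cost_le a b (c : R) : 0 <= a -> a < b ->
  (forall g, calC g -> pairing (xi b) g - pairing (xi a) g - (b - a) * renergy g <= c) ->
  step_cost a b <= c.
Proof.
move=> a0 ab H; have d0 : 0 < b - a by rewrite subr_gt0.
rewrite /step_cost mulrC -ler_pdivlMr// -lee_fin -(energy_conjE (Pmean a0 (ltW ab))).
apply: energy_conj_le => g Cg; rewrite ler_pdivlMr//.
rewrite pairing_cscale ?pairing_csub; [|exact: calC_C_S2|exact: calC_C_S2].
apply: le_trans (H g Cg); rewrite mulrBl mulrC mulrA divff ?gt_eqF// mul1r [renergy g * _]mulrC.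
exact: lexx.
Qed.

Lemma step_cost_ge a b g : 0 <= a -> a < b -> calC g ->
  pairing (xi b) g - pairing (xi a) g - (b - a) * renergy g <= step_cost a b.
Proof.
move=> a0 ab Cg; have d0 : 0 < b - a by rewrite subr_gt0.
have := energy_conj_ge (mean_velocity a b) Cg.
rewrite (energy_conjE (Pmean a0 (ltW ab))) lee_fin.
rewrite pairing_cscale ?pairing_csub; [|exact: calC_C_S2|exact: calC_C_S2].
move=> /(ler_wpM2l (ltW d0)); rewrite mulrBr mulrA divff ?gt_eqF// mul1r.
by rewrite /step_cost.
Qed.

(** Jensen's inequality: for each [g], Young's inequality at time [t] is integrated over the
    interval before the supremum is taken. *)
Lemma step_cost_integral a b : 0 <= a -> a < b -> b <= T ->
  step_cost a b <= \int[leb]_(t in `[a, b]%classic) ce t.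
Proof.
move=> a0 ab bT; apply: step_cost_le => // g Cg; have Cg' := calC_C_S2 Cg.
have mD : measurable (`[a, b]%classic : set (time R)) by exact: measurable_time_itv.
have i1 := pairing_dot_integrable ACxi b Cg' a0.
have i2 := leb_integrable_cst (renergy g) a b.
rewrite (pairing_increment ACxi Cg' a0 (ltW ab)) mulrC -(leb_Rintegral_cst _ (ltW ab)).
have E := RintegralB mD i1 i2; rewrite -E; apply: le_Rintegral => //.
- exact: (integrableB mD i1 i2).
- exact: ice_sub.
- move=> t /=; rewrite in_itv/= => /andP[at' _]; rewrite -lee_fin.
  by rewrite /ce -energy_conjE; [exact: energy_conj_ge|apply: Pdot; exact: le_trans at'].
Qed.

Lemma step_cost_convex a x b : 0 <= a -> a < x -> x < b ->
  step_cost a b <= step_cost a x + step_cost x b.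
Proof.
move=> a0 ax xb; apply: step_cost_le => //; first exact: lt_trans xb.
move=> g Cg; have H1 := step_cost_ge a0 ax Cg.
have H2 := step_cost_ge (le_trans a0 (ltW ax)) xb Cg.
by apply: le_trans (lerD H1 H2); rewrite le_eqVlt; apply/orP; left; apply/eqP; ring.
Qed.

Fixpoint partition_cost (s : R) (l : seq R) : R :=
  if l is x :: l' then step_cost s x + partition_cost x l' else 0.

(** The default element of [nth] is kept apart from the initial point, which changes along the
    induction on the partition. *)
Let conj_sum (s0 s : R) (l : seq R) : \bar R := (\sum_(0 <= k < size l)
  let a := nth s0 (s :: l) k in let b := nth s0 (s :: l) k.+1 in
      (b - a)%:E * energy_conj (cscale (b - a)^-1 (csub (xi b) (xi a))))%E.

Let conj_sumE s0 s l : 0 <= s -> path <%R s l -> conj_sum s0 s l = (partition_cost s l)%:E.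
Proof.
elim: l s => [|x l IH] s s0' /=; first by rewrite /conj_sum /= big_geq.
move=> /andP[sx pl]; have x0 : 0 <= x by exact: le_trans (ltW sx).
rewrite /conj_sum /= big_nat_recl//= -[X in (_ + X)%E]/(conj_sum s0 x l) IH//.
rewrite -/(mean_velocity s x) energy_conjE; last exact: (Pmean s0' (ltW sx)).
by [].
Qed.

Definition rvariation (s t : R) : R := fine (conj_variation xi s t).

Lemma partition_cost_le s l : 0 <= s -> path <%R s l -> last s l <= T ->
  partition_cost s l <= \int[leb]_(t in `[s, last s l]%classic) ce t.
Proof.
elim: l s => [|x l IH] s s0 /=.
  by move=> _ sT; apply: Rintegral_ge0 => t _; exact: ce_ge0.
move=> /andP[sx pl] lT; have x0 : 0 <= x by exact: le_trans (ltW sx).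
have xl := path_lt_last_le pl.
have xT := le_trans xl lT.
rewrite (leb_Rintegral_split (ltW sx) xl); last exact: ice_sub.
by rewrite lerD// ?IH// step_cost_integral.
Qed.

Let variation_le s t : 0 <= s -> s <= t -> t <= T ->
  (conj_variation xi s t <= (\int[leb]_(t in `[s, t]%classic) ce t)%:E)%E.
Proof.
move=> s0 st tT; apply: ge_ereal_sup => _ [l [pl /eqP lt] <-].
by rewrite -[X in (X <= _)%E]/(conj_sum s s l) conj_sumE// lee_fin -lt partition_cost_le ?lt.
Qed.

Let variation_ge s t l : 0 <= s -> path <%R s l -> last s l = t ->
  ((partition_cost s l)%:E <= conj_variation xi s t)%E.
Proof.
move=> s0 pl lt; apply: ereal_sup_ubound; exists l; first by split => //; exact/eqP.
by rewrite -[LHS]/(conj_sum s s l) conj_sumE.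
Qed.

Let variation_ge0 s t : 0 <= s -> s <= t -> (0 <= conj_variation xi s t)%E.
Proof.
move=> s0; rewrite le_eqVlt => /predU1P[<-|st].
  exact: (@variation_ge s s [::]).
apply: le_trans (@variation_ge s t [:: t] s0 _ erefl); last by rewrite /= st.
by rewrite lee_fin /= addr0 step_cost_ge0// ltW.
Qed.

Lemma rvariationE s t : 0 <= s -> s <= t -> t <= T ->
  conj_variation xi s t = (rvariation s t)%:E.
Proof.
move=> s0 st tT; rewrite /rvariation fineK// ge0_fin_numE ?variation_ge0//.
exact: le_lt_trans (variation_le s0 st tT) (ltry _).
Qed.

Lemma rvariation_le s t : 0 <= s -> s <= t -> t <= T ->
  rvariation s t <= \int[leb]_(t in `[s, t]%classic) ce t.
Proof. by move=> s0 st tT; rewrite -lee_fin -rvariationE// variation_le. Qed.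

Lemma rvariation_ge s t l : 0 <= s -> path <%R s l -> last s l = t -> s <= t -> t <= T ->
  partition_cost s l <= rvariation s t.
Proof. by move=> s0 pl lt st tT; rewrite -lee_fin -rvariationE// variation_ge. Qed.

Lemma rvariation_ge0 s t : 0 <= s -> s <= t -> t <= T -> 0 <= rvariation s t.
Proof. by move=> s0 st tT; rewrite -lee_fin -rvariationE// variation_ge0. Qed.

Lemma rvariation_ub s t (c : R) : 0 <= s -> s <= t -> t <= T ->
  (forall l, path <%R s l -> last s l = t -> partition_cost s l <= c) -> rvariation s t <= c.
Proof.
move=> s0 st tT H; rewrite -lee_fin -rvariationE//; apply: ge_ereal_sup => _ [l [pl /eqP lt] <-].
by rewrite -[X in (X <= _)%E]/(conj_sum s s l) conj_sumE// lee_fin H.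
Qed.

Lemma rvariation_superadditive s a b : 0 <= s -> s <= a -> a < b -> b <= T ->
  rvariation s a + step_cost a b <= rvariation s b.
Proof.
move=> s0 sa ab bT; rewrite -lerBrDr; apply: rvariation_ub => //.
  exact: le_trans (ltW ab) bT.
move=> l pl la; rewrite lerBrDr.
have -> : partition_cost s l + step_cost a b = partition_cost s (rcons l b).
  rewrite -la; elim: l s {pl la s0 sa} => [|x l IH] s /=; first by rewrite addr0 add0r.
  by rewrite -addrA IH.
apply: rvariation_ge => //; first by rewrite rcons_path pl la.
- by rewrite last_rcons.
- exact: le_trans sa (ltW ab).
Qed.

Lemma step_cost_rvariation s x a : 0 <= s -> s < x -> x <= a -> a <= T ->
  step_cost s x + rvariation x a <= rvariation s a.
Proof.
move=> s0 sx xa aT; have x0 := le_trans s0 (ltW sx).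
rewrite addrC -lerBrDr; apply: rvariation_ub => // l pl la; rewrite lerBrDr addrC.
apply: (@rvariation_ge s a (x :: l)) => //=; first by rewrite sx.
exact: le_trans (ltW sx) xa.
Qed.

(** Steps before [a] are charged to the variation on [[s, a]] and steps after it to the integral by
    Jensen; the step straddling [a] is first cut there, which does not decrease the cost. This
    bounds the increments of the variation by an integral, hence gives it a density. *)
Lemma rvariation_subadditive s a b : 0 <= s -> s <= a -> a <= b -> b <= T ->
  rvariation s b <= rvariation s a + \int[leb]_(t in `[a, b]%classic) ce t.
Proof.
move=> s0 sa ab bT; have sb := le_trans sa ab; have aT := le_trans ab bT.
apply: rvariation_ub => // l; elim: l s s0 sa sb => [|x l IH] s s0 sa sb /=.
  by move=> _ _; rewrite addr_ge0 ?rvariation_ge0//; apply: Rintegral_ge0 => t _; exact: ce_ge0.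
move=> /andP[sx pl] lb; have x0 : 0 <= x by exact: le_trans (ltW sx).
have xb : x <= b by rewrite -lb; exact: path_lt_last_le.
have [xa|ax] := leP x a.
  apply: le_trans (lerD (lexx _) (IH _ x0 xa xb pl lb)) _.
  by rewrite addrA lerD2r; exact: step_cost_rvariation.
have pc : partition_cost x l <= \int[leb]_(t in `[x, b]%classic) ce t.
  by rewrite -lb; apply: partition_cost_le => //; rewrite lb.
have a0 := le_trans s0 sa.
rewrite (leb_Rintegral_split (ltW ax) xb); last exact: ice_sub.
have ci := step_cost_integral a0 ax (le_trans xb bT).
suff H : step_cost s x <= rvariation s a + step_cost a x.
  by rewrite addrA lerD//; apply: (le_trans H); rewrite lerD2l.
move: sa; rewrite le_eqVlt => /predU1P[->|sa'].
  by rewrite lerDr rvariation_ge0.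
apply: le_trans (step_cost_convex s0 sa' ax) _; rewrite lerD2r.
have := @rvariation_ge s a [:: a] s0; rewrite /= addr0 => -> //; [by rewrite sa'|exact: ltW].
Qed.

Hypothesis derivative_xi : {ae leb, forall t : R, 0 <= t -> weak_star_derivative_at xi t (xidot t)}.

Lemma rvariationE_integral s t : 0 <= s -> s <= t -> t <= T ->
  rvariation s t = \int[leb]_(t in `[s, t]%classic) ce t.
Proof.
move=> s0 st tT; apply/eqP; rewrite eq_le rvariation_le//=.
have sT := le_trans st tT.
have inc a b : s <= a -> a <= b -> b <= T ->
    `|rvariation s b - rvariation s a| <= \int[leb]_(t in `[a, b]%classic) ce t.
  move=> sa ab bT; rewrite ger0_norm.
    by rewrite lerBlDl; exact: rvariation_subadditive.
  move: ab; rewrite le_eqVlt => /predU1P[<-|ab]; first by rewrite subrr.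
  rewrite subr_ge0; apply: le_trans _ (rvariation_superadditive s0 sa ab bT).
  by rewrite lerDl step_cost_ge0// ltW.
have [psi [ipsi WE aeW]] := ac_density_itv sT (ice_sub s0 (lexx T)) (fun t _ _ => ce_ge0 t) inc.
have ae2 : {ae leb, forall x : R, s < x -> x < t -> ce x <= psi x}.
  apply: ae_imply (fun x h => h) _.
  have H := negligibleU aeW derivative_xi; apply: negligibleS H => x /= H.
  apply: contrapT => /not_orP[/contrapT W1 /contrapT W2]; apply: H => sx xt.
  have x0 : 0 <= x := le_trans s0 (ltW sx).
  have := W1 sx (lt_le_trans xt tT) => {}W1; have {}W2 := W2 x0.
  rewrite -lee_fin /ce -energy_conjE; last exact: Pdot.
  (* Lower semicontinuity of [E^*] one minorant at a time: for fixed [g] the lower bound on the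
     difference quotient passes to the limit, and the supremum over [g] comes last. *)
  apply: energy_conj_le => g Cg; have Cg' := calC_C_S2 Cg.
  have {}W2 := W2 g Cg'.
  pose u (n : nat) : R := (T - x) / n.+2%:R.
  have Tx : 0 < T - x by rewrite subr_gt0 (lt_le_trans xt tT).
  have u0 n : 0 < u n by rewrite divr_gt0.
  have uT n : x + u n <= T.
    by rewrite -lerBrDl ler_pdivrMr// ler_peMr ?(ltW Tx)// ler1n.
  have uc : u n @[n --> \oo] --> 0.
    rewrite -(mulr0 (T - x)); apply: cvgM; first exact: cvg_cst.
    exact: cvg_natSSinv.
  have W1n : (rvariation s (x + u n) - rvariation s x) / u n @[n --> \oo] --> psi x.
    move/cvgr_dnbhsP : W1; apply; split => // n; by rewrite gt_eqF.
  have W2n : pairing (cscale (u n)^-1 (csub (xi (x + u n)) (xi x))) g - renergy g @[n --> \oo] -->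
      pairing (xidot x) g - renergy g.
    apply: cvgB; last exact: cvg_cst.
    move/cvgr_dnbhsP : W2; apply; split => // n; by rewrite gt_eqF.
  apply: (ler_cvg_to W2n W1n); apply: nearW => n.
  have xu : x < x + u n by rewrite ltrDl.
  rewrite ler_pdivlMr// pairing_cscale// pairing_csub//.
  have A := step_cost_ge x0 xu Cg; have B := rvariation_superadditive s0 (ltW sx) xu (uT n).
  have E : x + u n - x = u n by rewrite addrAC subrr add0r.
  rewrite lerBrDl; apply: le_trans _ B; rewrite lerD2l; apply: le_trans _ A.
  rewrite E mulrBl mulrAC mulVf ?gt_eqF// mul1r [renergy g * _]mulrC.
  exact: lexx.
have := WE s t (lexx s) st tT.
have V0 : rvariation s s = 0.
  apply/eqP; rewrite eq_le rvariation_ge0// andbT.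
  have := rvariation_le s0 (lexx s) sT; rewrite leb_Rintegral_point//; exact: ice_sub.
rewrite V0 subr0 => ->; apply: ae_itv_le_Rintegral => //.
- exact: ice_sub.
- exact: leb_integrable_sub (lexx s) tT ipsi.
Qed.

End variation.

(** * Energy balance along a classical solution *)

Section density.
Context {R : realType}.
Local Notation leb := (@completed_lebesgue_measure R).
Variables xi xidot : R -> M_S2 R.
Hypothesis Pxi : Pperp_curve xi.
Hypothesis ACxi : absolutely_continuous_curve xi xidot.
Variable g : R -> S2 R -> R.
Hypothesis mg : class_measurable g.
Hypothesis inclusion : {ae leb, forall t : R, 0 <= t ->
  dual_J (xi t) (g t) /\ d_energy_conj (xidot t) (fun u => - g t u)}.

Let Pdot : Pperp_curve xidot. Proof. by case: ACxi => _ []. Qed.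
Let phi := half_sqr_norm xi.

Let dual_J_le (x h : R) : 0 <= x -> 0 <= x + h -> dual_J (xi x) (g x) ->
  pairing (csub (xi (x + h)) (xi x)) (g x) <= phi (x + h) - phi x.
Proof.
move=> x0 xh0 [Cg /(_ _ (Pxi xh0))]; rewrite -EFinD lee_fin.
by rewrite lerBrDl.
Qed.

(* The subdifferential inequality of [phi] bounds the right difference quotients
   from below and the left ones from above. *)
Let chain_rule (x psi : R) : 0 < x -> (phi (x + h) - phi x) / h @[h --> 0^'] --> psi ->
  weak_star_derivative_at xi x (xidot x) -> dual_J (xi x) (g x) ->
  psi = pairing (xidot x) (g x).
Proof.
move=> x0 cphi cxi J; have Cg := J.1; have {}cxi := cxi _ Cg.
pose u (n : nat) : R := x / n.+2%:R.
have u0 n : 0 < u n by rewrite divr_gt0.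
have ux n : u n <= x by rewrite ler_pdivrMr// ler_peMr ?(ltW x0)// ler1n.
have uc : u n @[n --> \oo] --> 0.
  by rewrite -(mulr0 x); apply: cvgM; [exact: cvg_cst|exact: cvg_natSSinv].
have Nuc : - u n @[n --> \oo] --> 0 by rewrite -oppr0; exact: cvgN.
have c1 : (phi (x + u n) - phi x) / u n @[n --> \oo] --> psi.
  by move/cvgr_dnbhsP : cphi; apply; split => // n; rewrite gt_eqF.
have c2 : (phi (x + - u n) - phi x) / - u n @[n --> \oo] --> psi.
  by move/cvgr_dnbhsP : cphi; apply; split => // n; rewrite oppr_eq0 gt_eqF.
have d1 : pairing (cscale (u n)^-1 (csub (xi (x + u n)) (xi x))) (g x) @[n --> \oo] -->
    pairing (xidot x) (g x).
  by move/cvgr_dnbhsP : cxi; apply; split => // n; rewrite gt_eqF.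
have d2 : pairing (cscale (- u n)^-1 (csub (xi (x + - u n)) (xi x))) (g x) @[n --> \oo] -->
    pairing (xidot x) (g x).
  by move/cvgr_dnbhsP : cxi; apply; split => // n; rewrite oppr_eq0 gt_eqF.
apply/eqP; rewrite eq_le; apply/andP; split.
  apply: (ler_cvg_to c2 d2); apply: nearW => n.
  have xu : 0 <= x + - u n by rewrite subr_ge0.
  have H := dual_J_le (ltW x0) xu J.
  rewrite pairing_cscale// mulrC ler_wnM2l// invr_le0 oppr_le0 ltW//.
apply: (ler_cvg_to d1 c1); apply: nearW => n.
have xu : 0 <= x + u n by rewrite addr_ge0// ltW.
have H := dual_J_le (ltW x0) xu J.
by rewrite pairing_cscale// [leRHS]mulrC ler_wpM2l// invr_ge0 ltW.
Qed.

Let ce (t : R) : R := renergy_conj (xidot t).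
Let eg (t : R) : R := renergy (g t).

(** Quantified over all possible limits [psi], so that it can be combined with the density of [phi]
    on any bounded interval. *)
Let ae_identity : {ae leb, forall t : R, 0 < t -> forall psi : R,
  (phi (t + h) - phi t) / h @[h --> 0^'] --> psi ->
  calC (g t) /\ psi = - ce t - eg t}.
Proof.
case: ACxi => ae1 _ _; have H := negligibleU ae1 inclusion; apply: negligibleS H => t /= H.
apply: contrapT => /not_orP[/contrapT W1 /contrapT W2]; apply: H => t0 psi cpsi.
have [J D] := W2 (ltW t0); have {}W1 := W1 (ltW t0).
have [C E] := d_energy_conjP (Pdot (ltW t0)) J.1 D.
split=> //; rewrite (chain_rule t0 cpsi W1 J) /ce E /eg; ring.
Qed.

(** The integrability of [E^*(xi')] and of [E(g)] comes from the identity itself: both are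
    nonnegative and their sum is almost everywhere the integrable function [- psi]. *)
Lemma energy_balance (T : R) : 0 <= T ->
  [/\ leb.-integrable `[0, T]%classic (EFin \o (ce : time R -> R)),
   leb.-integrable `[0, T]%classic (EFin \o (eg : time R -> R)),
   {ae leb, forall t : R, 0 < t -> t < T -> calC (g t)} &
   forall s t, 0 <= s -> s <= t -> t <= T ->
     phi s - phi t = \int[leb]_(x in `[s, t]%classic) ce x + \int[leb]_(x in `[s, t]%classic) eg x].
Proof.
move=> T0; have [N N0 hN] := half_sqr_norm_increment Pxi ACxi T0.
have mD : measurable (`[0, T]%classic : set (time R)) by exact: measurable_time_itv.
have iN := integrableZl mD N (dual_norm_integrable ACxi T (lexx 0)).
have k0 t : 0 <= t -> t <= T -> 0 <= N * dual_norm (xidot t).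
  by move=> t0 tT; rewrite mulr_ge0// dual_norm_ge0//; exact: Pdot.
have [psi [ipsi WE aeW]] := ac_density_itv T0 iN k0 hN.
have key : {ae leb, forall t : R, 0 < t -> t < T -> calC (g t) /\ psi t = - ce t - eg t}.
  have H := negligibleU aeW ae_identity; apply: negligibleS H => t /= H.
  apply: contrapT => /not_orP[/contrapT W1 /contrapT W2]; apply: H => t0 tT.
  by apply: W2 => //; exact: W1.
have aeC : {ae leb, forall t : R, 0 < t -> t < T -> calC (g t)}.
  by apply: (ae_imply _ key) => t H t0 tT; have [] := H t0 tT.
have sub : (`[0, T]%classic : set (time R)) `<=` @nonneg_times R.
  by move=> t /=; rewrite in_itv/= => /andP[].
have mN := @measurable_nonneg_times R.
have meg : measurable_fun (`[0, T]%classic : set (time R)) (eg : time R -> R).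
  have m := measurable_funS mN sub (class_measurable_energy mg).
  have mf : measurable_fun setT (@fine R) by exact: fine_measurable.
  exact: (measurableT_comp mf m).
have mpsi : measurable_fun (`[0, T]%classic : set (time R)) (psi : time R -> R).
  by apply/measurable_EFinP; exact: (measurable_int _ ipsi).
(* Almost everywhere [0 <= eg <= - psi], so the truncation changes [eg] only on a null set, while it
   is bounded by [|psi|] at every time. *)
pose eg' : time R -> R := fun t => Num.max 0 (Num.min (eg t) (- psi t)).
have ieg' : leb.-integrable `[0, T]%classic (EFin \o eg').
  apply: (le_integrable mD _ _ ipsi).
    apply/measurable_EFinP; apply: measurable_maxr; first exact: measurable_cst.
    by apply: measurable_minr; [exact: meg|exact: (measurableT_comp _ mpsi)].
  move=> t _ /=; rewrite lee_fin ger0_norm ?le_max ?lexx// ge_max normr_ge0/= ge_min.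
  by apply/orP; right; rewrite -normrN ler_norm.
have ieg : leb.-integrable `[0, T]%classic (EFin \o (eg : time R -> R)).
  apply: (ae_itv_eq_integrable _ ieg'); apply: (ae_imply _ key) => t H t0 tT.
  have [C E] := H t0 tT; rewrite /eg' E opprD !opprK.
  have c0 : 0 <= ce t by rewrite fine_ge0// energy_conj_ge0.
  have e0 := renergy_ge0 C; rewrite min_l ?lerDr// max_r//.
have ice : leb.-integrable `[0, T]%classic (EFin \o (ce : time R -> R)).
  (* [ce] is reached as the difference [- psi - eg], both terms of which are already integrable. *)
  have iN' : leb.-integrable `[0, T]%classic (EFin \o (fun t : time R => -1 * psi t - eg t)).
    exact: (integrableB mD (integrableZl mD (-1) ipsi) ieg).
  apply: (ae_itv_eq_integrable _ iN'); apply: (ae_imply _ key) => t H t0 tT.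
  by have [C E] := H t0 tT; rewrite E; ring.
split=> // s t s0 st tT.
have mst : measurable (`[s, t]%classic : set (time R)) by exact: measurable_time_itv.
have i1 := leb_integrable_sub s0 tT ice; have i2 := leb_integrable_sub s0 tT ieg.
have i3 := leb_integrable_sub s0 tT ipsi.
have E1 := RintegralD mst i1 i2; rewrite -E1.
have E2 := RintegralZl (-1) mst i3.
have -> : phi s - phi t = \int[leb]_(x in `[s, t]%classic) (-1 * psi x).
  by apply: etrans _ (esym E2); rewrite mulN1r -WE// opprB.
apply: ae_itv_eq_Rintegral; last exact: (integrableZl mst (-1) i3).
apply: (ae_imply _ key) => x H sx xt.
have [_ ->] := H (le_lt_trans s0 sx) (lt_le_trans xt tT).
ring.
Qed.

End density.

Theorem lemma4p2 (R : realType) (xi : R -> M_S2 R) :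
  classical_solution xi -> weak_solution xi.
Proof.
move=> [Pxi [xidot AC [g mg incl]]]; have [aeD _ _] := AC.
have EB := energy_balance Pxi AC mg incl.
split; [exact: Pxi|exact: (curve_weak_star_measurable AC)| |].
  move=> s t s0 st; have [ice _ _ _] := EB _ (le_trans s0 st).
  by rewrite (rvariationE Pxi AC ice s0 st (lexx t)) ltry.
exists g; first exact: mg.
split.
  by apply: (ae_imply _ incl) => t H t0; have [] := H t0.
(* The balance is available for all [0 <= s <= t], whence an empty exceptional set. *)
exists set0; first exact: negligible_set0.
move=> s t s0 st _ _; have t0 := le_trans s0 st.
have [ice ieg aeC bal] := EB _ t0.
rewrite (rvariationE Pxi AC ice s0 st (lexx t)).
rewrite (rvariationE_integral Pxi AC ice aeD s0 st (lexx t)).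
have mD : measurable (`[s, t]%classic : set (time R)) by exact: measurable_time_itv.
have i2 := leb_integrable_sub s0 (lexx t) ieg.
have fi := integrable_fin_num mD i2.
have sub : (`[s, t]%classic : set (time R)) `<=` @nonneg_times R.
  by move=> x /=; rewrite in_itv/= => /andP[+ _]; exact: le_trans.
have mN := @measurable_nonneg_times R.
(* [energy (g tau)] may be [+oo] on a null set of times, where [renergy] has the default value of
   [fine]; elsewhere [g tau] belongs to [calC]. *)
have E : (\int[@completed_lebesgue_measure R]_(tau in `[s, t]%classic) energy (g tau) =
    (\int[@completed_lebesgue_measure R]_(tau in `[s, t]%classic) renergy (g tau))%:E)%E.
  rewrite /Rintegral fineK//; apply: ae_eq_integral; first exact: mD.
  - exact: (measurable_funS mN sub (class_measurable_energy mg)).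
  - exact: (measurable_int _ i2).
  - have H : {ae @completed_lebesgue_measure R, forall x : R, s < x -> x < t ->
        energy (g x) = (renergy (g x))%:E}.
      apply: (ae_imply _ aeC) => x C sx xt.
      by have [] := renergyP (C (le_lt_trans s0 sx) xt).
    by apply: (ae_imply _ (ae_interior H)) => x.
rewrite E -EFinD; congr (_ %:E); exact: (bal s t s0 st (lexx t)).
Qed.
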